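(* If $f$ is a conformal mapping on the unit disk $\mathbb{D}$, then $f\in A_\alpha^p(\mathbb{D})$ for every $p>0$ and $\alpha>-1$ such that $\frac{p}{\alpha+2}\in\left(0,\frac12\right)$. Moreover, the inequality $\frac{p}{\alpha+2}<\frac12$ is sharp.
   Context: A conformal mapping on $\mathbb{D}$ is an injective holomorphic function $f:\mathbb{D}\to\mathbb{C}$. For $p>0$, $\alpha>-1$, the weighted Bergman space $A_\alpha^p(\mathbb{D})$ is the set of holomorphic $f$ on $\mathbb{D}$ with $\int_{\mathbb{D}}|f(z)|^p(1-|z|^2)^\alpha\,dA(z)<\infty$, where $dA$ is Lebesgue area measure. *)

(* Defs.v *)
From HB Require Import structures.
From mathcomp Require Import all_boot all_order all_algebra.
From mathcomp Require Import complex.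
From mathcomp Require Import all_classical all_reals all_analysis.

Set Implicit Arguments.
Unset Strict Implicit.
Unset Printing Implicit Defensive.

Import Order.TTheory GRing.Theory Num.Theory numFieldNormedType.Exports.

Local Open Scope classical_set_scope.
Local Open Scope ring_scope.
Local Open Scope complex_scope.

(* Functions on a subset of the complex plane are represented by total functions
   R[i] -> R[i]; all notions below only depend on their values on the disk. *)

Definition unit_disk (R : realType) : set R[i] := [set z | Normc.normc z < 1].

(* The scalar field of R[i]^o is R[i] itself, so derivability in the direction
   1 is existence of the limit of (f (z + h) - f z) / h as the complex number h
   tends to 0, i.e. complex differentiability at z. *)
Definition holomorphic_on (R : realType) (D : set R[i]) (f : R[i] -> R[i]) : Prop :=
  forall z, D z -> derivable (f : R[i]^o -> R[i]^o) z 1.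

Definition conformal_mapping (R : realType) (f : R[i] -> R[i]) : Prop :=
  holomorphic_on (@unit_disk R) f /\ set_inj (@unit_disk R) f.

(* Integral of a function against Lebesgue area measure dA over a subset of the
   complex plane, identified with R * R through (x, y) |-> x +i* y. *)
Definition area_integral (R : realType) (D : set R[i]) (g : R[i] -> \bar R) : \bar R :=
  (\int[(@lebesgue_measure R \x @lebesgue_measure R)%E]_(w in
     [set w : R * R | D (w.1 +i* w.2)]) g (w.1 +i* w.2))%E.

Definition bergman_space (R : realType) (p alpha : R) : set (R[i] -> R[i]) :=
  [set f | holomorphic_on (@unit_disk R) f /\
    (area_integral (@unit_disk R)
       (fun z => ((Normc.normc (f z) `^ p) *
                  ((1 - Normc.normc z ^+ 2) `^ alpha))%:E) < +oo)%E].

(* Main.v *)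
From HB Require Import structures.
Require Import Defs.
From mathcomp Require Import all_boot all_order all_algebra.
From mathcomp Require Import complex.
From mathcomp Require Import all_classical all_reals all_analysis.
From mathcomp Require Import measurable_realfun.
From mathcomp Require Import ring lra.

(* Write W for the weight (1 - |z|^2)^alpha. Rotation invariance of area lets one
   average over circles, so it suffices to bound means of functions of |f|. When
   f 0 = 0 and |f| < s on |z| <= r1, the mean of ln (max |f| s) over |z| = r is at
   most ln s + ln (r / r1): integrate ln |f - w| over |w| = s and use that f - w
   has at most one zero. Koebe's growth estimate |f z - f 0| <= C / (1 - |z|)^2
   allows s = s0 4^n with r1 = 1 - 2^-(n+1), |f|^p is dominated by a multiple of
   the sum over n of 4^(n p) (ln (max |f| s) - ln s), and the integrals of these
   terms against W form a geometric series that converges when 2 p < alpha + 2.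

   The growth estimate follows from |g' 0| <= 4 |g 0| for nonvanishing univalent g.
   With h a square root of g, the image of the uniform measure of a circle under h
   minus its image under - h has total mass 0, so its logarithmic energy has a sign.
   As h z + h w and (h z - h w) / (z - w) never vanish, the energy is computed by
   mean values, and its sign is the wanted inequality.

   Sharpness is witnessed by (1 - z)^-2: the boxes of side h = 2^-(k+3) at distance
   about h from 1 each contribute at least a fixed amount when 2 p >= alpha + 2. *)

Set Implicit Arguments.
Unset Strict Implicit.
Unset Printing Implicit Defensive.

Import Order.TTheory GRing.Theory Num.Theory numFieldNormedType.Exports.

Local Open Scope classical_set_scope.
Local Open Scope ring_scope.
Local Open Scope complex_scope.

(** The growth estimate alone gives [|f|^p <= C (1 - |z|)^(-2p)], hence integrability only for
    [2 p < alpha + 1]. The missing power of [1 - |z|] comes from averaging over circles: at level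
    [s] the excess [ln (max |f| s) - ln s] vanishes for [|z| <= r1] and has mean at most
    [ln (r / r1)], of order [1 - r1]. The base [4] matches the growth exponent [2]: halving the
    distance to the unit circle multiplies the bound on [|f|] by [4]. Univalence enters through the
    nonvanishing of difference quotients: their logarithms have exact circle means, which take the
    place of power series, area formulas and Green's identity. The only contour integration is
    Goursat's argument on rectangles in logarithmic polar coordinates. Logarithms with singularities
    are replaced by [ln (|.|^2 + e)], so that integrands on circles are continuous, and [e] is
    chosen at the end with an explicit error. *)

Local Notation normc := Normc.normc.

(** * Complex differentiability at a point *)

Section normc_theory.
Variable R : realType.
Implicit Types z w : R[i].

Lemma normCE z : `|z| = (normc z)%:C.
Proof. by case: z. Qed.

Lemma nc0 : normc (0 : R[i]) = 0.
Proof. exact: Normc.normc0. Qed.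

Lemma nc1 : normc (1 : R[i]) = 1.
Proof. exact: Normc.normc1. Qed.

Lemma normc_ge0 z : 0 <= normc z.
Proof. by case: z => a b; exact: sqrtr_ge0. Qed.

Lemma normc_eq0 z : (normc z == 0) = (z == 0).
Proof. by apply/eqP/eqP => [/Normc.eq0_normc//|->]; exact: nc0. Qed.

Lemma normc_gt0 z : (0 < normc z) = (z != 0).
Proof. by rewrite lt_def normc_ge0 andbT normc_eq0. Qed.

Lemma ler_normcD z w : normc (z + w) <= normc z + normc w.
Proof. exact: le_normcD. Qed.

Lemma normcB z w : normc (z - w) = normc (w - z).
Proof. by rewrite -normcN opprB. Qed.

Lemma ler_distc_add u z w : normc (z - w) <= normc (z - u) + normc (u - w).
Proof. by apply: le_trans (ler_normcD _ _); rewrite addrA subrK. Qed.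

Lemma ler_normcB_dist z w : normc z - normc w <= normc (z - w).
Proof. by rewrite lerBlDr; apply: le_trans (ler_normcD _ _); rewrite subrK. Qed.

Lemma ler_dist_normc z w : `|normc z - normc w| <= normc (z - w).
Proof. by rewrite ler_norml lerNl opprB ler_normcB_dist normcB ler_normcB_dist. Qed.

Lemma normcR (x : R) : normc x%:C = `|x|.
Proof. by rewrite /= expr0n addr0 sqrtr_sqr. Qed.

Lemma normcX z n : normc (z ^+ n) = normc z ^+ n.
Proof. by elim: n => [|n IH]; rewrite ?nc1 // !exprS Normc.normcM IH. Qed.

Lemma sqr_normcE z : normc z ^+ 2 = complex.Re z ^+ 2 + complex.Im z ^+ 2.
Proof. by case: z => a b /=; rewrite sqr_sqrtr // addr_ge0 ?sqr_ge0. Qed.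

Lemma ler_Re_normc z : `|complex.Re z| <= normc z.
Proof.
rewrite -(@ler_pXn2r _ 2) ?nnegrE ?normc_ge0 // sqr_normcE real_normK ?num_real //.
by rewrite lerDl sqr_ge0.
Qed.

Lemma ler_Im_normc z : `|complex.Im z| <= normc z.
Proof.
rewrite -(@ler_pXn2r _ 2) ?nnegrE ?normc_ge0 // sqr_normcE real_normK ?num_real //.
by rewrite lerDr sqr_ge0.
Qed.

Lemma ler_normc_ReIm z : normc z <= `|complex.Re z| + `|complex.Im z|.
Proof.
rewrite -(@ler_pXn2r _ 2) ?nnegrE ?normc_ge0 ?addr_ge0 // sqr_normcE.
rewrite sqrrD !real_normK ?num_real // addrAC lerDl.
by rewrite mulrn_wge0 // mulr_ge0.
Qed.

End normc_theory.

Section complex_continuity.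
Variable R : realType.
Implicit Types (F G : R[i] -> R[i]) (z w : R[i]).
Let K : numFieldType := R[i].

(** Continuity with real radii: the norm of [R[i]] is valued in [R[i]], so the balls of its
    canonical topology have complex radii. [ctP] imports the algebra of limits. *)
Definition ct F z := forall e : R, 0 < e ->
  exists2 d, 0 < d & forall w, normc (w - z) < d -> normc (F w - F z) < e.

Lemma ctP F z : ct F z <-> ((F : K -> K) x @[x --> (z : K)] --> (F z : K)).
Proof.
split.
  move=> h; apply/(@cvgrPdist_lt K K _ (nbhs (z : K)) (nbhs_filter (z : K))) => /= e.
  case: e => [a b]; rewrite ltcE /= => /andP[/eqP-> a0].
  have [d d0 hd] := h _ a0.
  near=> w. rewrite -normrN opprB normCE ltcR. apply: hd.
  rewrite -ltcR -normCE -normrN opprB. near: w.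
  by apply/nbhs_ballP; exists (d%:C : K) => //=; rewrite ltcR.
move/(@cvgrPdist_lt K K _ (nbhs (z : K)) (nbhs_filter (z : K))) => h e e0.
have : 0 < (e%:C : K) by rewrite ltcR.
move=> /h /nbhs_ballP[[d d'] /=]. rewrite ltcE /= => /andP[/eqP-> d0] hd.
exists d => // w hw. have := hd w. rewrite -ltcR -normCE -normrN opprB; apply.
by rewrite /ball /= -normrN opprB normCE ltcR.
Unshelve. all: by end_near. Qed.

Lemma ctD F G z : ct F z -> ct G z -> ct (fun w => F w + G w) z.
Proof. by move=> /ctP h1 /ctP h2; apply/ctP; exact: cvgD h1 h2. Qed.

Lemma ctM F G z : ct F z -> ct G z -> ct (fun w => F w * G w) z.
Proof.
by move=> /ctP h1 /ctP h2; apply/ctP; exact: (@cvgM K _ (nbhs (z : K)) _ F G _ _ h1 h2).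
Qed.

Lemma ctV F z : F z != 0 -> ct F z -> ct (fun w => (F w)^-1) z.
Proof.
by move=> h /ctP h2; apply/ctP; exact: (@cvgV K _ (nbhs (z : K)) _ F _ h h2).
Qed.

Lemma ct_comp F G z : ct F (G z) -> ct G z -> ct (fun w => F (G w)) z.
Proof.
move=> h1 h2 e e0. have [d d0 hd] := h1 _ e0. have [d' d'0 hd'] := h2 _ d0.
by exists d' => // w /hd'; exact: hd.
Qed.

Lemma ct_cst (a : R[i]) z : ct (fun=> a) z.
Proof. by move=> e e0; exists 1 => // w _; rewrite subrr nc0. Qed.

Lemma ct_id z : ct id z.
Proof. by move=> e e0; exists e. Qed.

Lemma ctN F z : ct F z -> ct (fun w => - F w) z.
Proof. by move=> h e /h[d d0 hd]; exists d => // w /hd; rewrite -opprD normcN. Qed.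

Lemma ctB F G z : ct F z -> ct G z -> ct (fun w => F w - G w) z.
Proof. by move=> hF hG; apply: ctD => //; exact: ctN. Qed.

Definition locally_eq F G z :=
  exists2 d : R, 0 < d & forall w, normc (w - z) < d -> F w = G w.

Lemma locally_eq_at F G z : locally_eq F G z -> F z = G z.
Proof. by case=> d d0; apply; rewrite subrr nc0. Qed.

Lemma ct_locally F G z : locally_eq F G z -> ct F z -> ct G z.
Proof.
move=> fg h e /h[d d0 hd]; case: (fg) => d' d'0 hd'.
exists (Num.min d d') => [|w]; first by rewrite lt_min d0.
by rewrite lt_min => /andP[/hd h1 /hd' <-]; rewrite -(locally_eq_at fg).
Qed.

(** Caratheodory's form of the derivative: the difference quotient [P] is a function continuous at
    [z], which turns the product and chain rules into ring identities. *)
Definition cder F z l := exists P, [/\ ct P z, P z = l & forall w, F w = F z + P w * (w - z)].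

Lemma cder_ct F z l : cder F z l -> ct F z.
Proof.
case=> P [hP _ hF].
have h : ct (fun w => F z + P w * (w - z)) z.
  by apply: ctD; [exact: ct_cst|apply: ctM => //; apply: ctB; [exact: ct_id|exact: ct_cst]].
by move=> e /h[d d0 hd]; exists d => // w /hd; rewrite -hF subrr mulr0 addr0.
Qed.

Lemma cderE F z l : cder F z l <->
  ct (fun w => if w == z then l else (F w - F z) / (w - z)) z.
Proof.
split=> [[P [hP <- hF]]|h].
  apply: ct_locally hP; exists 1 => // w _; case: eqP => [->//|/eqP wz].
  by rewrite [F w]hF addrC addKr mulfK // subr_eq0.
exists (fun w => if w == z then l else (F w - F z) / (w - z)); split=> //; first by rewrite eqxx.
move=> w; case: eqP => [->|/eqP wz]; first by rewrite subrr mulr0 addr0.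
by rewrite divfK ?subr_eq0 // addrC subrK.
Qed.

Lemma cder_locally F G z l : locally_eq F G z -> cder F z l -> cder G z l.
Proof.
move=> fg /cderE h; apply/cderE; apply: ct_locally h.
by case: (fg) => d d0 hd; exists d => // w /hd ->; rewrite (locally_eq_at fg).
Qed.

Lemma cder_cst a z : cder (fun=> a) z 0.
Proof. by exists (fun=> 0); split=> // [|w]; [exact: ct_cst|rewrite mul0r addr0]. Qed.

Lemma cder_id z : cder id z 1.
Proof. by exists (fun=> 1); split=> // [|w]; [exact: ct_cst|rewrite mul1r addrC subrK]. Qed.

Lemma cderD F G z l m : cder F z l -> cder G z m -> cder (fun w => F w + G w) z (l + m).
Proof.
move=> [P [cP <- hP]] [Q [cQ <- hQ]]; exists (fun w => P w + Q w); split=> //.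
  exact: ctD.
by move=> w; rewrite {1}hP {1}hQ; ring.
Qed.

Lemma cderM F G z l m : cder F z l -> cder G z m ->
  cder (fun w => F w * G w) z (l * G z + F z * m).
Proof.
move=> hF hG; have cG := cder_ct hG.
case: hF hG => [P [cP <- hP]] [Q [cQ <- hQ]].
exists (fun w => P w * G w + F z * Q w); split=> //.
  by apply: ctD; apply: ctM => //; exact: ct_cst.
by move=> w; rewrite [F w]hP mulrDl {1}[G w]hQ; ring.
Qed.

Lemma cderN F z l : cder F z l -> cder (fun w => - F w) z (- l).
Proof.
move=> [P [cP <- hP]]; exists (fun w => - P w); split=> //; first exact: ctN.
by move=> w; rewrite {1}hP; ring.
Qed.

Lemma cderB F G z l m : cder F z l -> cder G z m -> cder (fun w => F w - G w) z (l - m).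
Proof. by move=> hF hG; apply: cderD => //; exact: cderN. Qed.

Lemma cder_comp F G z l m : cder F (G z) l -> cder G z m ->
  cder (fun w => F (G w)) z (l * m).
Proof.
move=> hF hG; have cG := cder_ct hG.
case: hF hG => [P [cP <- hP]] [Q [cQ <- hQ]].
exists (fun w => P (G w) * Q w); split=> //.
  by apply: ctM => //; exact: ct_comp.
by move=> w; rewrite [in LHS]hP {2}[G w]hQ; ring.
Qed.

Lemma cderV z : z != 0 -> cder (fun w => w^-1) z (- z^-2).
Proof.
move=> z0; apply/cderE.
apply: (@ct_locally (fun w => - (w^-1 * z^-1))); last first.
  by apply: ctN; apply: ctM; [apply: ctV => //; exact: ct_id|exact: ct_cst].
(* No point at distance less than [normc z] from [z] is [0]. *)
exists (normc z) => [|w]; rewrite ?normc_gt0 // => wz.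
case: eqP => [->|/eqP wnz]; first by rewrite -invfM expr2.
have w0 : w != 0 by apply: contraTneq wz => ->; rewrite sub0r normcN ltxx.
by field; rewrite subr_eq0 wnz z0 w0.
Qed.

Lemma cder_fV F z l : F z != 0 -> cder F z l -> cder (fun w => (F w)^-1) z (- l / F z ^+ 2).
Proof.
move=> Fz0 hF; have := cder_comp (cderV Fz0) hF.
by rewrite mulrC mulrN mulNr.
Qed.

Lemma cder_uniq F z l m : cder F z l -> cder F z m -> l = m.
Proof.
move=> /cderE hl /cderE hm; apply/eqP; rewrite -subr_eq0 -normc_eq0.
apply/negPn/negP => n0; set e := normc _ in n0.
have e0 : 0 < e / 2 by rewrite divr_gt0 // lt_def n0 normc_ge0.
have [d d0 hd] := hl _ e0; have [d' d'0 hd'] := hm _ e0.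
(* A real displacement below both radii yields two incompatible estimates of one quotient. *)
pose x : R := Num.min d d' / 2.
have x0 : 0 < x by rewrite divr_gt0 // lt_min d0.
have [md md'] : Num.min d d' <= d /\ Num.min d d' <= d' by rewrite !ge_min !lexx orbT.
have [xd xd'] : x < d /\ x < d' by move: x0; rewrite /x; split; lra.
have nz : z + x%:C != z.
  by rewrite -subr_eq0 addrC addKr -normc_eq0 normcR gtr0_norm // gt_eqF.
have hx : normc (z + x%:C - z) = x by rewrite addrC addKr normcR gtr0_norm.
have := hd (z + x%:C); rewrite hx => /(_ xd); rewrite (negPf nz) eqxx.
have := hd' (z + x%:C); rewrite hx => /(_ xd'); rewrite (negPf nz) eqxx.
set q := _ / _ => h1 h2; have := ler_distc_add q l m; rewrite -/e (normcB l).
by rewrite leNgt (lt_le_trans (ltrD h2 h1)) // -splitr.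
Qed.

Lemma derivable_cderP F z : derivable (F : R[i]^o -> R[i]^o) z 1 <-> exists l, cder F z l.
Proof.
have E (h : R[i]) : h != 0 -> (h^-1 *: (((F : R[i]^o -> R[i]^o) \o shift (z : R[i]^o))
    (h *: (1 : R[i]^o)) - F z) : R[i]^o) = (F (z + h) - F z) / (z + h - z).
  by move=> h0; rewrite [z + h]addrC addrK [RHS]mulrC /= [h *: _]mulr1.
have zh w : w != z -> w - z != 0 by rewrite subr_eq0.
split=> [/cvg_ex[/= l]|[l /cderE hl]].
  move/(@cvgrPdist_lt K (R[i]^o) _ _ (dnbhs_filter _)) => hl; exists l; apply/cderE => e e0.
  have /hl : 0 < (e%:C : K) by rewrite ltcR.
  move=> /nbhs_ballP[[d d'] /=]; rewrite ltcE /= => /andP[/eqP-> d0] hd.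
  exists d => // w wz; rewrite eqxx; case: eqP => [_|/eqP wnz]; first by rewrite subrr nc0.
  have := hd (w - z); rewrite /ball /= sub0r.
  rewrite normrN normCE ltcR => /(_ wz (zh _ wnz)).
  by rewrite E ?zh // [z + (w - z)]addrC subrK -normrN opprB !normCE ltcR.
apply/cvg_ex; exists (l : R[i]^o).
apply/(@cvgrPdist_lt K (R[i]^o) _ _ (dnbhs_filter _)) => -[e e'].
rewrite ltcE /= => /andP[/eqP-> e0]; have [d d0 hd] := hl _ e0.
apply/nbhs_ballP; exists (d%:C : K) => /=; first by rewrite ltcR.
move=> h; rewrite /ball /= sub0r normrN normCE ltcR => hd' h0.
have := hd (z + h); rewrite [z + h]addrC addrK => /(_ hd').
rewrite eqxx -subr_eq0 addrK (negPf h0) -normrN opprB normCE ltcR.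
by rewrite E // [z + h]addrC addrK.
Qed.

End complex_continuity.

(** * Cauchy theorem on rectangles *)

Section interval_integral.
Variable R : realType.
Implicit Types (a b c : R) (F G : R -> R).
Local Notation mu := (@lebesgue_measure R).

Definition itg a b F : R := \int[mu]_(x in `[a, b]) F x.

Definition cont_on a b F := forall x, a <= x <= b -> {for x, continuous F}.

Lemma cont_on_integrable a b F : cont_on a b F -> mu.-integrable `[a, b] (EFin \o F).
Proof.
move=> cF; apply: continuous_compact_integrable; first exact: segment_compact.
apply: continuous_in_subspaceT => x; rewrite inE /= in_itv /=; exact: cF.
Qed.

Lemma cont_on_sub a b a' b' F : a <= a' -> b' <= b -> cont_on a b F -> cont_on a' b' F.
Proof. by move=> h1 h2 h x /andP[h3 h4]; apply: h; lra. Qed.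

Lemma itgD a b F G : cont_on a b F -> cont_on a b G ->
  itg a b (fun x => F x + G x) = itg a b F + itg a b G.
Proof. by move=> cF cG; apply: RintegralD => //; exact: cont_on_integrable. Qed.

Lemma itgB a b F G : cont_on a b F -> cont_on a b G ->
  itg a b (fun x => F x - G x) = itg a b F - itg a b G.
Proof. by move=> cF cG; apply: RintegralB => //; exact: cont_on_integrable. Qed.

Lemma itgZ a b k F : cont_on a b F -> itg a b (fun x => k * F x) = k * itg a b F.
Proof. by move=> cF; apply: RintegralZl => //; exact: cont_on_integrable. Qed.

Lemma itg_cst a b k : a <= b -> itg a b (fun=> k) = k * (b - a).
Proof.
move=> ab; rewrite /itg Rintegral_cst //= lebesgue_measure_itv /= lte_fin.
by case: ltP => //= ba; rewrite (@le_anti _ _ a b) ?ab ?ba // subrr.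
Qed.

Lemma eq_itg a b F G : (forall x, a <= x <= b -> F x = G x) -> itg a b F = itg a b G.
Proof.
by move=> h; apply: eq_Rintegral => x; rewrite inE /= in_itv /= => /h.
Qed.

Lemma le_itg a b F G : cont_on a b F -> cont_on a b G ->
  (forall x, a <= x <= b -> F x <= G x) -> itg a b F <= itg a b G.
Proof.
move=> cF cG h; apply: le_Rintegral => //; try exact: cont_on_integrable.
Qed.

Lemma cont_on_cst a b k : cont_on a b (fun=> k).
Proof. by move=> x _; exact: cst_continuous. Qed.

Lemma normr_itg_le a b F k : a <= b -> cont_on a b F ->
  (forall x, a <= x <= b -> `|F x| <= k) -> `|itg a b F| <= k * (b - a).
Proof.
move=> ab cF h; rewrite ler_norml -mulNr -!itg_cst //; apply/andP; split.
  by apply: le_itg => //; [exact: cont_on_cst|move=> x /h; rewrite ler_norml => /andP[]].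
by apply: le_itg => //; [exact: cont_on_cst|move=> x /h; rewrite ler_norml => /andP[]].
Qed.

Lemma itg_chasles a b c F : a <= c <= b -> cont_on a b F -> itg a b F = itg a c F + itg c b F.
Proof.
move=> /andP[ac cb] cF; have /(@Rintegral_itvB _ F (BLeft a) (BRight b) c) := cont_on_integrable cF.
rewrite !bnd_simp => /(_ ac cb) h; apply/eqP; rewrite addrC -subr_eq; apply/eqP.
rewrite /itg h Rintegral_itv_obnd_cbnd //.
apply: integrableS (cont_on_integrable cF) => //.
by move=> x; rewrite /= !in_itv /= => /andP[h1 h2]; rewrite (le_trans ac (ltW h1)).
Qed.

End interval_integral.

Section goursat.
Variable R : realType.
Variables U V : R -> R -> R.

(** Imaginary part of the counterclockwise contour integral of [U + i V] around the rectangle. *)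
Definition rect_bdry a b c d :=
  (itg c d (U b) - itg c d (U a)) - (itg a b (V^~ d) - itg a b (V^~ c)).

(** Real differentiability with the Cauchy-Riemann equations built into the Jacobian, the derivative
    being [p + i q]. *)
Definition cr_diff (x0 y0 : R) := exists p q : R, forall e, 0 < e -> exists2 d, 0 < d &
  forall x y, `|x - x0| < d -> `|y - y0| < d ->
   `|U x y - (U x0 y0 + p * (x - x0) - q * (y - y0))| <= e * (`|x - x0| + `|y - y0|) /\
   `|V x y - (V x0 y0 + q * (x - x0) + p * (y - y0))| <= e * (`|x - x0| + `|y - y0|).

Variables a0 b0 c0 d0 : R.
Hypothesis ab0 : a0 < b0.
Hypothesis cd0 : c0 < d0.
Hypothesis cUy : forall x, a0 <= x <= b0 -> cont_on c0 d0 (U x).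
Hypothesis cVx : forall y, c0 <= y <= d0 -> cont_on a0 b0 (V^~ y).
Hypothesis dUV : forall x y, a0 <= x <= b0 -> c0 <= y <= d0 -> cr_diff x y.

(** Bisection invariant: the boundary integral per unit area stays above [e]. The sides are
    determined by the generation [n], so only the lower left corner [s] is recorded. *)
Let bad (e : R) (n : nat) (s : R * R) :=
  [/\ a0 <= s.1, s.1 + (b0 - a0) / 2 ^+ n <= b0, c0 <= s.2, s.2 + (d0 - c0) / 2 ^+ n <= d0 &
   e * (((b0 - a0) / 2 ^+ n) * ((d0 - c0) / 2 ^+ n)) <
   `|rect_bdry s.1 (s.1 + (b0 - a0) / 2 ^+ n) s.2 (s.2 + (d0 - c0) / 2 ^+ n)|].

Lemma rect_bdry_split a b c d m k :
  a0 <= a -> a <= m <= b -> b <= b0 -> c0 <= c -> c <= k <= d -> d <= d0 ->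
  rect_bdry a b c d = (rect_bdry a m c k + rect_bdry m b c k) + (rect_bdry a m k d +
    rect_bdry m b k d).
Proof.
move=> a0a /andP[am mb] bb0 c0c /andP[ck kd] dd0; rewrite /rect_bdry.
have hU x : a <= x <= b -> itg c d (U x) = itg c k (U x) + itg k d (U x).
  move=> /andP[h1 h2]; apply: itg_chasles; first by rewrite ck.
  by apply: (cont_on_sub (a := c0) (b := d0)) => //; apply: cUy; lra.
have hV y : c <= y <= d -> itg a b (V^~ y) = itg a m (V^~ y) + itg m b (V^~ y).
  move=> /andP[h1 h2]; apply: itg_chasles; first by rewrite am.
  by apply: (cont_on_sub (a := a0) (b := b0)) => //; apply: cVx; lra.
rewrite !hU ?hV; first ring.
all: lra.
Qed.

Lemma bad_step e n s : 0 < e -> bad e n s -> exists s', [/\ bad e n.+1 s', s.1 <= s'.1,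
  s'.1 + (b0 - a0) / 2 ^+ n.+1 <= s.1 + (b0 - a0) / 2 ^+ n, s.2 <= s'.2 &
  s'.2 + (d0 - c0) / 2 ^+ n.+1 <= s.2 + (d0 - c0) / 2 ^+ n].
Proof.
move=> e0 [h1 h2 h3 h4 h5].
have w0 : 0 < (b0 - a0) / 2 ^+ n.+1 by rewrite divr_gt0 ?exprn_gt0 // subr_gt0.
have v0 : 0 < (d0 - c0) / 2 ^+ n.+1 by rewrite divr_gt0 ?exprn_gt0 // subr_gt0.
have wE : (b0 - a0) / 2 ^+ n = (b0 - a0) / 2 ^+ n.+1 + (b0 - a0) / 2 ^+ n.+1.
  by rewrite exprS; field; rewrite expf_neq0.
have vE : (d0 - c0) / 2 ^+ n = (d0 - c0) / 2 ^+ n.+1 + (d0 - c0) / 2 ^+ n.+1.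
  by rewrite exprS; field; rewrite expf_neq0.
rewrite /bad.
move: ((b0 - a0) / 2 ^+ n) ((b0 - a0) / 2 ^+ n.+1) ((d0 - c0) / 2 ^+ n) ((d0 - c0) / 2 ^+
  n.+1) w0 v0 wE vE h2 h4 h5 => _ w _ v w0 v0 -> -> h2 h4.
rewrite !addrA (@rect_bdry_split _ _ _ _ (s.1 + w) (s.2 + v)) //; try by lra.
set r1 := rect_bdry _ _ _ _; set r2 := rect_bdry _ _ _ _.
set r3 := rect_bdry _ _ _ _; set r4 := rect_bdry _ _ _ _ => h5.
have [k1|k1] := ltP (e * (w * v)) `|r1|.
  by exists (s.1, s.2); split => //=; try lra; split => //=; lra.
have [k2|k2] := ltP (e * (w * v)) `|r2|.
  by exists (s.1 + w, s.2); split => //=; try lra; split => //=; lra.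
have [k3|k3] := ltP (e * (w * v)) `|r3|.
  by exists (s.1, s.2 + v); split => //=; try lra; split => //=; lra.
have [k4|k4] := ltP (e * (w * v)) `|r4|.
  by exists (s.1 + w, s.2 + v); split => //=; try lra; split => //=; lra.
(* Four good quarters would bound the whole by [4 e w v], which is [e] times its area. *)
exfalso; move: h5; apply/negP; rewrite -leNgt.
apply: le_trans (ler_normD _ _) _; apply: le_trans (lerD (ler_normD _ _) (ler_normD _ _)) _.
by lra.
Qed.

Lemma bad_seq e : 0 < e -> bad e 0 (a0, c0) -> exists s : nat -> R * R, forall n, [/\ bad e n (s n),
  (s n).1 <= (s n.+1).1,
  (s n.+1).1 + (b0 - a0) / 2 ^+ n.+1 <= (s n).1 + (b0 - a0) / 2 ^+ n, (s n).2 <= (s n.+1).2 &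
  (s n.+1).2 + (d0 - c0) / 2 ^+ n.+1 <= (s n).2 + (d0 - c0) / 2 ^+ n].
Proof.
move=> e0 h0.
pose nx n s := if pselect (bad e n s) is left h then sval (cid (bad_step e0 h)) else s.
pose fix sq n := if n is k.+1 then nx k (sq k) else (a0, c0).
have hb n : bad e n (sq n).
  elim: n => //= n IH; rewrite /nx; case: pselect => // h.
  by case: cid => s' [].
exists sq => n; have hn := hb n; split => //=; rewrite /nx; case: pselect => // h;
  by case: cid => s' [].
Qed.

Lemma nested_point (s w : nat -> R) : (forall n, 0 <= w n) ->
  (forall n, s n <= s n.+1) -> (forall n, s n.+1 + w n.+1 <= s n + w n) ->
  exists x, forall n, s n <= x <= s n + w n.
Proof.
move=> w0 h1 h2.
have ns : nondecreasing_seq s by apply/nondecreasing_seqP.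
have nw : nonincreasing_seq (fun n => s n + w n) by apply/nonincreasing_seqP.
have hub n m : s m <= s n + w n.
  have [nm|mn] := leqP n m.
    by apply: le_trans (nw _ _ nm); rewrite lerDl.
  by apply: le_trans (ns _ _ (ltnW mn)) _; rewrite lerDl.
have hs : has_sup (range s).
  by split; [exists (s 0); exists 0|exists (s 0 + w 0) => _ [m _ <-]].
exists (sup (range s)) => n; apply/andP; split.
  by apply: sup_upper_bound => //; exists n.
by apply: sup_le_ub; [exists (s 0); exists 0|move=> _ [m _ <-]].
Qed.

(** The affine part contributes [p (b - a) (d - c)] to the [U] integrals and the same amount to the
    [V] integrals, and these cancel. This is where the Cauchy-Riemann equations act. *)
Lemma rect_bdry_small x y a b c d p q e : a0 <= a -> a <= x <= b -> b <= b0 ->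
  c0 <= c -> c <= y <= d -> d <= d0 -> 0 <= e ->
  (forall x' y', a <= x' <= b -> c <= y' <= d ->
   `|U x' y' - (U x y + p * (x' - x) - q * (y' - y))| <= e * (`|x' - x| + `|y' - y|) /\
   `|V x' y' - (V x y + q * (x' - x) + p * (y' - y))| <= e * (`|x' - x| + `|y' - y|)) ->
  `|rect_bdry a b c d| <= 2 * e * ((b - a) + (d - c)) ^+ 2.
Proof.
move=> a0a /andP[ax xb] bb0 c0c /andP[cy yd] dd0 e0 h; rewrite /rect_bdry.
have cU x' : a <= x' <= b -> cont_on c d (U x').
  by move=> h'; apply: (cont_on_sub (a := c0) (b := d0)) => //; apply: cUy; lra.
have cV y' : c <= y' <= d -> cont_on a b (V^~ y').
  by move=> h'; apply: (cont_on_sub (a := a0) (b := b0)) => //; apply: cVx; lra.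
have ha : a <= a <= b by lra. have hb : a <= b <= b by lra.
have hc : c <= c <= d by lra. have hd : c <= d <= d by lra.
have abs1 u v w : v <= u <= w -> v <= x <= w -> `|u - x| <= w - v.
  by move=> h1 h2; rewrite ler_norml; lra.
have abs2 u v w : v <= u <= w -> v <= y <= w -> `|u - y| <= w - v.
  by move=> h1 h2; rewrite ler_norml; lra.
set s := (b - a) + (d - c).
have bnd x' y' : a <= x' <= b -> c <= y' <= d -> e * (`|x' - x| + `|y' - y|) <= e * s.
  by move=> h1 h2; apply: ler_wpM2l => //; apply: lerD; [apply: abs1|apply: abs2]; lra.
have iU : `|itg c d (fun y' => U b y' - U a y' - p * (b - a))| <= (2 * e * s) * (d - c).
  apply: normr_itg_le; first lra.
    by move=> y' hy'; apply: continuousB; [apply: continuousB; apply: cU|exact: cst_continuous].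
  move=> y' hy'; have := (h b y' hb hy').1; have := (h a y' ha hy').1.
  have := bnd b y' hb hy'; have := bnd a y' ha hy'.
  by rewrite !ler_norml; lra.
have iV : `|itg a b (fun x' => V x' d - V x' c - p * (d - c))| <= (2 * e * s) * (b - a).
  apply: normr_itg_le; first lra.
    by move=> x' hx'; apply: continuousB; [apply: continuousB; apply: cV|exact: cst_continuous].
  move=> x' hx'; have := (h x' d hx' hd).2; have := (h x' c hx' hc).2.
  have := bnd x' d hx' hd; have := bnd x' c hx' hc.
  by rewrite !ler_norml; lra.
have cUba : cont_on c d (fun y' => U b y' - U a y').
  by move=> y' hy'; apply: continuousB; apply: cU.
have cVdc : cont_on a b (fun x' => V x' d - V x' c).
  by move=> x' hx'; apply: continuousB; apply: cV.
move: iU iV.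
rewrite (itgB cUba (@cont_on_cst _ _ _ _)) (itgB (cU _ hb) (cU _ ha)) itg_cst; last lra.
rewrite (itgB cVdc (@cont_on_cst _ _ _ _)) (itgB (cV _ hd) (cV _ hc)) itg_cst; last lra.
have -> : 2 * e * s ^+ 2 = 2 * e * s * (d - c) + 2 * e * s * (b - a) by rewrite /s; ring.
by rewrite !ler_norml; lra.
Qed.

Lemma goursat : rect_bdry a0 b0 c0 d0 = 0.
Proof.
apply/eqP/negPn/negP => nz.
have A0 : 0 < (b0 - a0) * (d0 - c0) by rewrite mulr_gt0 ?subr_gt0.
(* Half of the boundary integral per unit area, so that the initial rectangle is strictly bad. *)
pose e := `|rect_bdry a0 b0 c0 d0| / (2 * ((b0 - a0) * (d0 - c0))).
have e0 : 0 < e by rewrite divr_gt0 ?normr_gt0 // mulr_gt0.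
have [|s hs] := @bad_seq e e0.
  split => //=; rewrite ?expr0 ?divr1; try lra.
  have -> : e * ((b0 - a0) * (d0 - c0)) = `|rect_bdry a0 b0 c0 d0| / 2.
    by rewrite /e; field; rewrite !subr_eq0 !gt_eqF.
  have := normr_gt0 (rect_bdry a0 b0 c0 d0); rewrite nz.
  by rewrite !(addrC _ (_ - _)) !subrK; lra.
pose w n := (b0 - a0) / 2 ^+ n; pose v n := (d0 - c0) / 2 ^+ n.
have w0 n : 0 <= w n by rewrite divr_ge0 ?exprn_ge0 // subr_ge0 ltW.
have v0 n : 0 <= v n by rewrite divr_ge0 ?exprn_ge0 // subr_ge0 ltW.
have [x hx] : exists x, forall n, (s n).1 <= x <= (s n).1 + w n.
  by apply: (@nested_point (fun n => (s n).1)) => // n; case: (hs n).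
have [y hy] : exists x, forall n, (s n).2 <= x <= (s n).2 + v n.
  by apply: (@nested_point (fun n => (s n).2)) => // n; case: (hs n).
have xab : a0 <= x <= b0 by have := hx 0; case: (hs 0) => -[]; rewrite /w; lra.
have ycd : c0 <= y <= d0 by have := hy 0; case: (hs 0) => -[]; rewrite /v; lra.
have [p [q hpq]] := dUV xab ycd.
pose L := (b0 - a0) + (d0 - c0).
have L0 : 0 < L by rewrite addr_gt0 // subr_gt0.
(* Chosen so that [2 e' (w n + v n)^2], the bound of [rect_bdry_small], equals [e (w n) (v n)]. *)
pose e' := e * ((b0 - a0) * (d0 - c0)) / (2 * L ^+ 2).
have e'0 : 0 < e' by rewrite divr_gt0 ?(mulr_gt0 e0 A0) // mulr_gt0 // exprn_gt0.
have [dl dl0 hdl] := hpq _ e'0.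
have [n hn] : exists n, L / 2 ^+ n < dl.
  exists (Num.trunc (L / dl)).+1; rewrite ltr_pdivrMr ?exprn_gt0 // mulrC -ltr_pdivrMr //.
  apply: lt_trans (truncnS_gt _) _. rewrite -natrX ltr_nat. exact: ltn_expl.
have [[h1 h2 h3 h4 h5] _ _ _ _] := hs n.
have wv : w n + v n = L / 2 ^+ n by rewrite /w /v -mulrDl.
have := @rect_bdry_small x y _ _ _ _ p q e' h1 (hx n) h2 h3 (hy n) h4 (ltW e'0).
move/(_ _)/wrap => [x' y' hx' hy'|].
  have := hx n; have := hy n; have := w0 n; have := v0 n; rewrite -/(w n) -/(v n) in hx' hy' *.
  by move=> ? ? ? ?; apply: hdl; rewrite ltr_norml; lra.
apply/negP; rewrite -ltNge; apply: le_lt_trans h5.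
rewrite !(addrC (s n).1) !(addrC (s n).2) !addrK -/(w n) -/(v n) wv /e'.
rewrite /w /v le_eqVlt; apply/orP; left; apply/eqP.
by field; rewrite gt_eqF // ?gt_eqF ?exprn_gt0.
Qed.

End goursat.

(** * The complex exponential *)

Arguments Normc.normc : simpl never.

Section complex_exp.
Variable R : realType.
Implicit Types (z w : R[i]) (x y t : R).

Lemma ReB z w : complex.Re (z - w) = complex.Re z - complex.Re w.
Proof. by case: z w => ? ? []. Qed.

Lemma ImB z w : complex.Im (z - w) = complex.Im z - complex.Im w.
Proof. by case: z w => ? ? []. Qed.

Lemma ReD z w : complex.Re (z + w) = complex.Re z + complex.Re w.
Proof. by case: z w => ? ? []. Qed.

Lemma ImD z w : complex.Im (z + w) = complex.Im z + complex.Im w.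
Proof. by case: z w => ? ? []. Qed.

Lemma ct_real z (u : R[i] -> R) (g : R -> R) : {for u z, continuous g} ->
  ct (fun w => (u w)%:C) z -> ct (fun w => (g (u w))%:C) z.
Proof.
move=> /(@cvgrPdist_lt R R) cg cu e e0.
have /nbhs_ballP[d /= d0 hd] := cg _ e0.
have [d' d'0 hd'] := cu _ d0; exists d' => // w /hd'.
rewrite -!rmorphB !normcR => h; rewrite -normrN opprB; apply: hd.
by rewrite /ball /= -normrN opprB.
Qed.

Lemma ctReIm (F : R[i] -> R[i]) z : ct (fun w => (complex.Re (F w))%:C) z ->
  ct (fun w => (complex.Im (F w))%:C) z -> ct F z.
Proof.
move=> h1 h2; apply: (@ct_locally _ (fun w => (complex.Re (F w))%:C + 'i%C *
  (complex.Im (F w))%:C)).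
  by exists 1 => // w _; rewrite -complexE.
by apply: ctD => //; apply: ctM => //; exact: ct_cst.
Qed.

Lemma ct_Re (F : R[i] -> R[i]) z : ct F z -> ct (fun w => (complex.Re (F w))%:C) z.
Proof.
move=> h e /h[d d0 hd]; exists d => // w /hd; apply: le_lt_trans.
by rewrite -rmorphB normcR; apply: le_trans (ler_Re_normc _); case: (F w) (F z) => ? ? [].
Qed.

Lemma ct_Im (F : R[i] -> R[i]) z : ct F z -> ct (fun w => (complex.Im (F w))%:C) z.
Proof.
move=> h e /h[d d0 hd]; exists d => // w /hd; apply: le_lt_trans.
by rewrite -rmorphB normcR; apply: le_trans (ler_Im_normc _); case: (F w) (F z) => ? ? [].
Qed.

Lemma ct_normc (F : R[i] -> R[i]) z : ct F z -> ct (fun w => (normc (F w))%:C) z.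
Proof.
move=> h e /h[d d0 hd]; exists d => // w /hd; apply: le_lt_trans.
by rewrite -rmorphB normcR ler_dist_normc.
Qed.

Lemma ct_neq0 (F : R[i] -> R[i]) z : ct F z -> F z != 0 ->
  exists2 d : R, 0 < d & forall w, normc (w - z) < d -> F w != 0.
Proof.
rewrite -normc_gt0 => cF /cF[d d0 hd]; exists d => // w /hd.
by apply: contraTneq => ->; rewrite sub0r normcN ltxx.
Qed.

Lemma is_derive_approx (f : R -> R) (x l : R) : is_derive x 1 f l -> forall e, 0 < e ->
  exists2 d, 0 < d & forall h, `|h| < d -> `|f (x + h) - f x - l * h| <= e * `|h|.
Proof.
move=> [df <-] e e0; move: df => /cvg_ex[m] hm.
have -> : 'D_1 f x = m by exact: (cvg_lim _ hm).
move: hm => /(@cvgrPdist_lt R R) /(_ _ e0) /nbhs_ballP[d /= d0 hd].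
exists d => // h hh; have [->|h0] := eqVneq h 0; first by rewrite addr0 subrr mulr0 subr0 normr0
  mulr0.
have := hd h; rewrite /ball /= sub0r normrN => /(_ hh h0).
rewrite /= [_ *: 1]mulr1 [h + x]addrC => /ltW.
set q := `|_|; move=> hq; have -> : f (x + h) - f x - m * h = - ((m - h^-1 *: (f (x + h) - f x)) *
  h).
  by rewrite /GRing.scale /=; field.
by rewrite normrN normrM ler_wpM2r.
Qed.

Definition cexp z : R[i] :=
  (expR (complex.Re z) * cos (complex.Im z)) +i* (expR (complex.Re z) * sin (complex.Im z)).

Lemma cexpD z w : cexp (z + w) = cexp z * cexp w.
Proof.
case: z w => a b [c d]; rewrite /cexp /= expRD cosD sinD.
by apply/eqP; rewrite eq_complex /=; apply/andP; split; apply/eqP; ring.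
Qed.

Lemma cexp0 : cexp 0 = 1.
Proof. by rewrite /cexp /= expR0 cos0 sin0 mulr1 mulr0. Qed.

Lemma normc_cexp z : normc (cexp z) = expR (complex.Re z).
Proof.
rewrite /cexp /Normc.normc !exprMn -mulrDr cos2Dsin2 mulr1 sqrtr_sqr ger0_norm // expR_ge0.
Qed.

Lemma cexp_neq0 z : cexp z != 0.
Proof. by rewrite -normc_gt0 normc_cexp expR_gt0. Qed.

Lemma cder_cexp z : cder cexp z (cexp z).
Proof.
(* The case of [0] follows from the real derivatives of [expR], [cos] and [sin]; [cexpD] carries it
   to [z]. *)
have h0 : cder cexp 0 1.
  apply/cderE => e e0.
  (* The errors of the two components add up to at most [7 e' r]; the bound [e' <= 1/16] also keeps
     [r] below [1]. *)
  pose e' := Num.min 1 e / 16.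
  have [m1 me] : Num.min 1 e <= 1 /\ Num.min 1 e <= e by rewrite !ge_min !lexx orbT.
  have m0 : 0 < Num.min 1 e by rewrite lt_min ltr01.
  have e'0 : 0 < e' by rewrite divr_gt0.
  have e'1 : e' <= 16^-1 by rewrite /e'; lra.
  have ee : 16 * e' <= e by rewrite /e'; lra.
  have [d1 d10 h1] := is_derive_approx (is_derive_expR (0 : R)) e'0.
  have [d2 d20 h2] := is_derive_approx (is_derive_cos (0 : R)) e'0.
  have [d3 d30 h3] := is_derive_approx (is_derive_sin (0 : R)) e'0.
  exists (Num.min (Num.min d1 d2) (Num.min d3 e')); first by rewrite !lt_min d10 d20 d30.
  move=> w; rewrite subr0 !lt_min eqxx => /andP[/andP[w1 w2] /andP[w3 w4]].
  case: eqP => [_|/eqP w0]; first by rewrite subrr nc0.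
  have -> : (cexp w - cexp 0) / w - 1 = (cexp w - 1 - w) / w.
    by rewrite cexp0; field.
  rewrite Normc.normcM Normc.normcV ltr_pdivrMr ?normc_gt0 //.
  have nw : 0 < normc w by rewrite normc_gt0.
  apply: le_lt_trans (ler_normc_ReIm _) _.
  have := ler_Re_normc w; have := ler_Im_normc w.
  move: w1 w2 w3 w4 nw; case: w w0 => x y w0; move: (normc (x +i* y)) => r w1 w2 w3 w4 nw hx hy.
  rewrite /cexp /= in hx hy *.
  move: (h1 x (le_lt_trans hy w1)) (h2 y (le_lt_trans hx w2)) (h3 y (le_lt_trans hx w3)).
  rewrite !add0r expR0 cos0 sin0 !mul1r oppr0 mul0r !subr0 ?addr0 => k1 k2 k3.
  suff key A B : A = expR x * cos y - 1 - x -> B = expR x * sin y - y -> `|A| + `|B| < e * r.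
    by apply: key => /=; ring.
  move=> -> ->.
  have -> : expR x * cos y - 1 - x = (expR x - 1 - x) * cos y + (1 + x) * (cos y - 1) by ring.
  have -> : expR x * sin y - y = (expR x - 1 - x) * sin y + x * sin y + (sin y - y) by ring.
  have := cos_max y; have := sin_max y.
  have n1 := ler_normD ((expR x - 1 - x) * cos y) ((1 + x) * (cos y - 1)).
  have n2 := ler_normD ((expR x - 1 - x) * sin y + x * sin y) (sin y - y).
  have n3 := ler_normD ((expR x - 1 - x) * sin y) (x * sin y).
  rewrite !normrM in n1 n2 n3.
  have n4 := ler_normD 1 x; rewrite normr1 in n4.
  have n5 := ler_normD (sin y - y) y; rewrite subrK in n5.
  move=> c1 c2.
  have p1 : `|expR x - 1 - x| * `|cos y| <= e' * r by apply: le_trans (ler_pM _ _ k1 c2) _ => //;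
    rewrite mulr1 ler_pM2l.
  have p2 : `|expR x - 1 - x| * `|sin y| <= e' * r by apply: le_trans (ler_pM _ _ k1 c1) _ => //;
    rewrite mulr1 ler_pM2l.
  have r1 : r <= 1 by lra.
  have p3 : `|1 + x| * `|cos y - 1| <= 2 * (e' * r).
    apply: ler_pM => //; first lra.
    by apply: le_trans k2 _; rewrite ler_pM2l.
  have s2 : `|sin y| <= 2 * e'.
    have := ler_wpM2l (ltW e'0) hx; have : e' * r <= e' by rewrite ler_piMr // ltW.
    by move: n5 k3; lra.
  have p4 : `|x| * `|sin y| <= r * (2 * e') by apply: ler_pM.
  have p5 : e' * `|y| <= e' * r by rewrite ler_pM2l.
  have p6 : 16 * (e' * r) <= e * r by rewrite mulrA ler_pM2r.
  have p7 : 0 < e' * r by rewrite mulr_gt0.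
  by move: n1 n2 n3; lra.
have := cder_comp (z := z) (G := fun w => w - z) (F := cexp) (l := 1) (m := 1 - 0).
rewrite subrr subr0 => /(_ h0) h1.
have h2 : cder (fun w => w - z) z 1 by rewrite -[X in cder _ _ X]subr0; apply: cderB;
  [exact: cder_id|exact: cder_cst].
have := cderM (cder_cst (cexp z) z) (h1 h2).
rewrite mul0r add0r !mulr1; apply: cder_locally.
by exists 1 => // w _; rewrite -cexpD [z + _]addrC subrK.
Qed.

(** With the quotients [P] of [cexp] and [Q] of [G], one has
    [P (L w) * (L w - L z) = Q w * (w - z)], and [P (L w)] is continuous at [z] and nonzero nearby.
    Continuity of [L] therefore gives differentiability. *)
Lemma cder_log (L G : R[i] -> R[i]) z m : ct L z ->
  locally_eq (fun w => cexp (L w)) G z -> cder G z m -> cder L z (m / cexp (L z)).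
Proof.
move=> cL LG [Q [cQ <- hQ]]; have [P [cP hP hE]] := cder_cexp (L z).
have cPL : ct (fun w => P (L w)) z by exact: ct_comp.
have PL0 : P (L z) != 0 by rewrite hP cexp_neq0.
have [d d0 hd] := ct_neq0 cPL PL0; have [d' d'0 hd'] := LG.
have GL : G z = cexp (L z) by rewrite (locally_eq_at LG).
apply: (@cder_locally _ (fun w => L z + Q w / P (L w) * (w - z))).
  exists (Num.min d d'); first by rewrite lt_min d0.
  move=> w; rewrite lt_min => /andP[/hd Pw /hd' Gw].
  have : P (L w) * (L w - L z) = Q w * (w - z).
    have := hE (L w); rewrite Gw hQ -GL => /eqP.
    by rewrite (inj_eq (addrI _)) => /eqP ->.
  move/(canRL (mulKf Pw)) => h.
  by rewrite mulrAC mulrC -h addrC subrK.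
exists (fun w => Q w / P (L w)); split.
- by apply: ctM => //; exact: ctV.
- by rewrite hP.
- by move=> w; rewrite subrr mulr0 addr0.
Qed.

(** The principal branch, meaningful on the right half-plane, where [atan] returns the argument. *)
Definition clog z : R[i] := ln (normc z) +i* atan (complex.Im z / complex.Re z).

Lemma clogK z : 0 < complex.Re z -> cexp (clog z) = z.
Proof.
case: z => a b /= a0; rewrite /cexp /clog /Normc.normc /=.
have n0 : 0 < Num.sqrt (a ^+ 2 + b ^+ 2).
  by rewrite sqrtr_gt0 ltr_pwDl ?exprn_gt0 ?sqr_ge0.
have [h1 h2] := atan_def (b / a).
have c0 : 0 < cos (atan (b / a)) by apply: cos_gt0_pihalf.
have E : Num.sqrt (a ^+ 2 + b ^+ 2) * cos (atan (b / a)) = a.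
  rewrite cos_atan.
  have -> : 1 + (b / a) ^+ 2 = (a ^+ 2 + b ^+ 2) / a ^+ 2 by field; rewrite gt_eqF.
  rewrite sqrtrM ?addr_ge0 ?sqr_ge0 // sqrtrV ?sqr_ge0 // sqrtr_sqr gtr0_norm //.
  by field; rewrite !gt_eqF.
rewrite lnK ?posrE //; apply/eqP; rewrite eq_complex /= E eqxx /=.
have -> : sin (atan (b / a)) = b / a * cos (atan (b / a)).
  by rewrite -{2}h2 /tan divfK // gt_eqF.
by rewrite mulrCA E divfK // gt_eqF.
Qed.

Lemma ct_clog z : 0 < complex.Re z -> ct clog z.
Proof.
move=> z0; apply: ctReIm.
  apply: (@ct_real _ (fun w => normc w)); last by apply: ct_normc; exact: ct_id.
  apply: continuous_ln; rewrite normc_gt0; apply: contraTneq z0 => ->.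
  by rewrite ltxx.
apply: (@ct_real _ (fun w => complex.Im w / complex.Re w)); first exact: continuous_atan.
apply: (@ct_locally _ (fun w => (complex.Im w)%:C * ((complex.Re w)%:C)^-1)).
  by exists 1 => // w _; rewrite rmorphM /= fmorphV.
apply: ctM; first by apply: (@ct_Im id); exact: ct_id.
apply: ctV; last by apply: (@ct_Re id); exact: ct_id.
by rewrite -normc_gt0 normcR normr_gt0 gt_eqF.
Qed.

End complex_exp.

(** * Uniformity on closed disks by compactness *)

Section disc_compactness.
Variable R : realType.
Implicit Types (z w c : R[i]) (r : R).

(** The Heine-Borel tool behind uniform continuity, positive minima, bounds and a Dini argument: a
    local scale that may be shrunk can be taken the same on the whole closed disk. *)
Lemma disc_uniform c r (P : R[i] -> R -> Prop) :
  (forall x d d', 0 < d' <= d -> P x d -> P x d') ->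
  (forall x, normc (x - c) <= r -> exists2 d, 0 < d & forall x', normc (x' - x) < d ->
     normc (x' - c) <= r -> P x' d) ->
  exists2 d, 0 < d & forall x, normc (x - c) <= r -> P x d.
Proof.
move=> Pmono hloc.
pose K : set (R * R) := `[complex.Re c - r, complex.Re c + r]%classic `*`
  `[complex.Im c - r, complex.Im c + r]%classic.
have cK : compact K by apply: compact_setX; exact: segment_compact.
move/compact_near_coveringP : cK => /(_ R (0^'+) (fun d p => normc (p.1 +i* p.2 - c) <= r ->
  P (p.1 +i* p.2) d)).
have hl p : exists2 d, 0 < d & forall x', normc (x' - (p.1 +i* p.2)) < d -> normc (x' - c) <= r ->
  P x' d.
  have [h|h] := leP (normc (p.1 +i* p.2 - c)) r; first exact: hloc.
  (* A point of the square outside the disk has a neighborhood that misses the disk. *)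
  exists (normc (p.1 +i* p.2 - c) - r); first by rewrite subr_gt0.
  move=> x' h1 h2; exfalso; have := ler_distc_add x' (p.1 +i* p.2) c.
  by rewrite (normcB (p.1 +i* p.2) x'); move: h1 h2; lra.
case => [p _|d /= d0 hd].
- have [d d0 hd] := hl p.
  exists ([set q | normc (q.1 +i* q.2 - (p.1 +i* p.2)) < d], [set e | 0 < e < d]).
    split => /=.
      apply/nbhs_ballP; exists (d / 2); first by rewrite /= divr_gt0.
      move=> q [/= h1 h2]; apply: le_lt_trans (ler_normc_ReIm _) _ => /=.
      by rewrite (splitr d) ltrD // distrC.
    near=> e; apply/andP; split; near: e; [exact: nbhs_right_gt|exact: nbhs_right_lt].
  move=> [q e] /= [h1 /andP[e0 ed]] h2; apply: (Pmono _ d); first by rewrite e0 ltW.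
  exact: hd.
- have h : 0 < d / 2 by rewrite divr_gt0.
  exists (d / 2) => // x xr.
  have := hd (d / 2); rewrite /ball /= sub0r normrN gtr0_norm // => /(_ _ h (complex.Re x,
    complex.Im x)).
  have -> : (complex.Re x +i* complex.Im x) = x by case: (x).
  apply => //; first by rewrite ltr_pdivrMr // ltr_pMr // ltr1n.
  have := ler_Re_normc (x - c); have := ler_Im_normc (x - c).
  move: xr; rewrite ReB ImB /K /= !in_itv /= => xr.
  by rewrite !ler_norml => ? ?; split; lra.
Unshelve. all: by end_near. Qed.

End disc_compactness.

(** * Logarithms of nonvanishing functions and mean values *)

Section paths.
Variable R : realType.
Implicit Types (g : R -> R[i]) (F : R[i] -> R[i]) (t x y r : R) (c z w : R[i]).

Definition rct g t := forall e : R, 0 < e ->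
  exists2 d, 0 < d & forall s, `|s - t| < d -> normc (g s - g t) < e.

Lemma rct_comp F g t : ct F (g t) -> rct g t -> rct (fun s => F (g s)) t.
Proof.
move=> h1 h2 e /h1[d d0 hd]; have [d' d'0 hd'] := h2 _ d0.
by exists d' => // s /hd'; exact: hd.
Qed.

Lemma near_for_continuous (f : R -> R) t : (forall e : R, 0 < e ->
  exists2 d, 0 < d & forall s, `|s - t| < d -> `|f s - f t| < e) -> {for t, continuous f}.
Proof.
move=> h; apply/(@cvgrPdist_lt R R) => e /h[d d0 hd].
apply/nbhs_ballP; exists d => //= s; rewrite /ball /= => st.
by rewrite distrC; apply: hd; rewrite distrC.
Qed.

Lemma for_continuous_near (f : R -> R) t : {for t, continuous f} -> forall e : R, 0 < e ->
  exists2 d, 0 < d & forall s, `|s - t| < d -> `|f s - f t| < e.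
Proof.
move=> /(@cvgrPdist_lt R R) h e /h /nbhs_ballP[d /= d0 hd]; exists d => // s st.
by rewrite distrC; apply: hd; rewrite /ball /= distrC.
Qed.

Lemma rct_Re g t : rct g t -> {for t, continuous (fun s => complex.Re (g s))}.
Proof.
move=> h; apply: near_for_continuous => e /h[d d0 hd]; exists d => // s /hd.
by apply: le_lt_trans; rewrite -ReB ler_Re_normc.
Qed.

Lemma rct_Im g t : rct g t -> {for t, continuous (fun s => complex.Im (g s))}.
Proof.
move=> h; apply: near_for_continuous => e /h[d d0 hd]; exists d => // s /hd.
by apply: le_lt_trans; rewrite -ImB ler_Im_normc.
Qed.

Lemma rct_normc g t : rct g t -> {for t, continuous (fun s => normc (g s))}.
Proof.
move=> h; apply: near_for_continuous => e /h[d d0 hd]; exists d => // s /hd.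
by apply: le_lt_trans; rewrite ler_dist_normc.
Qed.

Lemma rctReIm g t : {for t, continuous (fun s => complex.Re (g s))} ->
  {for t, continuous (fun s => complex.Im (g s))} -> rct g t.
Proof.
move=> /for_continuous_near h1 /for_continuous_near h2 e e0.
have e2 : 0 < e / 2 by rewrite divr_gt0.
have [d d0 hd] := h1 _ e2; have [d' d'0 hd'] := h2 _ e2.
exists (Num.min d d'); first by rewrite lt_min d0.
move=> s; rewrite lt_min => /andP[/hd a1 /hd' a2].
by apply: le_lt_trans (ler_normc_ReIm _) _; rewrite ReB ImB (splitr e) ltrD.
Qed.

Definition cis t : R[i] := cos t +i* sin t.

Definition circ c r t := c + r%:C * cis t.

Lemma normc_cis t : normc (cis t) = 1.
Proof. by rewrite /Normc.normc /= cos2Dsin2 sqrtr1. Qed.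

Lemma normc_circ c r t : normc (circ c r t - c) = `|r|.
Proof. by rewrite /circ addrC addKr Normc.normcM normc_cis normcR mulr1. Qed.

Lemma circ_dist c r r' t : normc (circ c r t - circ c r' t) = `|r - r'|.
Proof.
have -> : circ c r t - circ c r' t = (r - r')%:C * cis t by rewrite /circ rmorphB; ring.
by rewrite Normc.normcM normc_cis normcR mulr1.
Qed.

Lemma circ0 c t : circ c 0 t = c.
Proof. by rewrite /circ mul0r addr0. Qed.

Lemma circ_expR c x y : circ c (expR x) y = c + cexp (x +i* y).
Proof.
rewrite /circ /cexp /cis /=; congr (_ + _).
by apply/eqP; rewrite eq_complex /= !mul0r subr0 addr0 !eqxx.
Qed.

Lemma circ2pi c r : circ c r (pi *+ 2) = circ c r 0.
Proof. by rewrite /circ /cis cos2pi sin2pi cos0 sin0. Qed.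

Lemma rct_circ c r t : rct (circ c r) t.
Proof.
have ReE s : complex.Re (circ c r s) = complex.Re c + r * cos s.
  by rewrite /circ ReD /= mul0r subr0.
have ImE s : complex.Im (circ c r s) = complex.Im c + r * sin s.
  by rewrite /circ ImD /= mul0r addr0.
apply: rctReIm.
  rewrite (_ : (fun s => _) = (fun s => complex.Re c + r * cos s)); last exact/funext.
  by apply: continuousD; [exact: cst_continuous|apply: continuousM;
    [exact: cst_continuous|exact: continuous_cos]].
rewrite (_ : (fun s => _) = (fun s => complex.Im c + r * sin s)); last exact/funext.
by apply: continuousD; [exact: cst_continuous|apply: continuousM;
  [exact: cst_continuous|exact: continuous_sin]].
Qed.

Lemma rct_circ_expR c x y : rct (fun s => circ c (expR s) y) x.
Proof.
move=> e e0; have [d d0 hd] := for_continuous_near (@continuous_expR R x) e0.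
by exists d => // s /hd; rewrite circ_dist.
Qed.

End paths.

(** * Continuous branches of the logarithm on disks *)

Section log_branch.
Variable R : realType.
Implicit Types (F L : R[i] -> R[i]) (t x y r : R) (c z w : R[i]).

Lemma unif_ct F c r : (forall z, normc (z - c) <= r -> ct F z) -> forall e : R, 0 < e ->
  exists2 d : R, 0 < d & forall z w, normc (z - c) <= r -> normc (w - c) <= r ->
    normc (w - z) < d -> normc (F w - F z) < e.
Proof.
move=> cF e e0.
have [|x /cF cx|d d0 hd] := @disc_uniform R c r (fun z d => forall w, normc (w - c) <= r ->
    normc (w - z) < d -> normc (F w - F z) < e).
- by move=> x d d' /andP[_ d'd] h w wc wx; apply: h => //; exact: lt_le_trans d'd.
- have e2 : 0 < e / 2 by rewrite divr_gt0.
  have [d d0 hd] := cx _ e2; have d2 : 0 < d / 2 by rewrite divr_gt0.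
  exists (d / 2) => // x' x'x _ w _ wx'.
  apply: le_lt_trans (ler_distc_add (F x) _ _) _.
  rewrite (splitr e); apply: ltrD; last rewrite normcB; apply: hd.
    apply: le_lt_trans (ler_distc_add x' _ _) _; rewrite (splitr d).
    exact: ltrD.
  by apply: lt_trans x'x _; lra.
- by exists d => // z w zc; exact: hd.
Qed.

(** Telescoping along the segment from [c] to [z]: by uniform continuity consecutive values of [F]
    have a ratio in the right half-plane, where [clog] is a continuous logarithm. *)
Lemma log_branch F c r0 r : (forall z, normc (z - c) < r0 -> ct F z /\ F z != 0) ->
  0 <= r < r0 -> exists L, forall z, normc (z - c) < r -> ct L z /\ cexp (L z) = F z / F c.
Proof.
move=> hF /andP[r_ge0 rr0].
have [|x xr|d d0 hd] := @disc_uniform R c r (fun z d => forall w, normc (w - c) <= r ->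
    normc (w - z) < d -> 0 < complex.Re (F w / F z)).
- by move=> x d d' /andP[_ d'd] h w wc wx; apply: h => //; exact: lt_le_trans d'd.
- have [cx nx] := hF x (le_lt_trans xr rr0).
  have e0 : 0 < normc (F x) / 4 by rewrite divr_gt0 // normc_gt0.
  have [d d0 hd] := cx _ e0; have d2 : 0 < d / 2 by rewrite divr_gt0.
  exists (d / 2) => // x' x'x x'r w wr wx'.
  have [_ nx'] := hF x' (le_lt_trans x'r rr0).
  have h1 : normc (F w - F x) < normc (F x) / 4.
    apply: hd; apply: le_lt_trans (ler_distc_add x' _ _) _.
    by rewrite (splitr d); exact: ltrD.
  have h2 : normc (F x' - F x) < normc (F x) / 4 by apply: hd; lra.
  have h3 : normc (F w / F x' - 1) < 1.
    have -> : F w / F x' - 1 = (F w - F x') / F x' by field.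
    rewrite Normc.normcM Normc.normcV ltr_pdivrMr ?normc_gt0 // mul1r.
    have := ler_distc_add (F x) (F w) (F x'); have := ler_normcB_dist (F x) (F x').
    by rewrite !(normcB (F x) (F x')); lra.
  have := ler_Re_normc (F w / F x' - 1); rewrite ReB /= ler_norml.
  by move: h3; lra.
have [n hn] : exists n : nat, r / n.+1%:R < d.
  exists (Num.trunc (r / d)); rewrite ltr_pdivrMr ?ltr0Sn // mulrC -ltr_pdivrMr //.
  exact: truncnS_gt.
pose p z k : R[i] := c + (k%:R / n.+1%:R)%:C * (z - c).
have n0 : (0 : R) < n.+1%:R by rewrite ltr0Sn.
have pr z k : normc (z - c) < r -> (k <= n.+1)%N -> normc (p z k - c) <= r.
  move=> zr kn; rewrite /p addrC addKr Normc.normcM normcR ger0_norm ?divr_ge0 ?ler0n //.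
  apply: le_trans (ltW zr); rewrite ler_piMl ?normc_ge0 //.
  by rewrite ler_pdivrMr // mul1r ler_nat.
have cp k z : ct (p^~ k) z.
  apply: ctD; first exact: ct_cst.
  apply: ctM; first exact: ct_cst.
  by apply: ctB; [exact: ct_id|exact: ct_cst].
have pS z k : normc (z - c) < r -> normc (p z k.+1 - p z k) < d.
  move=> zr; have -> : p z k.+1 - p z k = (n.+1%:R^-1)%:C * (z - c).
    by rewrite /p -natr1 mulrDl mul1r rmorphD; ring.
  rewrite Normc.normcM normcR ger0_norm ?invr_ge0 ?ler0n //.
  by apply: le_lt_trans hn; rewrite mulrC ler_pM2r ?invr_gt0 // ltW.
exists (fun z => \sum_(k < n.+1) clog (F (p z k.+1) / F (p z k))) => z zr.
have q0 k : (k < n.+1)%N -> 0 < complex.Re (F (p z k.+1) / F (p z k)).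
  by move=> kn; apply: hd; [apply: pr => //; exact: ltnW|exact: pr|exact: pS].
have hp k : (k <= n.+1)%N -> ct F (p z k) /\ F (p z k) != 0.
  by move=> kn; apply: hF; apply: le_lt_trans rr0; exact: pr.
split.
  suff : forall m, (m <= n.+1)%N -> ct (fun z => \sum_(k < m) clog (F (p z k.+1) / F (p z k))) z
    by apply.
  elim=> [_|m IH mn].
    by apply: (@ct_locally _ (fun=> 0)); [exists 1 => // w _; rewrite big_ord0|exact: ct_cst].
  apply: (@ct_locally _ (fun z => \sum_(k < m) clog (F (p z k.+1) / F (p z k)) +
    clog (F (p z m.+1) / F (p z m)))).
    by exists 1 => // w _; rewrite big_ord_recr.
  apply: ctD; first by apply: IH; exact: ltnW.
  apply: (@ct_comp _ (@clog R) (fun z => F (p z m.+1) / F (p z m))).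
    exact/ct_clog/q0.
  have [c1 _] := hp _ mn; have [c2 n2] := hp _ (ltnW mn).
  apply: ctM; first by apply: (@ct_comp _ F (p^~ m.+1)).
  by apply: ctV => //; apply: (@ct_comp _ F (p^~ m)).
have -> : F z = F (p z n.+1).
  by rewrite /p divff ?pnatr_eq0 // mul1r addrC subrK.
suff : forall m, (m <= n.+1)%N -> cexp (\sum_(k < m) clog (F (p z k.+1) / F (p z k))) =
  F (p z m) / F c by apply.
have p0 : p z 0%N = c by rewrite /p mul0r mul0r addr0.
elim=> [_|m IH mn].
  by rewrite big_ord0 cexp0 p0 divff // -p0; case: (hp 0%N).
rewrite big_ord_recr /= cexpD IH ?(ltnW mn) // clogK ?q0 //.
have [_ n2] := hp _ (ltnW mn).
by rewrite mulrC mulrA divfK.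
Qed.

End log_branch.

(** * Mean value property on circles *)

Section mean_value.
Variable R : realType.
Implicit Types (F L : R[i] -> R[i]) (t x y r : R) (c z w a : R[i]).
Local Notation tpi := (pi *+ 2 : R).

Lemma tpi_gt0 : 0 < tpi.
Proof. by rewrite mulrn_wgt0 // pi_gt0. Qed.

Lemma cont_on_circ_Re F c r (a b : R) : (forall t, ct F (circ c r t)) ->
  cont_on a b (fun t => complex.Re (F (circ c r t))).
Proof. by move=> cF t _; apply: rct_Re; apply: rct_comp => //; exact: rct_circ. Qed.

(** In logarithmic polar coordinates [w |-> L (c + cexp w)] is again differentiable, and annuli
    become rectangles, to which [goursat] applies. *)
Lemma cr_diff_cder L c x y l : cder L (c + cexp (x +i* y)) l ->
  cr_diff (fun x y => complex.Re (L (circ c (expR x) y)))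
          (fun x y => complex.Im (L (circ c (expR x) y))) x y.
Proof.
move=> hL.
have hE : cder (fun w => c + cexp w) (x +i* y) (cexp (x +i* y)).
  by rewrite -[X in cder _ _ X]add0r; apply: cderD; [exact: cder_cst|exact: cder_cexp].
have /cderE := cder_comp (F := L) (G := fun w => c + cexp w) hL hE.
set m := l * _ => hm.
exists (complex.Re m), (complex.Im m) => e e0.
have [d d0 hd] := hm _ e0; have d2 : 0 < d / 2 by rewrite divr_gt0.
exists (d / 2) => // x' y' hx hy; rewrite !circ_expR.
set w := x' +i* y'; set w0 := x +i* y.
have ww : normc (w - w0) <= `|x' - x| + `|y' - y| by exact: ler_normc_ReIm.
have h : normc (L (c + cexp w) - L (c + cexp w0) - m * (w - w0)) <= e * (`|x' - x| + `|y' - y|).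
  have := hd w; rewrite -/w0 eqxx; case: eqP => [-> _|/eqP wn].
    by rewrite !subrr mulr0 subr0 nc0 mulr_ge0 ?addr_ge0 // ltW.
  have dn : w - w0 != 0 by rewrite subr_eq0.
  have lt : normc (w - w0) < d by apply: le_lt_trans ww _; rewrite (splitr d) ltrD.
  move=> /(_ lt) /ltW hh; apply: le_trans (ler_wpM2l (ltW e0) ww).
  have -> : L (c + cexp w) - L (c + cexp w0) - m * (w - w0) =
     ((L (c + cexp w) - L (c + cexp w0)) / (w - w0) - m) * (w - w0) by field.
  by rewrite Normc.normcM ler_wpM2r ?normc_ge0.
split; apply: le_trans h.
  apply: le_trans (ler_Re_normc _); rewrite !ReB.
  rewrite le_eqVlt; apply/orP; left; apply/eqP; congr (`| _ |).
  by rewrite /w /w0; case: (m) => m1 m2 /=; ring.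
apply: le_trans (ler_Im_normc _); rewrite !ImB.
rewrite le_eqVlt; apply/orP; left; apply/eqP; congr (`| _ |).
by rewrite /w /w0; case: (m) => m1 m2 /=; ring.
Qed.

Definition circ_int (u : R[i] -> R) c r := itg 0 tpi (fun t => u (circ c r t)).

(** Two sides of the rectangle are the angles [0] and [2 pi], whose contributions cancel; the other
    two are the circles. *)
Lemma circ_int_annulus L c r1 r2 : 0 < r1 < r2 ->
  (forall z, r1 <= normc (z - c) <= r2 -> exists l, cder L z l) ->
  circ_int (fun z => complex.Re (L z)) c r1 = circ_int (fun z => complex.Re (L z)) c r2.
Proof.
move=> /andP[r10 r12] hL.
have r20 : 0 < r2 by apply: lt_trans r12.
have lnr : ln r1 < ln r2 by rewrite ltr_ln ?posrE.
have hx x : ln r1 <= x <= ln r2 -> r1 <= expR x <= r2.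
  by rewrite -[r1 in X in _ -> X]lnK ?posrE // -[r2 in X in _ -> X]lnK ?posrE // !ler_expR.
have hL' x y : ln r1 <= x <= ln r2 -> exists l, cder L (circ c (expR x) y) l.
  by move=> /hx h; apply: hL; rewrite normc_circ ger0_norm // expR_ge0.
have cL x y : ln r1 <= x <= ln r2 -> ct L (circ c (expR x) y).
  by move=> h; have [l /cder_ct] := hL' x y h.
have E : itg (ln r1) (ln r2) (fun x => complex.Im (L (circ c (expR x) tpi))) =
    itg (ln r1) (ln r2) (fun x => complex.Im (L (circ c (expR x) 0))).
  by apply: eq_itg => x _; rewrite circ2pi.
have h : rect_bdry (fun x y => complex.Re (L (circ c (expR x) y)))
   (fun x y => complex.Im (L (circ c (expR x) y))) (ln r1) (ln r2) 0 tpi = 0.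
  apply: goursat => //; first exact: tpi_gt0.
  - by move=> x xr; apply: cont_on_circ_Re => t; exact: cL.
  - move=> y _ x xr; apply: (@rct_Im _ (fun x => L (circ c (expR x) y))).
    by apply: rct_comp; [exact: cL|exact: rct_circ_expR].
  - move=> x y xr _; have [l hl] := hL' x y xr.
    by apply: (@cr_diff_cder _ _ _ _ l); rewrite -circ_expR.
rewrite /rect_bdry in h.
rewrite (lnK (x := r1)) in h; last by rewrite posrE.
rewrite (lnK (x := r2)) in h; last by rewrite posrE.
have aux (A B C D : R) : A - B - (C - D) = 0 -> C = D -> B = A by lra.
exact: aux h E.
Qed.

Lemma eq_of_le (x y : R) : (forall e, 0 < e -> `|x - y| <= e) -> x = y.
Proof.
move=> h; apply/eqP; rewrite -subr_eq0 -normr_eq0 eq_le normr_ge0 andbT.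
by apply/ler_addgt0Pr => e /h; rewrite add0r.
Qed.

Lemma circ_int_cont L c r0 r : (forall z, normc (z - c) < r0 -> ct L z) -> 0 <= r < r0 ->
  forall e : R, 0 < e -> exists2 d : R, 0 < d & forall r', 0 <= r' < r0 -> `|r' - r| < d ->
   `|circ_int (fun z => complex.Re (L z)) c r' - circ_int (fun z => complex.Re (L z)) c r| <= e.
Proof.
move=> cL /andP[r_ge0 rr0] e e0.
pose r1 := (r + r0) / 2.
have cL1 z : normc (z - c) <= r1 -> ct L z by move=> h; apply: cL; rewrite /r1 in h; lra.
have e1 : 0 < e / tpi by rewrite divr_gt0 // tpi_gt0.
have [d d0 hd] := unif_ct cL1 e1.
exists (Num.min d (r0 - r) / 2).
  by rewrite divr_gt0 // lt_min d0 subr_gt0.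
have [md mr] : Num.min d (r0 - r) <= d /\ Num.min d (r0 - r) <=
  r0 - r by rewrite !ge_min !lexx orbT.
move=> r' /andP[r'0 r'r0] r'r.
have m0 : 0 < Num.min d (r0 - r) by rewrite lt_min d0 subr_gt0.
have r'r1 : r' <= r1 by move: r'r; rewrite ltr_norml /r1; lra.
have rr1 : r <= r1 by rewrite /r1; lra.
rewrite /circ_int -itgB; last first.
- by apply: cont_on_circ_Re => t; apply: cL; rewrite normc_circ ger0_norm.
- by apply: cont_on_circ_Re => t; apply: cL; rewrite normc_circ ger0_norm.
have -> : e = e / tpi * (tpi - 0) by rewrite subr0 divfK // gt_eqF // tpi_gt0.
apply: normr_itg_le; first exact/ltW/tpi_gt0.
  move=> t _; apply: continuousB; apply: (@cont_on_circ_Re _ _ _ t t) => [s|]; rewrite ?lexx //;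
    apply: cL; rewrite normc_circ ger0_norm //.
move=> t _; rewrite -ReB; apply: le_trans (ler_Re_normc _) _; apply/ltW/hd.
- by rewrite normc_circ ger0_norm.
- by rewrite normc_circ ger0_norm.
- by rewrite circ_dist; lra.
Qed.

Lemma circ_int_center (u : R[i] -> R) c : circ_int u c 0 = tpi * u c.
Proof.
rewrite /circ_int (eq_itg (G := fun=> u c)); last by move=> t _; rewrite circ0.
by rewrite itg_cst ?subr0 1?mulrC //; exact/ltW/tpi_gt0.
Qed.

(* A single point [a] where only continuity is assumed is harmless: the circle
   means are constant on either side of the radius of [a] and continuous across it. *)
Lemma mean_value L c r0 r a : (forall z, normc (z - c) < r0 -> ct L z) ->
  (forall z, normc (z - c) < r0 -> z != a -> exists l, cder L z l) -> 0 <= r < r0 ->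
  circ_int (fun z => complex.Re (L z)) c r = tpi * complex.Re (L c).
Proof.
move=> cL dL /andP[]; rewrite le_eqVlt => /predU1P[<- _|r_gt0 rr0]; first exact: circ_int_center.
rewrite -(circ_int_center (fun z => complex.Re (L z))).
set M := circ_int _ c; pose rho := normc (a - c).
have ann r1 r2 : 0 < r1 < r2 -> r2 < r0 -> ~~ (r1 <= rho <= r2) -> M r1 = M r2.
  move=> h12 r20 h; apply: circ_int_annulus => // z /andP[z1 z2]; apply: dL.
    exact: le_lt_trans r20.
  by apply: contraNneq h => az; rewrite /rho -az z1.
have Mc s : 0 <= s < r0 -> forall e, 0 < e -> exists2 d, 0 < d & forall r',
  0 <= r' < r0 -> `|r' - s| < d ->
   `|M r' - M s| <= e by exact: circ_int_cont.
(* If [a] is the center or lies beyond [s], the mean is constant down to radius [0], where it is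
   given by the value at the center. *)
have small s : 0 < s < r0 -> ~~ (0 < rho <= s) -> M s = M 0.
  move=> /andP[s0 sr0] h; apply: eq_of_le => e e0.
  have [|d d0 hd] := Mc 0 _ e e0; first by rewrite lexx; lra.
  pose s' := Num.min s d / 2.
  have [ms md] : Num.min s d <= s /\ Num.min s d <= d by rewrite !ge_min !lexx orbT.
  have m0 : 0 < Num.min s d by rewrite lt_min s0.
  have s'0 : 0 < s' by rewrite divr_gt0.
  rewrite -(ann s' s) //; first by apply: hd; rewrite ?subr0 ?gtr0_norm /s' //; lra.
    by rewrite /s'; lra.
  apply: contra h => /andP[h1 ->]; rewrite andbT; exact: lt_le_trans h1.
have [h|h] := boolP (0 < rho <= r); last by apply: small => //; rewrite r_gt0.
have /andP[rho0 rhor] := h.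
have Mrho : M rho = M 0.
  apply: eq_of_le => e e0.
  have [|d d0 hd] := Mc rho _ e e0; first by lra.
  pose s' := rho - Num.min rho d / 2.
  have [ms md] : Num.min rho d <= rho /\ Num.min rho d <= d by rewrite !ge_min !lexx orbT.
  have m0 : 0 < Num.min rho d by rewrite lt_min rho0.
  have s'0 : 0 < s' by rewrite /s'; lra.
  rewrite -(small s'); first by rewrite distrC; apply: hd; rewrite ?ltr_norml /s'; lra.
    by rewrite /s'; lra.
  by rewrite /s'; lra.
rewrite -Mrho; have [->//|/eqP nr] := eqVneq r rho.
have {}rhor : rho < r by rewrite lt_neqAle rhor andbT eq_sym; apply/eqP.
apply: eq_of_le => e e0.
have [|d d0 hd] := Mc rho _ e e0; first by lra.
pose s' := rho + Num.min (r - rho) d / 2.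
have [ms md] : Num.min (r - rho) d <= r - rho /\ Num.min (r - rho) d <=
  d by rewrite !ge_min !lexx orbT.
have m0 : 0 < Num.min (r - rho) d by rewrite lt_min d0 subr_gt0 rhor.
rewrite -(ann s' r) //; first by apply: hd; rewrite ?ltr_norml /s'; lra.
  by rewrite /s'; lra.
by rewrite /s'; lra.
Qed.

(** A continuous logarithm of [F / F c] has real part [ln |F| - ln |F c|]. The exceptional point [a]
    admits difference quotients, whose value there is filled in by continuity. *)
Lemma mean_value_ln F c r0 r a : (forall z, normc (z - c) < r0 -> ct F z /\ F z != 0) ->
  (forall z, normc (z - c) < r0 -> z != a -> exists l, cder F z l) -> 0 <= r < r0 ->
  circ_int (fun z => ln (normc (F z))) c r = tpi * ln (normc (F c)).
Proof.
move=> hF dF /andP[r_ge0 rr0]; pose r1 := (r + r0) / 2.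
have r1E : r < r1 < r0 by rewrite /r1; lra.
have [|L hL] := log_branch hF (r := r1); first by lra.
have lt1 z : normc (z - c) < r1 -> normc (z - c) < r0 by lra.
have Fc : F c != 0 by case: (hF c) => //; rewrite subrr nc0; lra.
have lnE z : normc (z - c) < r1 -> ln (normc (F z)) = complex.Re (L z) + ln (normc (F c)).
  move=> /hL[_ /(congr1 (@Normc.normc R))]; rewrite normc_cexp Normc.normcM Normc.normcV => E.
  have -> : normc (F z) = expR (complex.Re (L z)) * normc (F c).
    by rewrite E divfK // normc_eq0.
  by rewrite lnM ?posrE ?expR_gt0 ?normc_gt0 // expRK.
have dL z : normc (z - c) < r1 -> z != a -> exists l, cder L z l.
  move=> zr za; have [l hl] := dF z (lt1 _ zr) za.
  have [cL _] := hL _ zr.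
  have h : cder (fun w => F w / F c) z (l * (F c)^-1 + F z * 0).
    by apply: cderM => //; exact: cder_cst.
  eexists; apply: (cder_log cL) h; exists (r1 - normc (z - c)); first by rewrite subr_gt0.
  move=> w hw; have [|_ ->//] := hL w; have := ler_distc_add z w c; move: hw; lra.
have cL z : normc (z - c) < r1 -> ct L z by move=> /hL[].
have := @mean_value L c r1 r a cL dL; rewrite r_ge0 => /(_ _)/wrap[|h]; first by lra.
have cr t : normc (circ c r t - c) < r1 by rewrite normc_circ ger0_norm //; lra.
rewrite {1}/circ_int (eq_itg (G := fun t => complex.Re (L (circ c r t)) + ln (normc (F c))));
  last first.
  by move=> t _; rewrite lnE.
rewrite itgD; last by exact: cont_on_cst.
  rewrite -/(circ_int (fun z => complex.Re (L z)) c r) h itg_cst; last exact/ltW/tpi_gt0.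
  rewrite [in RHS](lnE c) ?subrr ?nc0; last by lra.
  by rewrite subr0; ring.
by apply: cont_on_circ_Re => t; exact: cL.
Qed.

End mean_value.

(** * Positive semidefinite kernels and logarithmic energy *)

Section psd_kernels.
Variable R : realType.
Implicit Types (K : R -> R -> R) (f g : R -> R) (a b x y : R).

Lemma cont_on_sum (I : eqType) (s : seq I) (F : I -> R -> R) a b :
  (forall i, i \in s -> cont_on a b (F i)) -> cont_on a b (fun x => \sum_(i <- s) F i x).
Proof.
elim: s => [|i s IH] h x xab.
  rewrite (_ : (fun x => _) = fun=> 0); first exact: cst_continuous.
  by apply/funext => z; rewrite big_nil.
rewrite (_ : (fun x => _) = fun x => F i x + \sum_(i <- s) F i x); last first.
  by apply/funext => z; rewrite big_cons.
apply: continuousD; first by apply: h; rewrite ?mem_head.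
by apply: IH => // j js; apply: h; rewrite inE js orbT.
Qed.

Lemma itg_sum (I : eqType) (s : seq I) (F : I -> R -> R) a b : a <= b ->
  (forall i, i \in s -> cont_on a b (F i)) ->
  itg a b (fun x => \sum_(i <- s) F i x) = \sum_(i <- s) itg a b (F i).
Proof.
move=> ab; elim: s => [|i s IH] h.
  by rewrite big_nil (eq_itg (G := fun=> 0)) ?itg_cst ?mul0r // => x _; rewrite big_nil.
have hs j : j \in s -> cont_on a b (F j) by move=> js; apply: h; rewrite inE js orbT.
rewrite big_cons -IH // -itgD; last exact: cont_on_sum.
  by apply: eq_itg => x _; rewrite big_cons.
by apply: h; rewrite mem_head.
Qed.

(** A finite nonnegative combination of rank-one kernels, so that the double integral of [K] is
    literally a finite weighted sum of squares. *)
Definition psd K := exists s : seq (R * (R -> R)),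
  (forall p, p \in s -> 0 <= p.1 /\ continuous p.2) /\
  forall x y, K x y = \sum_(p <- s) p.1 * (p.2 x * p.2 y).

Lemma psd_ext K K' : (forall x y, K x y = K' x y) -> psd K -> psd K'.
Proof. by move=> h [s [h1 h2]]; exists s; split=> // x y; rewrite -h. Qed.

Lemma psd_cst a : 0 <= a -> psd (fun _ _ => a).
Proof.
move=> a0; exists [:: (a, fun=> 1)]; split=> [p|x y]; last by rewrite big_seq1 /= !mulr1.
by rewrite inE => /eqP -> /=; split=> // x; exact: cst_continuous.
Qed.

Lemma psdD K K' : psd K -> psd K' -> psd (fun x y => K x y + K' x y).
Proof.
move=> [s [h1 h2]] [s' [h1' h2']]; exists (s ++ s'); split=> [p|x y].
  by rewrite mem_cat => /orP[/h1|/h1'].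
by rewrite big_cat h2 h2'.
Qed.

Lemma psdZ a K : 0 <= a -> psd K -> psd (fun x y => a * K x y).
Proof.
move=> a0 [s [h1 h2]]; exists [seq (a * p.1, p.2) | p <- s]; split=> [p /mapP[q /h1[q1 q2] ->]|x y].
  by split=> //=; rewrite mulr_ge0.
by rewrite h2 big_map mulr_sumr; apply: eq_bigr => p _ /=; rewrite mulrA.
Qed.

Lemma psd_mul f K : continuous f -> psd K -> psd (fun x y => f x * f y * K x y).
Proof.
move=> cf [s [h1 h2]]; exists [seq (p.1, fun x => f x * p.2 x) | p <- s].
split=> [p /mapP[q /h1[q1 q2] ->]|x y].
  by split=> //= z; apply: continuousM; [exact: cf|exact: q2].
by rewrite h2 big_map mulr_sumr; apply: eq_bigr => p _ /=; ring.
Qed.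

Lemma psd_sum n (K : nat -> R -> R -> R) : (forall i, psd (K i)) -> psd (fun x y =>
  \sum_(i < n) K i x y).
Proof.
move=> h; elim: n => [|n IH]; first by apply: psd_ext (psd_cst (lexx 0)) => x y; rewrite big_ord0.
by apply: psd_ext (psdD IH (h n)) => x y; rewrite big_ord_recr.
Qed.

Lemma psd_itg_ge0 K a b : a <= b -> psd K -> 0 <= itg a b (fun x => itg a b (K x)).
Proof.
move=> ab [s [h1 h2]].
have inner x : itg a b (K x) = \sum_(p <- s) p.1 * p.2 x * itg a b p.2.
  rewrite (eq_itg (G := fun y => \sum_(p <- s) p.1 * p.2 x * p.2 y)); last first.
    by move=> y _; rewrite h2; apply: eq_bigr => p _; rewrite mulrA.
  rewrite itg_sum // => [|p /h1[_ cp] y _].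
    by rewrite big_seq [RHS]big_seq; apply: eq_bigr => p /h1[_ cp]; rewrite itgZ // => y _;
      exact: cp.
  by apply: continuousM; [exact: cst_continuous|exact: cp].
rewrite (eq_itg (G := fun x => \sum_(p <- s) p.1 * itg a b p.2 * p.2 x)); last first.
  by move=> x _; rewrite inner; apply: eq_bigr => p _; rewrite mulrAC.
rewrite itg_sum // => [|p /h1[_ cp] y _]; last first.
  by apply: continuousM; [exact: cst_continuous|exact: cp].
rewrite big_seq; apply: sumr_ge0 => p /h1[p0 cp].
rewrite itgZ; last by move=> y _; exact: cp.
by rewrite -mulrA mulr_ge0 // -expr2 sqr_ge0.
Qed.

(** Only the odd, respectively even, powers of [b] survive, with nonnegative coefficients, and
    products of [b] and [c] are again positive semidefinite. Each claim feeds the other, hence the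
    joint induction. *)
Lemma psd_powB (f1 f2 f3 : R -> R) n : continuous f1 -> continuous f2 -> continuous f3 ->
  let c x y := f3 x * f3 y in let b x y := f1 x * f1 y + f2 x * f2 y in
  psd (fun x y => (c x y + b x y) ^+ n - (c x y - b x y) ^+ n) /\
  psd (fun x y => (c x y + b x y) ^+ n + (c x y - b x y) ^+ n).
Proof.
move=> c1 c2 c3 c b; elim: n => [|n [IH1 IH2]].
  split; first by apply: psd_ext (psd_cst (lexx 0)) => x y; rewrite subrr.
  by apply: psd_ext (psd_cst (ler0n _ 2)) => x y; rewrite -mulr2n.
have step X Y : psd X -> psd Y -> psd (fun x y => c x y * X x y + b x y * Y x y).
  move=> hX hY; apply: psd_ext (psdD (psd_mul c3 hX) (psdD (psd_mul c1 hY) (psd_mul c2 hY))).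
  by move=> x y; rewrite /c /b; ring.
by split; [apply: psd_ext (step _ _ IH1 IH2)|apply: psd_ext (step _ _ IH2 IH1)] => x y;
  rewrite !exprS; ring.
Qed.

(** The remainder vanishes at [0] and has derivative [x^N / (1 - x)]. *)
Lemma ln_series_approx q N x : 0 <= q < 1 -> `|x| <= q ->
  `|- ln (1 - x) - \sum_(i < N) x ^+ i.+1 / i.+1%:R| <= q ^+ N / (1 - q).
Proof.
move=> /andP[q0 q1] xq.
pose D (x : R) := - ln (1 - x) - \sum_(i < N) x ^+ i.+1 / i.+1%:R.
pose D' (x : R) := x ^+ N / (1 - x).
have dD (z : R) : `|z| <= q -> is_derive z 1 D (D' z).
  move=> zq; have z1 : z < 1 by apply: le_lt_trans (ler_norm z) _; exact: le_lt_trans q1.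
  have z1' : 0 < 1 - z by rewrite subr_gt0.
  have d1 : is_derive z 1 (fun x : R => 1 - x) (- 1).
    have : is_derive z 1 (cst 1 - id) (0 - 1 : R) by apply: is_deriveB.
    by rewrite sub0r.
  have d2 : is_derive z 1 (fun x : R => ln (1 - x)) ((1 - z)^-1 * -1).
    exact: (@is_derive1_comp R (@ln R) (fun x => 1 - x) z _ _ (is_derive1_ln z1') d1).
  have d3 : is_derive z 1 (fun x : R => \sum_(i < N) x ^+ i.+1 / i.+1%:R) (\sum_(i < N) z ^+ i).
    elim: (N) => [|n IH].
      rewrite big_ord0 (_ : (fun x => _) = fun=> 0); first exact: is_derive_cst.
      by apply/funext => w; rewrite big_ord0.
    rewrite big_ord_recr (_ : (fun x => _) = (fun x => \sum_(i < n) x ^+ i.+1 / i.+1%:R) +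
      (n.+1%:R^-1 \*: (id ^+ n.+1))); last first.
      by apply/funext => w; rewrite big_ord_recr /= !fctE mulrC.
    apply: is_deriveD.
    have : is_derive z 1 (n.+1%:R^-1 \*: (id ^+ n.+1) : R -> R) (n.+1%:R^-1 *: (n.+1%:R * id z ^+
      n *: 1)).
      by apply: is_deriveZ.
    by rewrite /GRing.scale /= mulr1 mulrA mulVf ?pnatr_eq0 // mul1r.
  suff -> : D' z = - ((1 - z)^-1 * -1) - \sum_(i < N) z ^+ i.
    exact: is_deriveB (is_deriveN d2) d3.
  rewrite mulrN1 opprK /D'.
  have -> : \sum_(i < N) z ^+ i = (1 - z ^+ N) / (1 - z).
    rewrite -[1 in X in X / _](expr1n _ N) subrXX mulrC mulKf ?gt_eqF //.
    by apply: eq_bigr => i _; rewrite expr1n mul1r.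
  by field; rewrite gt_eqF.
have D0 : D 0 = 0.
  rewrite /D subr0 ln1 oppr0 sub0r big1 ?oppr0 // => i _.
  by rewrite expr0n mul0r.
have bD c : `|c| <= q -> `|D' c| <= q ^+ N / (1 - q).
  move=> cq; rewrite normrM normrX normrV ?unitfE; last first.
    by rewrite subr_eq0 gt_eqF //; apply: le_lt_trans (ler_norm c) _; exact: le_lt_trans q1.
  apply: ler_pM; rewrite ?exprn_ge0 ?invr_ge0 //; first exact: lerXn2r.
  have c1 : 1 - q <= `|1 - c| by have := ler_norm (1 - c); have := ler_norm c; lra.
  by rewrite lef_pV2 ?posrE // ?subr_gt0 //; apply: lt_le_trans c1; rewrite subr_gt0.
have cD (u v : R) : (forall z, u <= z <= v -> `|z| <= q) -> {within `[u, v], continuous D}.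
  move=> h; apply: derivable_within_continuous => z; rewrite in_itv /= => /h/dD[].
  by [].
have le1 : `|D x| <= q ^+ N / (1 - q) * `|x|.
  have [x0|x0] := leP 0 x.
    have hx (z : R) : 0 <= z <= x -> `|z| <= q by move=> hz; move: xq; rewrite !ger0_norm; lra.
    have [||c] := @MVT_segment R D D' 0 x x0; last first.
    - rewrite in_itv /= D0 !subr0 => /hx/bD h ->; rewrite normrM ler_wpM2r //.
    - exact: cD.
    - by move=> z; rewrite in_itv /= => hz; apply/dD/hx; lra.
  have hx (z : R) : x <= z <= 0 -> `|z| <= q by move=> hz; move: xq;
    rewrite (ltr0_norm x0) ler0_norm; lra.
  have [||c] := @MVT_segment R D D' x 0 (ltW x0); last first.
  - rewrite in_itv /= D0 !sub0r => /hx/bD h h'; rewrite -normrN h' normrM normrN ler_wpM2r //.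
  - exact: cD.
  - by move=> z; rewrite in_itv /= => hz; apply/dD/hx; lra.
apply: le_trans le1 _; rewrite ler_piMr //; last by apply: ltW; apply: le_lt_trans q1.
by rewrite divr_ge0 ?exprn_ge0 // subr_ge0 ltW.
Qed.

End psd_kernels.

(** * Regularized logarithmic energy *)

Section energy.
Variable R : realType.
Implicit Types (K G : R -> R -> R) (h k : R -> R[i]) (a b x y : R).

Lemma contM (f g : R -> R) : continuous f -> continuous g -> continuous (fun x => f x * g x).
Proof. by move=> cf cg x; apply: continuousM; [exact: cf|exact: cg]. Qed.

Lemma contD (f g : R -> R) : continuous f -> continuous g -> continuous (fun x => f x + g x).
Proof. by move=> cf cg x; apply: continuousD; [exact: cf|exact: cg]. Qed.

Lemma cont_cst (c : R) : continuous (fun _ : R => c).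
Proof. by move=> x; exact: cst_continuous. Qed.

Lemma psd_cont K : psd K -> forall x, continuous (K x).
Proof.
move=> [s [h1 h2]] x y.
rewrite (_ : K x = fun y => \sum_(p <- s) p.1 * (p.2 x * p.2 y)); last first.
  by apply/funext => z; rewrite h2.
apply: (@cont_on_sum _ _ s (fun p y => p.1 * (p.2 x * p.2 y)) y y _ y); last by rewrite lexx.
move=> p /h1[_ cp] z _; apply: continuousM; first exact: cst_continuous.
by apply: continuousM; [exact: cst_continuous|exact: cp].
Qed.

Lemma psd_itg_cont K a b : a <= b -> psd K -> continuous (fun x => itg a b (K x)).
Proof.
move=> ab [s [h1 h2]] x.
have inner z : itg a b (K z) = \sum_(p <- s) p.1 * itg a b p.2 * p.2 z.
  rewrite (eq_itg (G := fun y => \sum_(p <- s) p.1 * p.2 z * p.2 y)); last first.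
    by move=> y _; rewrite h2; apply: eq_bigr => p _; rewrite mulrA.
  rewrite itg_sum // => [|p /h1[_ cp] y _].
    by rewrite big_seq [RHS]big_seq; apply: eq_bigr => p /h1[_ cp]; rewrite itgZ;
      [ring|move=> y _; exact: cp].
  by apply: continuousM; [exact: cst_continuous|exact: cp].
rewrite (_ : (fun x => _) = fun z => \sum_(p <- s) p.1 * itg a b p.2 * p.2 z); last exact/funext.
apply: (@cont_on_sum _ _ s (fun p z => p.1 * itg a b p.2 * p.2 z) x x _ x); last by rewrite lexx.
by move=> p /h1[_ cp] z _; apply: continuousM; [exact: cst_continuous|exact: cp].
Qed.

Lemma itg_param_cont G a b x : a <= b -> (forall z, cont_on a b (G z)) ->
  (forall e : R, 0 < e -> exists2 d, 0 < d & forall x', `|x' - x| < d -> forall y,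
    a <= y <= b -> `|G x' y - G x y| <= e) ->
  {for x, continuous (fun x => itg a b (G x))}.
Proof.
move=> ab cG h; apply: near_for_continuous => e e0.
have e1 : 0 < e / (2 * (b - a + 1)) by rewrite divr_gt0 // mulr_gt0 //; lra.
have [d d0 hd] := h _ e1; exists d => // x' /hd hx.
rewrite -itgB //; apply: le_lt_trans (normr_itg_le ab _ hx) _.
  by move=> y yab; apply: continuousB; exact: cG.
have ba : 0 < b - a + 1 by lra.
rewrite mulrAC ltr_pdivrMr; last by rewrite mulr_gt0.
by rewrite ltr_pM2l //; lra.
Qed.

Lemma ln_le_lip (e A B : R) : 0 < e -> 0 <= A -> 0 <= B -> ln (A + e) - ln (B + e) <= `|A - B| / e.
Proof.
move=> e0 A0 B0.
have Ae : 0 < A + e by lra.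
have Be : 0 < B + e by lra.
rewrite -ln_div ?posrE //.
have -> : (A + e) / (B + e) = 1 + (A - B) / (B + e) by field; rewrite gt_eqF.
have h : (A - B) / (B + e) <= `|A - B| / e.
  apply: (@le_trans _ _ (`|A - B| / (B + e))).
    by rewrite ler_pM2r ?invr_gt0 // ler_norm.
  by rewrite ler_wpM2l // lef_pV2 ?posrE //; lra.
apply: le_trans h; apply: le_ln1Dx.
have -> : (A - B) / (B + e) = (A + e) / (B + e) - 1 by field; rewrite gt_eqF.
by rewrite ltrBrDr addNr divr_gt0.
Qed.

Lemma ln_lip (e A B : R) : 0 < e -> 0 <= A -> 0 <= B -> `|ln (A + e) - ln (B + e)| <= `|A - B| / e.
Proof.
move=> e0 A0 B0; rewrite ler_norml ln_le_lip // andbT lerNl opprB distrC.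
by rewrite ln_le_lip.
Qed.

(** Twice the logarithmic distance from [z] to [- w], regularized by [e]. The plus sign treats sums
    [h x + h y] directly and differences through [- h y]. *)
Definition ln_dist (e : R) z w : R := ln (normc (z + w) ^+ 2 + e).

Lemma ln_dist_cont (e : R) h z x : 0 < e -> rct h x -> {for x,
  continuous (fun y => ln_dist e z (h y))}.
Proof.
move=> e0 ch.
apply: (@continuous_comp _ _ _ (fun y => normc (z + h y) ^+ 2 + e) (@ln R)).
  apply: continuousD; last exact: cst_continuous.
  have cn : {for x, continuous (fun y => normc (z + h y))}.
    apply: (@rct_normc _ (fun y => z + h y)); move=> d /ch[d' d'0 hd]; exists d' => // s /hd.
    by rewrite opprD addrACA subrr add0r.
  rewrite (_ : (fun y => _) = (fun y => normc (z + h y) * normc (z + h y))).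
    exact: continuousM.
  by apply/funext => y; rewrite expr2.
by apply: continuous_ln; rewrite ltr_wpDl ?exprn_ge0 ?normc_ge0.
Qed.

Lemma rct_bounded h a b : a <= b -> (forall t, rct h t) ->
  exists2 M, 0 <= M & forall y, a <= y <= b -> normc (h y) <= M.
Proof.
move=> ab ch.
have [|c _ hc] := @EVT_max R (fun y => normc (h y)) a b ab.
  by apply: continuous_in_subspaceT => x _; apply: rct_normc.
exists (normc (h c)); first exact: normc_ge0.
by move=> y yab; apply: hc; rewrite in_itv.
Qed.

Lemma itg_ln_dist_cont (e : R) h k a b x : 0 < e -> a <= b -> rct h x -> (forall t, rct k t) ->
  {for x, continuous (fun x => itg a b (fun y => ln_dist e (h x) (k y)))}.
Proof.
move=> e0 ab ch ck; apply: itg_param_cont => // [z y _|e1 e10]; first exact: ln_dist_cont.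
have [M M0 hM] := rct_bounded ab ck.
pose L := 2 * normc (h x) + 1 + 2 * M.
have L0 : 0 < L by rewrite /L; have := normc_ge0 (h x); lra.
have e2 : 0 < Num.min 1 (e1 * e / L) by rewrite lt_min ltr01 divr_gt0 // mulr_gt0.
have [m1 m2] : Num.min 1 (e1 * e / L) <= 1 /\ Num.min 1 (e1 * e / L) <= e1 *
  e / L by rewrite !ge_min !lexx orbT.
have [d d0 hd] := ch _ e2; exists d => // x' /hd hx y /hM yM.
apply: le_trans (ln_lip e0 _ _) _; rewrite ?exprn_ge0 ?normc_ge0 //.
rewrite ler_pdivrMr // subr_sqr normrM.
have dd : `|normc (h x' + k y) - normc (h x + k y)| <= normc (h x' - h x).
  by apply: le_trans (ler_dist_normc _ _) _; rewrite opprD addrACA subrr addr0.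
have ss : `|normc (h x' + k y) + normc (h x + k y)| <= L.
  rewrite ger0_norm ?addr_ge0 ?normc_ge0 //.
  have := ler_normcD (h x') (k y); have := ler_normcD (h x) (k y).
  have := ler_normcB_dist (h x') (h x); rewrite /L; lra.
apply: le_trans (ler_pM _ _ dd ss) _ => //.
by rewrite -ler_pdivlMr // ltW //; lra.
Qed.

Lemma expr_cvg0_lt (q e : R) : 0 <= q < 1 -> 0 < e -> exists N, q ^+ N < e.
Proof.
move=> /andP[q0 q1] e0.
have : (GRing.exp q) n @[n --> \oo] --> (0 : R) by apply: cvg_expr; rewrite ger0_norm.
move=> /(@cvgrPdist_lt R R) /(_ _ e0) [N _ hN]; exists N.
by have := hN N (leqnn N); rewrite sub0r normrN ger0_norm ?exprn_ge0.
Qed.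

(* Stereographic projection onto the paraboloid turns [|w - w'|^2 + e] into a multiple of
   [1 - k . k'] with [|k| < 1]; then [- ln (1 - k . k')] is a positive combination of the
   positive semidefinite kernels [(k . k') ^ n]. *)
Lemma energy_le (e : R) h a b : 0 < e -> a <= b -> (forall t, rct h t) ->
  itg a b (fun x => itg a b (fun y => ln_dist e (h x) (- h y))) <=
  itg a b (fun x => itg a b (fun y => ln_dist e (h x) (h y))).
Proof.
move=> e0 ab ch.
have chN t : rct (fun y => - h y) t.
  by move=> d d0; have [d' d'0 hd] := ch t _ d0; exists d' => // s /hd; rewrite -opprD normcN.
pose s x : R := normc (h x) ^+ 2 + e / 2.
have s0 x : 0 < s x by rewrite /s ltr_wpDl ?exprn_ge0 ?normc_ge0 // divr_gt0.
have s1 x : s x + 1 != 0 by rewrite gt_eqF // ltr_wpDr.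
have cn : continuous (fun x => normc (h x)) by move=> x; exact: rct_normc.
have cs : continuous (fun x => s x + 1).
  exact: (contD (contD (contM cn cn) (@cont_cst (e / 2))) (@cont_cst 1)).
have cV : continuous (fun x => (s x + 1)^-1).
  by move=> x; apply: (@continuousV _ _ (fun x => s x + 1)) => //; exact: cs.
(* Replacing [h] by [- h] changes the sign of [k1] and [k2] and fixes [k3]; hence the split of the
   inner product into [c] and [d] below. *)
pose k1 x : R := 2 * complex.Re (h x) * (s x + 1)^-1.
pose k2 x : R := 2 * complex.Im (h x) * (s x + 1)^-1.
pose k3 x : R := (s x + 1 - 2) * (s x + 1)^-1.
have cRe : continuous (fun x => complex.Re (h x)) by move=> x; exact: rct_Re.
have cIm : continuous (fun x => complex.Im (h x)) by move=> x; exact: rct_Im.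
have ck1 : continuous k1 by exact: (contM (contM (@cont_cst 2) cRe) cV).
have ck2 : continuous k2 by exact: (contM (contM (@cont_cst 2) cIm) cV).
have ck3 : continuous k3 by exact: (contM (contD cs (@cont_cst (- 2))) cV).
pose c x y : R := k3 x * k3 y.
pose d x y : R := k1 x * k1 y + k2 x * k2 y.
(* Truncation of the series of [- ln (1 - (c + d)) + ln (1 - (c - d))], whose double integral is the
   difference of the two energies. *)
pose KN N x y : R := \sum_(i < N) (i.+1%:R^-1) * ((c x y + d x y) ^+ i.+1 - (c x y - d x y) ^+
  i.+1).
have psdK N : psd (KN N).
  apply: (@psd_sum _ _ (fun i x y => (i.+1%:R^-1) * ((c x y + d x y) ^+ i.+1 - (c x y - d x y) ^+
    i.+1))) => i.
  apply: psdZ; first by rewrite invr_ge0.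
  by have [] := psd_powB i.+1 ck1 ck2 ck3.
have [M M0 hM] := rct_bounded ab ch.
pose S : R := M ^+ 2 + e / 2.
have S0 : 0 < S by rewrite /S ltr_wpDl ?exprn_ge0 // divr_gt0.
(* [|k|^2 = 1 - 2 e / (s + 1)^2] with [s <= S] on the interval, so both series converge
   geometrically with ratio [q]. *)
pose q : R := 1 - 2 * e / (S + 1) ^+ 2.
have q1 : q < 1 by rewrite /q ltrBlDr ltrDl divr_gt0 ?exprn_gt0 ?mulr_gt0 //; lra.
have kq x : a <= x <= b -> k1 x ^+ 2 + k2 x ^+ 2 + k3 x ^+ 2 <= q.
  move=> /hM xM.
  have -> : k1 x ^+ 2 + k2 x ^+ 2 + k3 x ^+ 2 = 1 - 2 * e / (s x + 1) ^+ 2.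
    have -> : k1 x ^+ 2 + k2 x ^+ 2 + k3 x ^+ 2 =
      (4 * (complex.Re (h x) ^+ 2 + complex.Im (h x) ^+ 2) + (s x - 1) ^+ 2) / (s x + 1) ^+ 2.
      by rewrite /k1 /k2 /k3; field.
    rewrite -sqr_normcE.
    have -> : normc (h x) ^+ 2 = s x - e / 2 by rewrite /s addrK.
    by field.
  have sx1 : 0 < s x + 1 by rewrite addr_gt0.
  have S1 : 0 < S + 1 by rewrite addr_gt0.
  have sS : s x + 1 <= S + 1.
    by rewrite lerD2r /s /S lerD2r lerXn2r ?nnegrE ?normc_ge0.
  rewrite /q lerD2l lerN2; apply: ler_wpM2l; first by rewrite mulr_ge0 // ltW.
  rewrite lef_pV2 ?posrE ?exprn_gt0 //.
  by rewrite lerXn2r // ?nnegrE; exact: ltW.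
have q0 : 0 <= q.
  by apply: le_trans (kq a _); rewrite ?lexx ?ab // !addr_ge0 ?sqr_ge0.
have cdq x y : a <= x <= b -> a <= y <= b -> `|c x y + d x y| <= q /\ `|c x y - d x y| <= q.
  move=> /kq hx /kq hy; rewrite /c /d; move: hx hy.
  move: (k1 x) (k2 x) (k3 x) (k1 y) (k2 y) (k3 y) => x1 x2 x3 y1 y2 y3 hx hy.
  have := sqr_ge0 (x1 - y1); have := sqr_ge0 (x2 - y2); have := sqr_ge0 (x3 - y3).
  have := sqr_ge0 (x1 + y1); have := sqr_ge0 (x2 + y2); have := sqr_ge0 (x3 + y3).
  by rewrite !ler_norml; split; nra.
have cdE x y : - ln (1 - (c x y + d x y)) + ln (1 - (c x y - d x y)) =
   ln_dist e (h x) (h y) - ln_dist e (h x) (- h y).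
  have E1 : 1 - (c x y + d x y) = (normc (h x - h y) ^+ 2 + e) * (2 / ((s x + 1) * (s y + 1))).
    have nE : normc (h x - h y) ^+ 2 + e = s x + s y - 2 * (complex.Re (h x) * complex.Re (h y) +
      complex.Im (h x) * complex.Im (h y)).
      by rewrite /s !sqr_normcE ReB ImB; field.
    by rewrite nE /c /d /k1 /k2 /k3; field; rewrite !s1.
  have E2 : 1 - (c x y - d x y) = (normc (h x + h y) ^+ 2 + e) * (2 / ((s x + 1) * (s y + 1))).
    have nE : normc (h x + h y) ^+ 2 + e = s x + s y + 2 * (complex.Re (h x) * complex.Re (h y) +
      complex.Im (h x) * complex.Im (h y)).
      by rewrite /s !sqr_normcE ReD ImD; field.
    by rewrite nE /c /d /k1 /k2 /k3; field; rewrite !s1.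
  have P0 : 0 < 2 / ((s x + 1) * (s y + 1)) by rewrite divr_gt0 // mulr_gt0 // ltr_wpDr.
  have Pn z : 0 < normc z ^+ 2 + e by rewrite ltr_wpDl ?exprn_ge0 ?normc_ge0.
  rewrite E1 E2; move: P0; move: (2 / _) => P P0.
  by rewrite !lnM ?posrE // /ln_dist; ring.
pose G x y : R := ln_dist e (h x) (h y) - ln_dist e (h x) (- h y).
have cG x : cont_on a b (G x) by move=> y _; apply: continuousB; apply: ln_dist_cont.
have cGi : cont_on a b (fun x => itg a b (fun y => ln_dist e (h x) (h y))).
  by move=> x _; apply: itg_ln_dist_cont.
have cGi' : cont_on a b (fun x => itg a b (fun y => ln_dist e (h x) (- h y))).
  by move=> x _; apply: itg_ln_dist_cont.
rewrite -subr_ge0 -itgB //.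
rewrite (eq_itg (G := fun x => itg a b (G x))); last first.
  by move=> x _; rewrite itgB //; move=> y _; apply: ln_dist_cont.
have cGG : cont_on a b (fun x => itg a b (G x)).
  move=> x xab; rewrite (_ : (fun x => _) = (fun x => itg a b (fun y =>
    ln_dist e (h x) (h y)) - itg a b (fun y => ln_dist e (h x) (- h y)))).
    by apply: continuousB; [exact: cGi|exact: cGi'].
  by apply/funext => z; rewrite itgB //; move=> y _; apply: ln_dist_cont.
have main N : 0 <= itg a b (fun x => itg a b (G x)) + 2 * (q ^+ N / (1 - q)) * (b - a) * (b - a).
  apply: le_trans (psd_itg_ge0 ab (psdK N)) _.
  rewrite -(itg_cst (2 * (q ^+ N / (1 - q)) * (b - a)) ab) -itgD //; last exact: cont_on_cst.
  apply: le_itg.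
  - by move=> x _; exact: psd_itg_cont.
  - by move=> x xab; apply: continuousD; [exact: cGG|exact: cst_continuous].
  move=> x xab; rewrite -(itg_cst (2 * (q ^+ N / (1 - q))) ab) -itgD //; last exact: cont_on_cst.
  apply: le_itg.
  - by move=> y _; exact: psd_cont.
  - by move=> y yab; apply: continuousD; [exact: cG|exact: cst_continuous].
  move=> y yab; rewrite /G -cdE /KN.
  have [b1 b2] := cdq x y xab yab.
  have qq : 0 <= q < 1 by rewrite q0.
  have := ln_series_approx N qq b1; have := ln_series_approx N qq b2.
  have -> : \sum_(i < N) i.+1%:R^-1 * ((c x y + d x y) ^+ i.+1 - (c x y - d x y) ^+ i.+1) =
    \sum_(i < N) (c x y + d x y) ^+ i.+1 / i.+1%:R - \sum_(i < N) (c x y - d x y) ^+ i.+1 / i.+1%:R.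
    by rewrite -sumrB; apply: eq_bigr => i _; rewrite mulrC mulrBl.
  by rewrite !ler_norml; lra.
apply/ler_addgt0Pr => eta eta0.
pose A : R := 2 / (1 - q) * (b - a) * (b - a) + 1.
have A0 : 0 < A.
  by rewrite ltr_wpDl // !mulr_ge0 ?invr_ge0 //; lra.
have qq : 0 <= q < 1 by rewrite q0.
have [N hN] := expr_cvg0_lt qq (divr_gt0 eta0 A0).
apply: le_trans (main N) _; rewrite lerD2l.
have -> : 2 * (q ^+ N / (1 - q)) * (b - a) * (b - a) = q ^+ N * (A - 1) by rewrite /A; field;
  rewrite subr_eq0 gt_eqF.
rewrite ltr_pdivlMr // in hN.
have : 0 <= q ^+ N by rewrite exprn_ge0.
by lra.
Qed.

End energy.

(** * Univalent functions: nonvanishing derivative and the Koebe estimate *)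

Section difference_quotient.
Variable R : realType.
Implicit Types (f F G : R[i] -> R[i]) (a c z w l m : R[i]) (r : R).

Definition holo f c r := forall z, normc (z - c) < r -> exists l, cder f z l.

Definition inj_disc f c r := forall z w, normc (z - c) < r -> normc (w - c) < r -> f z = f w ->
  z = w.

(** The value [l] is meant to be the derivative at [a], which makes the quotient continuous there;
    [a] then serves as the exceptional point of [mean_value_ln]. *)
Definition quot f a l z := if z == a then l else (f z - f a) / (z - a).

Lemma quotE f a l z : f z - f a = quot f a l z * (z - a).
Proof.
rewrite /quot; case: eqP => [->|/eqP za]; first by rewrite !subrr mulr0.
by rewrite divfK // subr_eq0.
Qed.

Lemma quot_cder f a l m z : z != a -> cder f z m -> exists l', cder (quot f a l) z l'.
Proof.
move=> za hf.
have za' : z - a != 0 by rewrite subr_eq0.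
have h1 := cderB hf (cder_cst (f a) z).
have h2 := @cder_fV _ (fun w => w - a) z _ za' (cderB (cder_id z) (cder_cst a z)).
eexists; apply: cder_locally (cderM h1 h2).
exists (normc (z - a)); first by rewrite normc_gt0.
move=> w wz; rewrite /quot; case: eqP => // wa.
by move: wz; rewrite wa normcB ltxx.
Qed.

Lemma quot_ct f a l z : (exists m, cder f z m) -> cder f a l -> ct (quot f a l) z.
Proof.
move=> [m hf] fl; have [->|za] := eqVneq z a; first by move/cderE : fl.
by have [l' /cder_ct] := quot_cder l za hf.
Qed.

(** This is how injectivity enters the mean value computations. *)
Lemma quot_neq0 f a l c r z : inj_disc f c r -> l != 0 -> normc (a - c) < r ->
  normc (z - c) < r -> quot f a l z != 0.
Proof.
move=> fi l0 ac zc; rewrite /quot; case: (z =P a) => // /eqP za.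
rewrite mulf_neq0 ?invr_eq0 ?subr_eq0 //.
by apply: contra_neq za => /fi; apply.
Qed.

Lemma quot_diag f a l : quot f a l a = l.
Proof. by rewrite /quot eqxx. Qed.

Lemma quot_sym f a l b m : a != b -> quot f a l b = quot f b m a.
Proof.
move=> ab; rewrite /quot eq_sym (negPf ab).
by rewrite -(opprB (f a)) -(opprB a) invrN mulrNN.
Qed.

(** Obtained from [disc_uniform] by letting the scale [d] itself be the lower bound; off the circle
    the requirement is void. *)
Lemma circ_lower G c r : (forall z, normc (z - c) = r -> ct G z /\ G z != 0) ->
  exists2 m : R, 0 < m & forall z, normc (z - c) = r -> m <= normc (G z).
Proof.
move=> hG.
have [|x xr|d d0 hd] := @disc_uniform R c r (fun x d => normc (x - c) = r -> d <= normc (G x)).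
- by move=> x d d' /andP[_ d'd] h /h; exact: le_trans.
- have [xE|xE] := eqVneq (normc (x - c)) r; last first.
    exists (r - normc (x - c)); first by rewrite subr_gt0 lt_neqAle xE.
    move=> x' hx' _ x'r; exfalso; have := ler_distc_add x x' c.
    by move: hx'; rewrite x'r; lra.
  have [cx nx] := hG x xE.
  have n0 : 0 < normc (G x) / 2 by rewrite divr_gt0 // normc_gt0.
  have [d d0 hd] := cx _ n0; exists (Num.min d (normc (G x) / 2)); first by rewrite lt_min d0.
  have [md mG] : Num.min d (normc (G x) / 2) <= d /\ Num.min d (normc (G x) / 2) <= normc (G x) / 2.
    by rewrite !ge_min !lexx orbT.
  move=> x' hx' _ _; have := hd x' (lt_le_trans hx' md).
  have := ler_normcB_dist (G x) (G x'); rewrite normcB.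
  by move: mG; lra.
by exists d => // z zr; apply: hd => //; rewrite zr.
Qed.

Lemma circ_int_ge (u : R[i] -> R) c r (k : R) : (forall t, {for t,
  continuous (fun t => u (circ c r t))}) ->
  (forall t, k <= u (circ c r t)) -> (pi *+ 2) * k <= circ_int u c r.
Proof.
move=> cu ku; have tp := ltW (@tpi_gt0 R).
rewrite /circ_int mulrC -[X in k * X]subr0 -itg_cst //; apply: le_itg => //.
exact: cont_on_cst.
Qed.

Lemma cont_ln_normc F c r t : ct F (circ c r t) -> F (circ c r t) != 0 ->
  {for t, continuous (fun t => ln (normc (F (circ c r t))))}.
Proof.
move=> cF F0; apply: (@continuous_comp _ _ _ (fun t => normc (F (circ c r t))) (@ln R)).
  by apply: rct_normc; apply: rct_comp => //; exact: rct_circ.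
by apply: continuous_ln; rewrite normc_gt0.
Qed.

(** The mean of [ln |F|] over the circle is [ln |F c|], and it is at least [ln k]. *)
Lemma min_principle F c r0 r a (k : R) : (forall z, normc (z - c) < r0 -> ct F z /\ F z != 0) ->
  (forall z, normc (z - c) < r0 -> z != a -> exists l, cder F z l) -> 0 <= r < r0 -> 0 < k ->
  (forall z, normc (z - c) = r -> k <= normc (F z)) -> k <= normc (F c).
Proof.
move=> hF dF /andP[r_ge0 rr0] k0 hk.
have rE t : normc (circ c r t - c) = r by rewrite normc_circ ger0_norm.
have F0 : F c != 0 by case: (hF c) => //; rewrite subrr nc0; lra.
have r00 : 0 <= r < r0 by rewrite r_ge0.
have := mean_value_ln hF dF r00 => E.
have : (pi *+ 2) * ln k <= (pi *+ 2) * ln (normc (F c)).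
  rewrite -E; apply: circ_int_ge => t.
    by have [|c1 c2] := hF (circ c r t); [rewrite rE|exact: cont_ln_normc].
  have h := hk _ (rE t).
  by rewrite ler_ln ?posrE //; exact: lt_le_trans h.
by rewrite ler_pM2l ?tpi_gt0 // ler_ln ?posrE ?normc_gt0.
Qed.

Lemma is_derive_of_approx (f : R -> R) (x l : R) : (forall e, 0 < e ->
  exists2 d, 0 < d & forall h, `|h| < d -> `|f (x + h) - f x - l * h| <= e * `|h|) ->
    is_derive x 1 f l.
Proof.
move=> hf.
have hl : (fun h => h^-1 *: ((f \o shift x) (h *: (1 : R)) - f x)) @ 0^' --> (l : R^o).
  apply/(@cvgrPdist_lt R R^o) => e e0.
  have [d d0 hd] := hf _ (divr_gt0 e0 (ltr0Sn R 1)).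
  apply/nbhs_ballP; exists d => //= h; rewrite /ball /= sub0r normrN => hh h0.
  have := hd _ hh; rewrite [h *: 1]mulr1 [h + x]addrC.
  have -> : l - h^-1 *: (f (x + h) - f x) = - ((f (x + h) - f x - l * h) / h).
    by rewrite /GRing.scale /=; field.
  rewrite normrN normrM normrV ?unitfE // ltr_pdivrMr ?normr_gt0 // => hle.
  apply: le_lt_trans hle _; rewrite ltr_pM2r ?normr_gt0 //; lra.
apply: DeriveDef; first by apply/cvg_ex; exists l.
exact: (cvg_lim _ hl).
Qed.

Lemma cder_approx F z l (e : R) : cder F z l -> 0 < e -> exists2 d, 0 < d &
  forall w, normc (w - z) < d -> normc (F w - F z - l * (w - z)) <= e * normc (w - z).
Proof.
move=> /cderE h /h[d d0 hd]; exists d => // w /hd; rewrite eqxx.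
case: eqP => [-> _|/eqP wz /ltW]; first by rewrite !subrr mulr0 subr0 nc0 mulr0.
have -> : F w - F z - l * (w - z) = ((F w - F z) / (w - z) - l) * (w - z).
  by field; rewrite subr_eq0.
by rewrite Normc.normcM => hh; rewrite ler_wpM2r ?normc_ge0.
Qed.

Lemma is_derive_Re F z v l (t : R) : cder F (z + t%:C * v) l ->
  is_derive t 1 (fun s : R => complex.Re (F (z + s%:C * v))) (complex.Re (l * v)).
Proof.
move=> hF; apply: is_derive_of_approx => e e0.
have v1 : 0 < normc v + 1 by rewrite ltr_wpDl ?normc_ge0.
have [d d0 hd] := cder_approx hF (divr_gt0 e0 v1).
exists (d / (normc v + 1)); first by rewrite divr_gt0.
move=> h; rewrite ltr_pdivlMr // => hh.
have E : z + (t + h)%:C * v - (z + t%:C * v) = h%:C * v by rewrite rmorphD; ring.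
have nE : normc (h%:C * v) <= `|h| * (normc v + 1).
  by rewrite Normc.normcM normcR ler_wpM2l // lerDl.
have := hd (z + (t + h)%:C * v); rewrite E => /(_ (le_lt_trans nE hh)) hh'.
have -> : complex.Re (F (z + (t + h)%:C * v)) - complex.Re (F (z + t%:C * v)) - complex.Re (l *
  v) * h =
   complex.Re (F (z + (t + h)%:C * v) - F (z + t%:C * v) - l * (h%:C * v)).
  by rewrite !ReB; congr (_ - _ - _); case: (l) (v) => [? ?] [? ?] /=; ring.
apply: le_trans (ler_Re_normc _) _; apply: le_trans hh' _.
apply: le_trans (ler_wpM2l _ nE) _; first exact/ltW/divr_gt0.
rewrite le_eqVlt; apply/orP; left; apply/eqP.
by field; rewrite gt_eqF.
Qed.

(** Constancy along a real segment is enough to contradict injectivity. The mean value theorem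
    handles each component, the imaginary part being the real part of [- i f]. *)
Lemma cder0_cst f c r : 0 < r -> (forall z, normc (z - c) < r -> cder f z 0) ->
  forall h : R, 0 <= h < r -> f (c + h%:C) = f c.
Proof.
move=> r0 hf h /andP[h0 hr].
have key (g : R[i] -> R[i]) : (forall z, normc (z - c) < r -> cder g z 0) -> complex.Re (g (c +
  h%:C)) = complex.Re (g c).
  move=> hg.
  have d1 (s : R) : 0 <= s <= h -> is_derive s 1 (fun s : R => complex.Re (g (c + s%:C * 1))) 0.
    move=> /andP[s0 sh]; have := @is_derive_Re g c 1 0 s; rewrite mul0r; apply.
    by apply: hg; rewrite addrC addKr mulr1 normcR ger0_norm //; lra.
  have [||x _] := @MVT_segment R (fun s : R => complex.Re (g (c + s%:C * 1))) (fun=> 0) 0 h h0.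
  - by move=> x; rewrite in_itv /= => xh; apply: d1; lra.
  - by apply: derivable_within_continuous => x; rewrite in_itv /= => /d1[].
  by rewrite mul0r mulr1 mul0r addr0 => /subr0_eq.
have k1 := key f hf.
have k2 := key (fun z => f z * - 'i%C).
apply/eqP; rewrite eq_complex; apply/andP; split; first exact/eqP.
have : complex.Re (f (c + h%:C) * - 'i%C) = complex.Re (f c * - 'i%C).
  apply: k2 => z /hf h'; rewrite [X in cder _ _ X](_ : 0 = 0 * - 'i%C + f z * 0); last by ring.
  by apply: cderM => //; exact: cder_cst.
have E (u : R[i]) : complex.Re (u * - 'i%C) = complex.Im u by case: u => ? ? /=; ring.
by rewrite !E => ->.
Qed.

(* If [f'(z0) = 0] then the quotients [quot f w] with [f'(w) <> 0] have no zeros, so by the minimum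
   principle they stay away from [0] at [z0], although their value there tends to [f'(z0)]
   as [w] tends to [z0]. *)
Lemma inj_cder_neq0 f c r z0 l : holo f c r -> inj_disc f c r -> normc (z0 - c) < r ->
  cder f z0 l -> l != 0.
Proof.
move=> fh fi z0c fl; apply/eqP => l0; subst l.
pose rho := (r - normc (z0 - c)) / 2.
have rho0 : 0 < rho by rewrite divr_gt0 // subr_gt0.
have inD z : normc (z - z0) < 2 * rho -> normc (z - c) < r.
  by move=> h; have := ler_distc_add z0 z c; move: h; rewrite /rho; lra.
have [|mu mu0 hmu] := @circ_lower (fun z => f z - f z0) z0 rho.
  move=> z zr; have zc : normc (z - c) < r by apply: inD; rewrite zr; lra.
  have [m hm] := fh z zc; split.
    by apply: ctB; [exact: cder_ct hm|exact: ct_cst].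
  rewrite subr_eq0; apply: contra_eq_neq zr => /fi -> //.
  by rewrite subrr nc0 lt_eqF.
(* The slope near [z0] is at most [mu / (8 rho)], half of the lower bound [mu / (4 rho)] that the
   minimum principle will give. *)
have [d1 d10 hd1] := cder_approx fl (divr_gt0 mu0 (mulr_gt0 (ltr0Sn R 7) rho0)).
have [d2 d20 hd2] := cder_ct fl (divr_gt0 mu0 (ltr0Sn R 1)).
pose dl := Num.min (Num.min d1 d2) rho.
have dl0 : 0 < dl by rewrite !lt_min d10 d20.
have [k1 [k2 k3]] : dl <= d1 /\ dl <= d2 /\ dl <= rho.
  by rewrite /dl !ge_min !lexx ?orbT.
have [[w [wz [m [m0 hm]]]]|nex] := pselect (exists w, normc (w - z0) < dl /\ exists m,
  m != 0 /\ cder f w m).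
  have wc : normc (w - c) < r by apply: inD; lra.
  have wz0 : w != z0.
    by apply: contra_neq m0 => wE; apply: (cder_uniq _ fl); rewrite -wE.
  have : mu / (4 * rho) <= normc (quot f w m z0).
    apply: (@min_principle _ _ (2 * rho) rho w).
    - by move=> z /inD zc; split; [apply: quot_ct => //; exact: fh|exact: quot_neq0 fi m0 wc zc].
    - by move=> z /inD/fh[l hl] zw; exact: quot_cder hl.
    - by rewrite (ltW rho0); lra.
    - by rewrite divr_gt0 // mulr_gt0.
    - move=> z zr.
      have zw : normc (z - w) <= 2 * rho.
        by have := ler_distc_add z0 z w; rewrite zr (normcB z0); lra.
      have fzw : mu / 2 <= normc (f z - f w).
        have := hmu z zr; have := hd2 w (lt_le_trans wz k2).
        by have := ler_distc_add (f w) (f z) (f z0); lra.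
      have znw : z != w.
        apply: contraTneq fzw => ->; rewrite subrr nc0 -ltNge; lra.
      rewrite /quot (negPf znw) Normc.normcM Normc.normcV.
      rewrite ler_pdivlMr ?normc_gt0 ?subr_eq0 //.
      apply: le_trans fzw; rewrite mulrAC ler_pdivrMr; last exact: mulr_gt0.
      by move: zw; nra.
  (* By symmetry the value at [z0] of the quotient based at [w] is the value at [w] of the quotient
     based at [z0], which is small. *)
  rewrite (quot_sym f m 0 wz0) /quot (negPf wz0) Normc.normcM Normc.normcV.
  rewrite ler_pdivlMr ?normc_gt0 ?subr_eq0 //.
  have := hd1 w (lt_le_trans wz k1); rewrite mul0r subr0 => h1 h2.
  have nw : 0 < normc (w - z0) by rewrite normc_gt0 subr_eq0.
  have : mu / (4 * rho) * normc (w - z0) <= mu / (8 * rho) *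
    normc (w - z0) by apply: le_trans h2 h1.
  have r4 : 0 < 4 * rho by exact: mulr_gt0.
  have r8 : 0 < 8 * rho by exact: mulr_gt0.
  by rewrite (ler_pM2r nw) (ler_pM2l mu0) lef_pV2 ?posrE // (ler_pM2r rho0) ler_nat.
(* In the remaining case the derivative vanishes on a disk about [z0], so [f] is constant on a
   segment. *)
have zero z : normc (z - z0) < dl -> cder f z 0.
  move=> zz; have [|m hm] := fh z; first by apply: inD; lra.
  have [<-//|m0] := eqVneq m 0.
  by exfalso; apply: nex; exists z; split => //; exists m.
have d20' : 0 <= dl / 2 < dl by lra.
have := cder0_cst dl0 zero d20'.
move/fi => /(_ _ _)/wrap[||/eqP].
- by apply: inD; rewrite addrC addKr normcR gtr0_norm; lra.
- exact: z0c.
by rewrite -subr_eq0 addrC addKr -normc_eq0 normcR gt_eqF // gtr0_norm; lra.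
Qed.

End difference_quotient.

(** * The odd energy inequality *)

Section koebe.
Variable R : realType.
Implicit Types (f g h F : R[i] -> R[i]) (a c z w l m : R[i]) (r e t x y : R).
Local Notation tpi := (pi *+ 2 : R).

(** [circ_lower] in the second variable for each fixed first one, then [disc_uniform] in the
    first. *)
Lemma circ_lower2 h c r : (forall z, normc (z - c) = r -> ct h z) ->
  (forall z w, normc (z - c) = r -> normc (w - c) = r -> h z + h w != 0) ->
  exists2 mu : R, 0 < mu & forall z w, normc (z - c) = r -> normc (w - c) = r -> mu <=
    normc (h z + h w).
Proof.
move=> ch h0.
have [|x xr|d d0 hd] := @disc_uniform R c r (fun (x : R[i]) d => normc (x - c) = r ->
    forall w, normc (w - c) = r -> d <= normc (h x + h w)).
- by move=> x d d' /andP[_ d'd] hx /hx hw w /hw; exact: le_trans.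
- have [xE|xE] := eqVneq (normc (x - c)) r; last first.
    exists (r - normc (x - c)); first by rewrite subr_gt0 lt_neqAle xE.
    move=> x' hx' _ x'r; exfalso; have := ler_distc_add x x' c.
    by move: hx'; rewrite x'r; lra.
  have [|mu mu0 hmu] := @circ_lower _ (fun w => h x + h w) c r.
    by move=> z zr; split; [apply: ctD; [exact: ct_cst|exact: ch]|exact: h0].
  have mu2 : 0 < mu / 2 by rewrite divr_gt0.
  have [d d0 hd] := ch x xE _ mu2; exists (Num.min d (mu / 2)); first by rewrite lt_min d0.
  have [md mm] : Num.min d (mu / 2) <= d /\ Num.min d (mu / 2) <= mu / 2.
    by rewrite !ge_min !lexx orbT.
  move=> x' hx' _ _ w wr; have := hd x' (lt_le_trans hx' md); have := hmu w wr.
  have := ler_normcB_dist (h x + h w) (h x' + h w).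
  have -> : h x + h w - (h x' + h w) = h x - h x' by ring.
  by rewrite normcB; move: mm; lra.
by exists d => // z w zr wr; apply: hd => //; rewrite zr.
Qed.

Lemma ln_sqr_normc z : z != 0 -> ln (normc z ^+ 2) = 2 * ln (normc z).
Proof. by move=> z0; rewrite lnXn ?normc_gt0 // mulr_natl. Qed.

Lemma itg_affine (u : R -> R) (k b : R) : 0 <= b -> (forall t, {for t, continuous u}) ->
  forall eta, itg 0 b (fun t => k * u t + eta) = k * itg 0 b u + eta * b.
Proof.
move=> b0 cu eta; have cu' : cont_on 0 b u by move=> t _; exact: cu.
rewrite itgD; last exact: cont_on_cst.
  by rewrite itgZ // itg_cst // subr0.
by move=> t _; apply: continuousM; [exact: cst_continuous|exact: cu].
Qed.

Lemma affine_cont (u : R -> R) (k eta b : R) : (forall t, {for t,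
  continuous u}) -> cont_on 0 b (fun t => k * u t + eta).
Proof.
move=> cu t _; apply: continuousD; last exact: cst_continuous.
by apply: continuousM; [exact: cst_continuous|exact: cu].
Qed.

(* [ln r + ln |l|] comes from the logarithmic energy of the odd measure obtained from the
   uniform measure on a circle and its images under [h] and [- h]; the energy has a sign,
   and all the means involved are computed by the mean value property in each variable. *)
Lemma odd_energy h R0 l r : (forall z, normc z < R0 -> exists l, cder h z l) ->
  (forall z w, normc z < R0 -> normc w < R0 -> h z = h w -> z = w) ->
  (forall z w, normc z < R0 -> normc w < R0 -> h z + h w != 0) ->
  cder h 0 l -> l != 0 -> 0 < r < R0 -> ln r + ln (normc l) <= ln (2 * normc (h 0)).
Proof.
move=> hh hi hn hl l0 /andP[r0 rR0].
have sub0 z : z - 0 = z by rewrite subr0.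
have tp := @tpi_gt0 R.
have cr t : normc (circ 0 r t) = r by have := normc_circ 0 r t; rewrite sub0 gtr0_norm.
have R00 : normc (0 : R[i]) < R0 by rewrite nc0; lra.
have ch z : normc z < R0 -> ct h z by move=> /hh[m /cder_ct].
pose H t := h (circ 0 r t).
have rH t : rct H t by apply: rct_comp; [apply: ch; rewrite cr|exact: rct_circ].
have hneq z : normc z < R0 -> z != 0 -> h z - h 0 != 0.
  by move=> zr z0; rewrite subr_eq0; apply: contra_neq z0 => /hi; apply.
have circ_neq0 t : circ 0 r t != 0 by rewrite -normc_gt0 cr.
have cD t : {for t, continuous (fun t => ln (normc (H t - h 0)))}.
  apply: (@cont_ln_normc _ (fun z => h z - h 0)).
    by apply: ctB; [apply: ch; rewrite cr|exact: ct_cst].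
  by apply: hneq; rewrite ?cr.
have cS t : {for t, continuous (fun t => ln (normc (H t + h 0)))}.
  apply: (@cont_ln_normc _ (fun z => h z + h 0)).
    by apply: ctD; [apply: ch; rewrite cr|exact: ct_cst].
  by apply: hn; rewrite ?cr.
(* Mean value for the nonvanishing quotient of [h] at [0]; the factor [z] has modulus [r] on the
   circle. *)
have ID : itg 0 tpi (fun t => ln (normc (H t - h 0))) = tpi * (ln r + ln (normc l)).
  have q0 z : normc z < R0 -> quot h 0 l z != 0.
    move=> zr; rewrite /quot; case: (z =P 0) => // /eqP z0.
    by rewrite mulf_neq0 ?invr_eq0 ?sub0 // hneq.
  have : circ_int (fun z => ln (normc (quot h 0 l z))) 0 r = tpi * ln (normc (quot h 0 l 0)).
    apply: (@mean_value_ln _ _ _ R0 _ 0); last lra.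
      by move=> z; rewrite sub0 => zr; split; [apply: quot_ct => //; exact: hh|exact: q0].
    by move=> z; rewrite sub0 => /hh[m hm] z0; apply: quot_cder hm.
  rewrite quot_diag => E; rewrite mulrDr -E addrC.
  rewrite -[X in _ + X]/(tpi * ln r) [tpi * ln r]mulrC -[X in _ + ln r * X]subr0 -itg_cst ?ltW //.
  rewrite /circ_int -itgD; last exact: cont_on_cst.
    apply: eq_itg => t _; rewrite /H (quotE h 0 l) sub0 Normc.normcM cr lnM ?posrE // normc_gt0.
    by apply: q0; rewrite cr.
  move=> t _; apply: (@cont_ln_normc _ (quot h 0 l)).
    by apply: quot_ct => //; apply: hh; rewrite cr.
  by apply: q0; rewrite cr.
have IS : itg 0 tpi (fun t => ln (normc (H t + h 0))) = tpi * ln (2 * normc (h 0)).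
  have : circ_int (fun z => ln (normc (h z + h 0))) 0 r = tpi * ln (normc (h 0 + h 0)).
    apply: (@mean_value_ln _ (fun z => h z + h 0) _ R0 _ 0); last lra.
      by move=> z; rewrite sub0 => zr; split; [apply: ctD; [exact: ch|exact: ct_cst]|exact: hn].
    move=> z; rewrite sub0 => /hh[m hm] _; eexists; apply: cderD hm _; exact: cder_cst.
  rewrite /circ_int => ->; congr (_ * ln _).
  by rewrite -mulr2n normcMn mulr_natl.
have [||mu mu0 hmu] := @circ_lower2 h 0 r.
- by move=> z; rewrite sub0 => zr; apply: ch; rewrite zr.
- by move=> z w; rewrite !sub0 => zr wr; apply: hn; rewrite ?zr ?wr.
have [M M0 hM] := rct_bounded (ltW tp) rH.
have rHN t : rct (fun y => - H y) t.
  by move=> d d0; have [d' d'0 hd] := rH t _ d0; exists d' => // s /hd; rewrite -opprD normcN.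
apply/ler_addgt0Pr => eta eta0.
(* Since [|H x + H y| >= mu], adding [e] to its square increases the logarithm by at most [eta]. *)
pose e := eta * mu ^+ 2.
have e0 : 0 < e by rewrite mulr_gt0 // exprn_gt0.
have up x : itg 0 tpi (fun y => ln_dist e (H x) (H y)) <= 2 * tpi * ln (normc (H x + h 0)) + eta *
  tpi.
  have E : circ_int (fun z => ln (normc (H x + h z))) 0 r = tpi * ln (normc (H x + h 0)).
    apply: (@mean_value_ln _ (fun z => H x + h z) _ R0 _ 0); last lra.
      move=> z; rewrite sub0 => zr; split; last by apply: hn; rewrite ?cr.
      by apply: ctD; [exact: ct_cst|exact: ch].
    by move=> z; rewrite sub0 => /hh[m hm] _; eexists; apply: cderD hm; exact: cder_cst.
  have cE t : {for t, continuous (fun t => ln (normc (H x + H t)))}.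
    apply: (@cont_ln_normc _ (fun z => H x + h z)).
      by apply: ctD; [exact: ct_cst|apply: ch; rewrite cr].
    by apply: hn; rewrite cr.
  have -> : 2 * tpi * ln (normc (H x + h 0)) + eta * tpi = itg 0 tpi (fun y => 2 *
    ln (normc (H x + H y)) + eta).
    by rewrite itg_affine ?ltW // -mulrA -E.
  apply: le_itg; [by move=> y _; apply: ln_dist_cont|exact: affine_cont|].
  move=> y _; have nz : H x + H y != 0 by apply: hn; rewrite cr.
    have n2 : 0 < normc (H x + H y) ^+ 2 by rewrite exprn_gt0 // normc_gt0.
    rewrite /ln_dist -ln_sqr_normc //.
    have -> : normc (H x + H y) ^+ 2 + e = normc (H x + H y) ^+ 2 * (1 + e / normc (H x + H y) ^+
      2).
      by field; rewrite normc_eq0.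
    have en : e / normc (H x + H y) ^+ 2 <= eta.
      rewrite ler_pdivrMr // /e ler_pM2l //.
      have mle : mu <= normc (H x + H y) by apply: hmu; rewrite sub0 cr.
      by rewrite lerXn2r // nnegrE; [exact: ltW|exact: normc_ge0].
    have en0 : 0 < e / normc (H x + H y) ^+ 2 by rewrite divr_gt0.
    rewrite lnM ?posrE //; last by rewrite addr_gt0.
    by rewrite lerD2l; apply: le_trans en; apply: le_ln1Dx; lra.
(* Here [H x - h z] vanishes at a point of the circle itself, so the mean value is taken at a radius
   [r' < r] and transferred by the Lipschitz bound [ln_le_lip] of the regularized logarithm. *)
have lo x : 0 <= x <= tpi -> 2 * tpi * ln (normc (H x - h 0)) - eta * tpi <= itg 0 tpi (fun y =>
  ln_dist e (H x) (- H y)).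
  move=> /hM hMx; pose L := 4 * M + 1.
  have L0 : 0 < L by rewrite /L; lra.
  have d0 : 0 < Num.min 1 (eta * e / L) by rewrite lt_min ltr01 divr_gt0 // mulr_gt0.
  have [m1 m2] : Num.min 1 (eta * e / L) <= 1 /\ Num.min 1 (eta * e / L) <= eta * e / L.
    by rewrite !ge_min !lexx orbT.
  have ch' z : normc (z - 0) <= r -> ct h z by rewrite sub0 => zr; apply: ch; lra.
  have [s s0 hs] := unif_ct ch' d0.
  pose r' := r - Num.min r s / 2.
  have [ms1 ms2] : Num.min r s <= r /\ Num.min r s <= s by rewrite !ge_min !lexx orbT.
  have ms0 : 0 < Num.min r s by rewrite lt_min r0.
  have r'0 : 0 < r' by rewrite /r'; lra.
  have r'r : r' < r by rewrite /r'; lra.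
  have cr' t : normc (circ 0 r' t) = r' by have := normc_circ 0 r' t; rewrite sub0 gtr0_norm.
  have clo y : normc (h (circ 0 r' y) - H y) < Num.min 1 (eta * e / L).
    apply: hs; rewrite ?sub0 ?cr ?cr' //; first exact: ltW.
    by rewrite circ_dist ltr_norml /r'; lra.
  have nD z : normc z < r -> H x - h z != 0.
    move=> zr; rewrite subr_eq0; apply/eqP => /hi hz.
    have zE : circ 0 r x = z by apply: hz; rewrite ?cr //; lra.
    by move: zr; rewrite -zE cr ltxx.
  have E : circ_int (fun z => ln (normc (H x - h z))) 0 r' = tpi * ln (normc (H x - h 0)).
    apply: (@mean_value_ln _ (fun z => H x - h z) _ r _ 0); last lra.
      move=> z; rewrite sub0 => zr; split; last exact: nD.
      by apply: ctB; [exact: ct_cst|apply: ch; lra].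
    move=> z; rewrite sub0 => zr _; have [|m hm] := hh z; first lra.
    by eexists; apply: cderB hm; exact: cder_cst.
  have cE t : {for t, continuous (fun t => ln (normc (H x - h (circ 0 r' t))))}.
    apply: (@cont_ln_normc _ (fun z => H x - h z)).
      by apply: ctB; [exact: ct_cst|apply: ch; rewrite cr'; lra].
    by apply: nD; rewrite cr'.
  have -> : 2 * tpi * ln (normc (H x - h 0)) - eta * tpi = itg 0 tpi (fun y => 2 *
    ln (normc (H x - h (circ 0 r' y))) + - eta).
    by rewrite itg_affine ?ltW // -mulrA -E mulNr.
  apply: le_itg; [exact: affine_cont|by move=> y _; apply: ln_dist_cont|].
    move=> y yab; have nz : H x - h (circ 0 r' y) != 0 by apply: nD; rewrite cr'.
    have n2 : 0 < normc (H x - h (circ 0 r' y)) ^+ 2 by rewrite exprn_gt0 // normc_gt0.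
    rewrite -ln_sqr_normc //.
    set A := normc (H x - h (circ 0 r' y)) ^+ 2 in n2 *.
    have h1 : ln A <= ln (A + e) by rewrite ler_ln ?posrE; lra.
    have h2 : ln (A + e) - ln (normc (H x - H y) ^+ 2 + e) <= `|A - normc (H x - H y) ^+ 2| / e.
      by apply: ln_le_lip => //; [exact: ltW|rewrite exprn_ge0 // normc_ge0].
    have h3 : `|A - normc (H x - H y) ^+ 2| / e <= eta.
      rewrite ler_pdivrMr // /A subr_sqr normrM.
      have a1 : `|normc (H x - h (circ 0 r' y)) - normc (H x - H y)| <= eta * e / L.
        apply: le_trans (ler_dist_normc _ _) _.
        have -> : H x - h (circ 0 r' y) - (H x - H y) = H y - h (circ 0 r' y) by ring.
        by rewrite normcB; apply: le_trans m2; exact/ltW/clo.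
      have a2 : `|normc (H x - h (circ 0 r' y)) + normc (H x - H y)| <= L.
        rewrite ger0_norm ?addr_ge0 ?normc_ge0 //.
        have := ler_distc_add (H y) (H x) (h (circ 0 r' y)).
        rewrite (normcB (H y)); have := clo y; have := ler_normcD (H x) (- H y).
        rewrite normcN; have := hM y yab; rewrite /L; lra.
      by apply: le_trans (ler_pM _ _ a1 a2) _ => //; rewrite divfK // gt_eqF.
    by rewrite /ln_dist; lra.
have en := energy_le e0 (ltW tp) rH.
have c1 : cont_on 0 tpi (fun x => itg 0 tpi (fun y => ln_dist e (H x) (- H y))).
  by move=> x _; apply: itg_ln_dist_cont => //; exact: ltW.
have c2 : cont_on 0 tpi (fun x => itg 0 tpi (fun y => ln_dist e (H x) (H y))).
  by move=> x _; apply: itg_ln_dist_cont => //; exact: ltW.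
have lo' : 2 * tpi * (tpi * (ln r + ln (normc l))) - eta * tpi * tpi <= itg 0 tpi (fun x =>
  itg 0 tpi (fun y => ln_dist e (H x) (- H y))).
  have -> : 2 * tpi * (tpi * (ln r + ln (normc l))) - eta * tpi * tpi =
      itg 0 tpi (fun t => (2 * tpi) * ln (normc (H t - h 0)) + - (eta * tpi)).
    by rewrite itg_affine ?ltW // ID mulNr.
  by apply: le_itg => //; exact: affine_cont.
have up' : itg 0 tpi (fun x => itg 0 tpi (fun y => ln_dist e (H x) (H y))) <= 2 * tpi * (tpi *
  ln (2 * normc (h 0))) + eta * tpi * tpi.
  have -> : 2 * tpi * (tpi * ln (2 * normc (h 0))) + eta * tpi * tpi =
      itg 0 tpi (fun t => (2 * tpi) * ln (normc (H t + h 0)) + eta * tpi).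
    by rewrite itg_affine ?ltW // IS.
  by apply: le_itg => //; exact: affine_cont.
have := le_trans lo' (le_trans en up').
have tp2 : 0 < tpi * tpi by rewrite mulr_gt0.
have -> : 2 * tpi * (tpi * (ln r + ln (normc l))) - eta * tpi * tpi = (tpi * tpi) * (2 * (ln r +
  ln (normc l)) - eta) by ring.
have -> : 2 * tpi * (tpi * ln (2 * normc (h 0))) + eta * tpi * tpi = (tpi * tpi) * (2 * ln (2 *
  normc (h 0)) + eta) by ring.
rewrite (ler_pM2l tp2) => hle; clear -hle; lra.
Qed.

End koebe.

(** * Koebe estimate for nonvanishing functions and growth of univalent functions *)

Section growth.
Variable R : realType.
Implicit Types (f g h F : R[i] -> R[i]) (a c z w l m : R[i]) (r e t : R).

Lemma le_of_lt_scale (x y : R) : 0 <= x -> (forall r, 0 < r < 1 -> r * x <= y) -> x <= y.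
Proof.
move=> x0 h; rewrite leNgt; apply/negP => yx.
have xp : 0 < x.
  rewrite lt_neqAle x0 andbT eq_sym; apply/eqP => xE; move: yx; rewrite xE.
  by apply/negP; rewrite -leNgt; have := h 2^-1; rewrite xE mulr0; apply; lra.
pose r := (1 + Num.max 0 (y / x)) / 2.
have y1 : y / x < 1 by rewrite ltr_pdivrMr // mul1r.
have [m0 m1] : 0 <= Num.max 0 (y / x) /\ y / x <= Num.max 0 (y / x) by rewrite !le_max !lexx orbT.
have m2 : Num.max 0 (y / x) < 1 by rewrite gt_max ltr01.
have : r * x <= y by apply: h; rewrite /r; lra.
rewrite -ler_pdivlMr // /r; lra.
Qed.

(** [odd_energy] applies to the square root [h] of [g / g 0]: an equality [h z = - h w] would give
    [g z = g w], so [z = w] and [h z = 0]. As [|h 0| = 1], it bounds [s |h' 0|] by [2], and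
    [g' 0 = 2 h 0 h' 0 g 0] supplies the second factor [2]. *)
Lemma koebe_nonvanishing g l : (forall z, normc z < 1 -> exists l, cder g z l) ->
  (forall z w, normc z < 1 -> normc w < 1 -> g z = g w -> z = w) ->
  (forall z, normc z < 1 -> g z != 0) -> cder g 0 l -> normc l <= 4 * normc (g 0).
Proof.
move=> gh gi gn gl.
have sub0 z : z - 0 = z by rewrite subr0.
have n0 : normc (0 : R[i]) < 1 by rewrite nc0 ltr01.
have g00 := gn _ n0.
apply: le_of_lt_scale; first exact: normc_ge0.
move=> s /andP[s0 s1].
(* [log_branch] works on disks of radius below [1]; [r] leaves room above the radius [s] of the
   energy circle. *)
pose r := (1 + s) / 2.
have rr : 0 <= r < 1 by rewrite /r; lra.
have [|L hL] := @log_branch R g 0 1 r _ rr.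
  by move=> z; rewrite sub0 => zr; split; [have [m /cder_ct] := gh z zr|exact: gn].
have lt1 z : normc z < r -> normc z < 1 by rewrite /r; lra.
have LE z : normc z < r -> cexp (L z) = g z / g 0.
  by move=> zr; have [|_] := hL z; rewrite ?sub0.
have dL z : normc z < r -> exists m, cder L z m.
  move=> zr; have [m hm] := gh z (lt1 _ zr); have [|cL _] := hL z; first by rewrite sub0.
  have hq : cder (fun w => g w / g 0) z (m * (g 0)^-1 + g z * 0).
    by apply: cderM => //; exact: cder_cst.
  eexists; apply: (cder_log cL) hq; exists (r - normc z); first by rewrite subr_gt0.
  move=> w hw; apply: LE; have := ler_normcD (w - z) z; rewrite subrK; lra.
pose h z := cexp (L z * (2^-1)%:C).
have hsq z : normc z < r -> h z * h z = g z / g 0.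
  move=> zr; rewrite -LE // /h -cexpD -mulrDr -rmorphD /=.
  by rewrite (_ : 2^-1 + 2^-1 = 1 :> R) ?mulr1 //; lra.
have dh z : normc z < r -> exists m, cder h z m.
  move=> /dL[m hm]; eexists; apply: cder_comp; first exact: cder_cexp.
  by apply: cderM hm _; exact: cder_cst.
have gE z : normc z < r -> g z = h z * h z * g 0 by move=> zr; rewrite hsq // divfK.
have [m hm] : exists m, cder h 0 m by apply: dh; rewrite nc0 /r; lra.
have r00 : normc (0 : R[i]) < r by rewrite nc0 /r; lra.
have lE : l = 2 * h 0 * m * g 0.
  apply: (cder_uniq gl).
  have := cderM (cderM hm hm) (cder_cst (g 0) 0) => hh.
  rewrite (_ : 2 * h 0 * m * g 0 = (m * h 0 + h 0 * m) * g 0 + h 0 * h 0 * 0); last by ring.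
  apply: cder_locally hh; exists r; first by rewrite /r; lra.
  by move=> w; rewrite sub0 => /gE.
have h01 : normc (h 0) = 1.
  have := hsq 0 r00; rewrite divff // => /(congr1 (@Normc.normc R)).
  rewrite Normc.normcM nc1 -expr2 => /eqP; rewrite sqrf_eq1 => /orP[/eqP //|/eqP E].
  by have := normc_ge0 (h 0); rewrite E; lra.
have [m0|m0] := eqVneq m 0.
  by rewrite lE m0 mulr0 mul0r nc0 mulr0 mulr_ge0 ?normc_ge0.
have sr : 0 < s < r by rewrite /r; lra.
have hi z w : normc z < r -> normc w < r -> h z = h w -> z = w.
  move=> zr wr hE; apply: gi; [exact: lt1|exact: lt1|].
  by rewrite (gE _ zr) (gE _ wr) hE.
have hn z w : normc z < r -> normc w < r -> h z + h w != 0.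
  move=> zr wr; rewrite addr_eq0; apply/eqP => hE.
  have zw : z = w by apply: gi; [exact: lt1|exact: lt1|rewrite (gE _ zr) (gE _ wr) hE mulrNN].
  move: hE; rewrite zw => /eqP; rewrite -addr_eq0 -mulr2n -mulr_natl mulf_eq0 pnatr_eq0 /=.
  by rewrite (negPf (cexp_neq0 _)).
have := odd_energy dh hi hn hm m0 sr.
rewrite h01 mulr1 -lnM ?posrE ?normc_gt0 //.
rewrite ler_ln ?posrE ?mulr_gt0 ?normc_gt0 //.
rewrite lE !Normc.normcM h01 mulr1 => hs.
have -> : normc (2 : R[i]) = 2.
  by rewrite (_ : (2 : R[i]) = 2%:C) ?normcR ?ger0_norm // rmorph_nat.
have := ler_wpM2r (normc_ge0 (g 0)) hs; lra.
Qed.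

(* Composing with the automorphism [w |-> (w + t) / (1 + t w)] of the disk. *)
Lemma koebe_nonvanishing_at g t l : (forall z, normc z < 1 -> exists l, cder g z l) ->
  (forall z w, normc z < 1 -> normc w < 1 -> g z = g w -> z = w) ->
  (forall z, normc z < 1 -> g z != 0) -> 0 <= t < 1 -> cder g t%:C l ->
  (1 - t ^+ 2) * normc l <= 4 * normc (g t%:C).
Proof.
move=> gh gi gn /andP[t0 t1] gl.
have den w : normc w < 1 -> 1 + t%:C * w != 0.
  move=> w1; rewrite addrC addr_eq0; apply/eqP => /(congr1 (@Normc.normc R)).
  rewrite normcN nc1 Normc.normcM normcR ger0_norm // => E.
  by have := ler_pM t0 (normc_ge0 w) (ltW t1) (ltW w1); have := normc_ge0 w; nra.
pose M w := (w + t%:C) / (1 + t%:C * w).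
have M1 w : normc w < 1 -> normc (M w) < 1.
  move=> w1; rewrite /M Normc.normcM Normc.normcV ltr_pdivrMr ?normc_gt0 ?den // mul1r.
  rewrite -(@ltr_pXn2r _ 2) ?nnegrE ?normc_ge0 // !sqr_normcE.
  have : normc w ^+ 2 < 1 by rewrite expr_lt1 // normc_ge0.
  rewrite sqr_normcE; case: w {w1} => x y /=; rewrite !mul0r !subr0 !addr0 add0r.
  have : 0 < 1 - t ^+ 2 by rewrite subr_gt0 expr_lt1.
  by nra.
have Mi z w : normc z < 1 -> normc w < 1 -> M z = M w -> z = w.
  move=> z1 w1 /eqP; rewrite /M eqr_div ?den // => /eqP E.
  have t2 : (1 - t%:C ^+ 2) != 0.
    by rewrite -rmorphXn -(rmorph1 (real_complex R)) -rmorphB -normc_eq0 normcR normr_eq0 gt_eqF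
      // subr_gt0 expr_lt1.
  apply/eqP; rewrite -subr_eq0; apply/eqP/(mulfI t2); rewrite mulr0.
  have -> : (1 - t%:C ^+ 2) * (z - w) = (z + t%:C) * (1 + t%:C * w) - (w + t%:C) * (1 + t%:C *
    z) by ring.
  by rewrite E subrr.
have dM w : normc w < 1 -> cder M w ((1 + 0) * (1 + t%:C * w)^-1 + (w + t%:C) * (- (0 + (0 * w +
  t%:C * 1)) / (1 + t%:C * w) ^+ 2)).
  move=> w1; apply: cderM.
    by apply: cderD; [exact: cder_id|exact: cder_cst].
  apply: cder_fV; first exact: den.
  apply: cderD; first exact: cder_cst.
  by apply: cderM; [exact: cder_cst|exact: cder_id].
have n0 : normc (0 : R[i]) < 1 by rewrite nc0 ltr01.
have M0 : M 0 = t%:C by rewrite /M add0r mulr0 addr0 divr1.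
have := @koebe_nonvanishing (fun w => g (M w)) (l * (1 - t ^+ 2)%:C).
rewrite M0 Normc.normcM normcR (ger0_norm (_ : 0 <= 1 - t ^+ 2)); last first.
  by rewrite subr_ge0 expr_le1 // ltW.
move=> h; rewrite mulrC; apply: h.
- by move=> z z1; have [m hm] := gh _ (M1 _ z1); eexists; apply: cder_comp hm (dM _ z1).
- by move=> z w z1 w1 /gi E; apply: Mi => //; apply: E; exact: M1.
- by move=> z z1; apply: gn; exact: M1.
have := @cder_comp _ g M 0 l _ _ (dM _ n0); rewrite M0 => /(_ gl).
congr (cder _ _ (_ * _)).
by rewrite rmorphB rmorphXn rmorph1 !(mulr0, mul0r, addr0, add0r, mulr1, expr1n, divr1, invr1);
  ring.
Qed.

Lemma cder_clog1 : cder (@clog R) 1 1.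
Proof.
have h : 0 < complex.Re (1 : R[i]) by rewrite /= ltr01.
have := @cder_log R (@clog R) id 1 1 (ct_clog h); rewrite clogK // divr1; apply;
  last exact: cder_id.
by exists 1 => // w w1; rewrite clogK //; have := ler_Re_normc (w - 1); rewrite ReB ler_norml /=;
  lra.
Qed.

(** Up to a constant, [ln |F|] is the real part of [clog (F / F t)], and [clog] is differentiable at
    [1]. *)
Lemma is_derive_ln_normc F t l : cder F t%:C l -> F t%:C != 0 ->
  is_derive t 1 (fun s : R => ln (normc (F s%:C))) (complex.Re (l / F t%:C)).
Proof.
move=> hF F0.
have hq : cder (fun w => F w / F t%:C) t%:C (l * (F t%:C)^-1 + F t%:C * 0).
  by apply: cderM => //; exact: cder_cst.
have hlog : cder (@clog R) (F t%:C / F t%:C) 1 by rewrite divff //; exact: cder_clog1.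
have := cder_comp (F := @clog R) (G := fun w => F w / F t%:C) hlog hq.
rewrite mul1r mulr0 addr0 => hc.
have := @is_derive_Re R (fun w => clog (F w / F t%:C)) 0 1 (l / F t%:C) t.
rewrite add0r !mulr1 => /(_ hc) /is_derive_approx hd.
have [d1 d10 hd1] := ct_neq0 (cder_ct hF) F0.
apply: is_derive_of_approx => e /hd[d d0 hd']; exists (Num.min d d1); first by rewrite lt_min d0.
move=> x; rewrite lt_min => /andP[xd xd1].
have Fx : F (t + x)%:C != 0 by apply: hd1; rewrite rmorphD addrC addKr normcR.
have := hd' x xd; rewrite !add0r !mulr1 /clog /= divff // nc1 ln1 subr0.
by rewrite Normc.normcM Normc.normcV ln_div ?posrE ?normc_gt0.
Qed.

(** The Koebe bound [4 / (1 - s^2)] on the logarithmic derivative is the derivative of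
    [2 ln (1 + s) - 2 ln (1 - s)], so [phi] is nonincreasing. *)
Lemma growth_nonvanishing g t : (forall z, normc z < 1 -> exists l, cder g z l) ->
  (forall z w, normc z < 1 -> normc w < 1 -> g z = g w -> z = w) ->
  (forall z, normc z < 1 -> g z != 0) -> 0 <= t < 1 ->
  normc (g t%:C) <= normc (g 0) * ((1 + t) / (1 - t)) ^+ 2.
Proof.
move=> gh gi gn /andP[t0 t1].
have n1 (s : R) : 0 <= s <= t -> normc s%:C < 1.
  by move=> /andP[s0 st]; rewrite normcR ger0_norm //; lra.
have [dg hdg] : exists dg : R -> R[i], forall s, 0 <= s <= t -> cder g s%:C (dg s).
  suff /choice[dg hdg] : forall s : R, exists l, 0 <= s <= t -> cder g s%:C l by exists dg.
  move=> s; have [st|st] := boolP (0 <= s <= t); last by exists 0.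
  by have [l hl] := gh _ (n1 _ st); exists l.
pose phi (s : R) := ln (normc (g s%:C)) - (2 * ln (1 + s) - 2 * ln (1 - s)) : R.
pose dphi (s : R) := complex.Re (dg s / g s%:C) - (2 * (1 + s)^-1 - 2 * (- (1 - s)^-1)) : R.
have hphi (s : R) : 0 <= s <= t -> is_derive s 1 phi (dphi s).
  move=> st; have gs := gn _ (n1 _ st).
  have h1 := is_derive_ln_normc (hdg _ st) gs.
  have p1 : 0 < 1 + s by lra.
  have p2 : 0 < 1 - s by lra.
  have a1 : is_derive s 1 (fun s : R => 1 + s) 1.
    have : is_derive s 1 (cst 1 + id) (0 + 1 : R) by apply: is_deriveD.
    by rewrite add0r.
  have a2 : is_derive s 1 (fun s : R => 1 - s) (- 1).
    have : is_derive s 1 (cst 1 - id) (0 - 1 : R) by apply: is_deriveB.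
    by rewrite sub0r.
  have l1 : is_derive s 1 (fun s : R => ln (1 + s)) ((1 + s)^-1 * 1).
    exact: (@is_derive1_comp R (@ln R) (fun s => 1 + s) s _ _ (is_derive1_ln p1) a1).
  have l2 : is_derive s 1 (fun s : R => ln (1 - s)) ((1 - s)^-1 * -1).
    exact: (@is_derive1_comp R (@ln R) (fun s => 1 - s) s _ _ (is_derive1_ln p2) a2).
  rewrite mulr1 in l1; rewrite mulrN1 in l2.
  exact: (is_deriveB h1 (is_deriveB (is_deriveZ 2 l1) (is_deriveZ 2 l2))).
have dphi_le (s : R) : 0 <= s <= t -> dphi s <= 0.
  move=> st; have gs := gn _ (n1 _ st).
  have p1 : 0 < 1 + s by lra.
  have p2 : 0 < 1 - s by lra.
  have st1 : 0 <= s < 1 by lra.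
  have := koebe_nonvanishing_at gh gi gn st1 (hdg _ st) => hk.
  have : complex.Re (dg s / g s%:C) <= 4 / (1 - s ^+ 2).
    apply: le_trans (ler_norm _) _; apply: le_trans (ler_Re_normc _) _.
    rewrite Normc.normcM Normc.normcV ler_pdivrMr ?normc_gt0 // mulrAC ler_pdivlMr 1?mulrC //.
    by rewrite subr_gt0 expr_lt1 //; lra.
  have -> : 4 / (1 - s ^+ 2) = 2 * (1 + s)^-1 - 2 * (- (1 - s)^-1) :> R.
    by field; rewrite !gt_eqF // subr_gt0 expr_lt1 //; lra.
  by rewrite /dphi subr_le0.
have : phi t <= phi 0.
  have [||x] := @MVT_segment R phi dphi 0 t t0.
  - by move=> x; rewrite in_itv /= => xt; apply: hphi; lra.
  - by apply: derivable_within_continuous => x; rewrite in_itv /= => /hphi[].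
  rewrite in_itv /= subr0 => /dphi_le hx E; rewrite -subr_le0 E.
  exact: mulr_le0_ge0.
have g0 : 0 < normc (g 0) by rewrite normc_gt0 gn // nc0 ltr01.
have gt : 0 < normc (g t%:C) by rewrite normc_gt0 gn // n1 // t0 lexx.
have p1 : 0 < 1 + t by lra.
have p2 : 0 < 1 - t by lra.
rewrite /phi addr0 subr0 ln1 mulr0 subrr subr0.
have E : ln (normc (g 0) * ((1 + t) / (1 - t)) ^+ 2) = ln (normc (g 0)) + (2 * ln (1 + t) - 2 *
  ln (1 - t)).
  rewrite lnM ?posrE ?exprn_gt0 ?divr_gt0 // lnXn ?divr_gt0 // ln_div ?posrE //.
  by rewrite mulr2n; ring.
rewrite lerBlDr -E ler_ln ?posrE //.
by rewrite mulr_gt0 // exprn_gt0 // divr_gt0.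
Qed.

Lemma disc_bounded F c r : (forall z, normc (z - c) <= r -> ct F z) ->
  exists2 C : R, 0 < C & forall z, normc (z - c) <= r -> normc (F z) <= C.
Proof.
move=> cF.
(* The scale [d] is read as the reciprocal of a bound. *)
have [|x xr|d d0 hd] := @disc_uniform R c r (fun x d => normc (F x) <= d^-1).
- move=> x d d' /andP[d'0 d'd] h; apply: le_trans h _; rewrite lef_pV2 ?posrE //.
  exact: lt_le_trans d'd.
- have [d d0 hd] := cF x xr 1 ltr01.
  have n1 : 0 < normc (F x) + 1 by rewrite ltr_wpDl ?normc_ge0.
  exists (Num.min d (normc (F x) + 1)^-1); first by rewrite lt_min d0 invr_gt0.
  move=> x'; rewrite lt_min => /andP[/hd h _ _].
  apply: (@le_trans _ _ (normc (F x) + 1)).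
    by have := ler_normcB_dist (F x') (F x); lra.
  rewrite -[X in X <= _]invrK lef_pV2 ?posrE ?lt_min ?d0 ?invr_gt0 //.
  by rewrite ge_min lexx orbT.
by exists d^-1; rewrite ?invr_gt0.
Qed.

(* [f - f 0] has no zero in the disk of diameter [0, e] for [|e| = 1], so the sharp
   growth estimate for nonvanishing functions on such disks applies without knowing
   that [f] omits a value. *)
Lemma growth f : (forall z, normc z < 1 -> exists l, cder f z l) ->
  (forall z w, normc z < 1 -> normc w < 1 -> f z = f w -> z = w) ->
  exists2 C : R, 0 < C & forall z, normc z < 1 -> normc (f z - f 0) <= C / (1 - normc z) ^+ 2.
Proof.
move=> fh fi.
have n0 : normc (0 : R[i]) < 1 by rewrite nc0 ltr01.
have [|C C0 hC] := @disc_bounded (fun z => f z - f 0) 0 2^-1.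
  move=> z; rewrite subr0 => zr; apply: ctB; last exact: ct_cst.
  by have [|l /cder_ct] := fh z; first lra.
exists C => // z z1; have [zr|zr] := leP (normc z) 2^-1.
  have := hC z; rewrite subr0 => /(_ zr) h; apply: le_trans h _.
  have z0 := normc_ge0 z.
  have q1 : (1 - normc z) ^+ 2 <= 1 by rewrite expr_le1 //; lra.
  by rewrite ler_pdivlMr ?exprn_gt0 ?subr_gt0 // ler_piMr // ltW.
have nz : normc z != 0 by rewrite gt_eqF //; lra.
pose e := z / (normc z)%:C.
have ne : normc e = 1 by rewrite /e Normc.normcM Normc.normcV normcR ger0_norm ?normc_ge0 // divff.
have zE : z = e * (normc z)%:C.
  by rewrite /e divfK // -normc_eq0 normcR normr_eq0.
clearbody e; pose p w := e * (1 + w) / 2.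
have n2 : normc (2 : R[i]) = 2.
  by rewrite (_ : (2 : R[i]) = 2%:C) ?normcR ?ger0_norm // rmorph_nat.
have p1 w : normc w < 1 -> normc (p w) < 1.
  move=> w1; rewrite /p !Normc.normcM ne Normc.normcV n2 mul1r ltr_pdivrMr // mul1r.
  by have := ler_normcD 1 w; rewrite nc1; lra.
have p0 w : normc w < 1 -> p w != 0.
  move=> w1; rewrite /p !mulf_neq0 ?invr_eq0 -?normc_eq0 ?ne ?n2 ?oner_neq0 ?pnatr_eq0 //.
  rewrite normc_eq0 addr_eq0; apply: contraTneq w1 => E.
  by have := nc1 R; rewrite E normcN => ->; rewrite ltxx.
have e0 : e != 0 by rewrite -normc_eq0 ne oner_neq0.
have two0 : (2 : R[i]) != 0 by rewrite pnatr_eq0.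
pose g w := f (p w) - f 0.
(* Solves [p t = z]; the center [p 0] has modulus [1/2], where [C] bounds [f - f 0]. *)
pose t := 2 * normc z - 1.
have t01 : 0 <= t < 1 by rewrite /t; lra.
have := @growth_nonvanishing g t _ _ _ t01.
move/(_ _ _ _)/wrap => [w w1|w w' w1 w'1|w w1|h].
- have [l hl] := fh _ (p1 _ w1); eexists; apply: cderB; last exact: cder_cst.
  apply: cder_comp hl _; apply: cderM; last exact: cder_cst.
  by apply: cderM; [exact: cder_cst|apply: cderD; [exact: cder_cst|exact: cder_id]].
- move/addIr/fi => /(_ (p1 _ w1) (p1 _ w'1)) /(mulIf (invr_neq0 two0)) /(mulfI e0).
  exact: addrI.
- rewrite subr_eq0; apply/eqP => /fi E; have := p0 _ w1.
  by rewrite E ?eqxx //; exact: p1.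
have pt : p t%:C = z.
  by rewrite /p [RHS]zE /t rmorphB rmorphM rmorph1 rmorph_nat; field.
have gz : normc (g 0) <= C.
  by apply: (hC (p 0)); rewrite subr0 /p addr0 mulr1 Normc.normcM ne Normc.normcV n2 mul1r.
move: h; rewrite /g pt -/(g 0) => h; apply: le_trans h _.
have z01 : 0 < 1 - normc z by rewrite subr_gt0.
have -> : (1 + t) / (1 - t) = normc z / (1 - normc z).
  by rewrite /t; field; rewrite gt_eqF //=; lra.
apply: ler_pM => //; first exact: normc_ge0.
  by rewrite exprn_ge0 // divr_ge0 ?normc_ge0 // ltW.
rewrite expr_div_n ler_piMl //; first by rewrite invr_ge0 exprn_ge0 // ltW.
by rewrite expr_le1 ?normc_ge0 // ltW.
Qed.

End growth.

(** * Logarithmic means *)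

Section plane_measurability.
Variable R : realType.
Local Notation mu := (@lebesgue_measure R).
Local Notation RR := (measurableTypeR R * measurableTypeR R)%type.

Definition open2 (A : set (R * R)) := forall p, A p -> exists2 d : R, 0 < d &
  forall q, `|q.1 - p.1| < d -> `|q.2 - p.2| < d -> A q.

(** An open set is the countable union of the rational boxes that it contains; [S] is such a box, or
    empty if the box is not contained. *)
Lemma open2_measurable (A : set RR) : open2 A -> measurable A.
Proof.
move=> oA.
pose box (a b c d : rat) : set RR := `]ratr a, ratr b[%classic `*` `]ratr c, ratr d[%classic.
pose S a b c d : set RR := [set p | box a b c d p /\ box a b c d `<=` A].
have -> : A = \bigcup_a \bigcup_b \bigcup_c \bigcup_d S a b c d.
  apply/seteqP; split=> [p Ap|p [a _ [b _ [c _ [d _]]]]].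
    have [e e0 he] := oA _ Ap.
    have [a] : exists a : rat, ratr a \in `]p.1 - e, p.1[ by apply: rat_in_itvoo; lra.
    have [b] : exists a : rat, ratr a \in `]p.1, p.1 + e[ by apply: rat_in_itvoo; lra.
    have [c] : exists a : rat, ratr a \in `]p.2 - e, p.2[ by apply: rat_in_itvoo; lra.
    have [d] : exists a : rat, ratr a \in `]p.2, p.2 + e[ by apply: rat_in_itvoo; lra.
    rewrite !in_itv /= => /andP[d1 d2] /andP[c1 c2] /andP[b1 b2] /andP[a1 a2].
    exists a => //; exists b => //; exists c => //; exists d => //; split.
      by split; rewrite /= in_itv /= ?a2 ?c2.
    move=> q [/=]; rewrite !in_itv /= => /andP[q1 q2] /andP[q3 q4].
    by apply: he; rewrite ltr_norml; lra.
  by case=> h; exact.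
apply: bigcupT_measurable_rat => a; apply: bigcupT_measurable_rat => b.
apply: bigcupT_measurable_rat => c; apply: bigcupT_measurable_rat => d.
pose Q := box a b c d; have [QA|QA] := pselect (Q `<=` A).
  rewrite (_ : S _ _ _ _ = Q); first exact: measurableX.
  by apply/seteqP; split=> [p []|p].
by rewrite (_ : S _ _ _ _ = set0) //; apply/seteqP; split=> [p []|p].
Qed.

Lemma open2_measurable_fun (D : set RR) (f : RR -> R) : open2 D ->
  (forall p, D p -> forall e : R, 0 < e -> exists2 d : R, 0 < d &
    forall q, `|q.1 - p.1| < d -> `|q.2 - p.2| < d -> `|f q - f p| < e) -> measurable_fun D f.
Proof.
move=> oD cf; have mD : measurable D by exact: open2_measurable.
apply: (measurability _ (RGenOInfty.measurableE R)) => _ [_ [a ->] <-].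
apply: open2_measurable => p [Dp /=]; rewrite in_itv /= andbT => ap.
have e0 : 0 < f p - a by rewrite subr_gt0.
have [d d0 hd] := oD _ Dp; have [d' d'0 hd'] := cf _ Dp _ e0.
exists (Num.min d d') => [|q]; first by rewrite lt_min d0.
rewrite !lt_min => /andP[q1 q1'] /andP[q2 q2']; split; first exact: hd.
rewrite /= in_itv /= andbT; have := hd' _ q1' q2'; rewrite ltr_norml; lra.
Qed.

Lemma itg_EFin a b (F : R -> R) : cont_on a b F ->
  (\int[mu]_(x in `[a, b]) (F x)%:E)%E = (itg a b F)%:E.
Proof.
move=> cF; rewrite /itg /Rintegral fineK //.
by apply: integrable_fin_num => //; exact: cont_on_integrable.
Qed.

(** Tonelli for the kernel extended by [0] outside the square. *)
Lemma ge0_itg_swap a b (K : R -> R -> R) : (forall x y, 0 <= K x y) ->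
  measurable_fun setT (fun p : RR => K p.1 p.2) ->
  (forall x, cont_on a b (K x)) -> (forall y, cont_on a b (K ^~ y)) ->
  cont_on a b (fun x => itg a b (K x)) -> cont_on a b (fun y => itg a b (K ^~ y)) ->
  itg a b (fun x => itg a b (K x)) = itg a b (fun y => itg a b (K ^~ y)).
Proof.
move=> K0 mK c1 c2 c3 c4; apply: EFin_inj; rewrite -!itg_EFin //.
pose D : set (measurableTypeR R) := `[a, b]%classic.
pose f : RR -> \bar R := (fun p : RR => (K p.1 p.2)%:E) \_ (D `*` D).
have mD : measurable (D `*` D : set RR) by apply: measurableX; exact: measurable_itv.
have f0 p : (0 <= f p)%E by rewrite /f patchE; case: ifP => // _; rewrite lee_fin.
have mf : measurable_fun setT f.
  apply/(measurable_restrictT _ mD); apply/measurable_EFinP.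
  exact: measurable_funS mK.
have fE x y : f (x, y) = if (x \in D) && (y \in D) then (K x y)%:E else 0%E.
  by rewrite /f patchE in_setX.
have h := @fubini_tonelli _ _ _ _ _ mu mu f mf f0.
rewrite integral_mkcond [RHS]integral_mkcond.
transitivity (\int[mu]_x \int[mu]_y f (x, y))%E.
  apply: eq_integral => x _; rewrite patchE; case: ifPn => xD.
    rewrite -itg_EFin // integral_mkcond; apply: eq_integral => y _.
    by rewrite fE xD /= patchE.
  by rewrite integral0_eq // => y _; rewrite fE (negPf xD).
rewrite h; apply: eq_integral => y _; rewrite patchE; case: ifPn => yD.
  rewrite -itg_EFin // [RHS]integral_mkcond; apply: eq_integral => x _.
  by rewrite fE yD andbT patchE.
by rewrite integral0_eq // => x _; rewrite fE (negPf yD) andbF.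
Qed.

End plane_measurability.

(** * Jensen's formula and its regularization *)

Section log_means.
Variable R : realType.
Implicit Types (f F : R[i] -> R[i]) (a c z w l m : R[i]) (r s e t x y rho : R).
Local Notation tpi := (pi *+ 2 : R).
Local Notation RR := (measurableTypeR R * measurableTypeR R)%type.

Lemma normc_conj z : normc z^*%C = normc z.
Proof. by case: z => x y; rewrite /Normc.normc /= sqrrN. Qed.

(** On the circle [|a - w|] equals [|rho - conj a w / rho|], which has no zero in the disk:
    reflecting the zero makes [mean_value_ln] applicable. *)
Lemma jensen_circ a rho : normc a < rho ->
  itg 0 tpi (fun t => ln (normc (a - circ 0 rho t))) = tpi * ln rho.
Proof.
move=> arho; have a0 := normc_ge0 a.
have rho0 : 0 < rho by lra.
have rhoC : rho%:C != 0 :> R[i] by rewrite -normc_eq0 normcR normr_eq0 gt_eqF.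
(* Any positive [k] strictly between [|a|] and [rho] gives a zero-free radius [rho^2 / k > rho],
   also when [a = 0]. *)
pose k := (normc a + rho) / 2.
have k0 : 0 < k by rewrite /k; lra.
pose G w := rho%:C - (a^*%C / rho%:C) * w.
have GE t : normc (G (circ 0 rho t)) = normc (a - circ 0 rho t).
  have -> : G (circ 0 rho t) = rho%:C - a^*%C * cis t by rewrite /G /circ add0r; field.
  apply/eqP; rewrite -(@eqrXn2 _ 2) ?normc_ge0 // !sqr_normcE !(ReB, ImB) /circ add0r.
  case: (a) => x y /=; apply/eqP.
  transitivity (rho ^+ 2 - 2 * rho * (x * cos t + y * sin t) + (x ^+ 2 + y ^+ 2) * (cos t ^+ 2 +
    sin t ^+ 2)); first by ring.
  rewrite cos2Dsin2 mulr1.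
  transitivity (rho ^+ 2 * (cos t ^+ 2 + sin t ^+ 2) - 2 * rho * (x * cos t + y * sin t) + (x ^+
    2 + y ^+ 2)).
    by rewrite cos2Dsin2 mulr1.
  by ring.
rewrite (eq_itg (G := fun t => ln (normc (G (circ 0 rho t))))); last by move=> t _; rewrite GE.
have cdG z : cder G z (0 - (0 * z + a^*%C / rho%:C * 1)).
  apply: cderB; first exact: cder_cst.
  by apply: cderM; [exact: cder_cst|exact: cder_id].
have := @mean_value_ln R G 0 (rho ^+ 2 / k) rho 0 _ _ _.
rewrite /circ_int => ->.
- by rewrite /G mulr0 subr0 normcR gtr0_norm.
- move=> z; rewrite subr0 => zr; split; first exact: cder_ct (cdG z).
  rewrite subr_eq0; apply: contraTneq zr => /(congr1 (@Normc.normc R)).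
  rewrite normcR gtr0_norm // !Normc.normcM Normc.normcV normcR gtr0_norm // normc_conj => E.
  rewrite -leNgt ler_pdivrMr //.
  have : rho * rho = normc a * normc z by rewrite {1}E; field; rewrite gt_eqF.
  rewrite expr2 => ->; rewrite mulrC; apply: ler_wpM2l; first exact: normc_ge0.
  by rewrite /k; lra.
- by move=> z _ _; eexists; exact: cdG.
- rewrite ltW //= ltr_pdivlMr // expr2 ltr_pM2l // /k; lra.
Qed.

Lemma half_ln_sqr z e : 0 <= e -> z != 0 -> ln (normc z) <= 2^-1 * ln (normc z ^+ 2 + e).
Proof.
move=> e0 z0; have n0 : 0 < normc z ^+ 2 by rewrite exprn_gt0 // normc_gt0.
have : ln (normc z ^+ 2) <= ln (normc z ^+ 2 + e) by rewrite ler_ln ?posrE; lra.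
by rewrite ln_sqr_normc //; lra.
Qed.

Lemma rctN (h : R -> R[i]) : (forall t, rct h t) -> forall t, rct (fun t => - h t) t.
Proof.
by move=> ch t d d0; have [d' d'0 hd] := ch t _ d0; exists d' => // s /hd; rewrite -opprD normcN.
Qed.

(** The mean of [ln |a - w|] over [|w| = s] is [ln (max |a| s)]. For [|a| <= s] the point is first
    moved to [b = (1 - eta) a], strictly inside the circle, and the regularization absorbs the
    error. *)
Lemma ln_max_le a s e : 0 < s -> 0 < e ->
  tpi * ln (Num.max (normc a) s) <= itg 0 tpi (fun t => 2^-1 * ln_dist e a (- circ 0 s t)).
Proof.
move=> s0 e0; have tp := @tpi_gt0 R; have a0 := normc_ge0 a.
have cs t : normc (circ 0 s t) = s by have := normc_circ 0 s t; rewrite subr0 gtr0_norm.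
have rc := rctN (fun t => @rct_circ R 0 s t).
have cR : cont_on 0 tpi (fun t => 2^-1 * ln_dist e a (- circ 0 s t)).
  by move=> t _; apply: continuousM; [exact: cst_continuous|exact: ln_dist_cont].
have cL b : (forall t, b - circ 0 s t != 0) -> cont_on 0 tpi (fun t => ln (normc (b - circ 0 s t))).
  move=> hb t _; apply: (@cont_ln_normc _ (fun w => b - w)) => //.
  by apply: ctB; [exact: ct_cst|exact: ct_id].
have [as_|as_] := ltP s (normc a).
  have nz t : a - circ 0 s t != 0.
    by rewrite subr_eq0; apply: contraTneq as_ => ->; rewrite cs ltxx.
  have E : circ_int (fun w => ln (normc (a - w))) 0 s = tpi * ln (normc (a - 0)).
    apply: (@mean_value_ln _ (fun w => a - w) _ (normc a) _ 0); last lra.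
      move=> z; rewrite subr0 => za; split.
        by apply: ctB; [exact: ct_cst|exact: ct_id].
      by rewrite subr_eq0; apply: contraTneq za => ->; rewrite ltxx.
    by move=> z _ _; eexists; apply: cderB; [exact: cder_cst|exact: cder_id].
  rewrite subr0 in E; rewrite -E; apply: le_itg => //; first exact: cL.
  by move=> t _; apply: half_ln_sqr; [exact: ltW|exact: nz].
(* If [p] and [q] are the distances of [b] and [a] to a point of the circle, then [p <= q + eta s]
   and [q <= 2 s], so [p^2 <= q^2 + 5 s^2 eta], and [8 s^2 eta <= e] suffices. *)
pose eta := Num.min 1 (e / (8 * s ^+ 2)) / 2.
have s2 : 0 < 8 * s ^+ 2 by rewrite mulr_gt0 // exprn_gt0.
have [m1 m2] : Num.min 1 (e / (8 * s ^+ 2)) <= 1 /\ Num.min 1 (e / (8 * s ^+ 2)) <= e / (8 * s ^+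
  2).
  by rewrite !ge_min !lexx orbT.
have m0 : 0 < Num.min 1 (e / (8 * s ^+ 2)) by rewrite lt_min ltr01 divr_gt0.
have eta0 : 0 < eta by rewrite divr_gt0.
have eta1 : eta < 1 by rewrite /eta; lra.
have etae : 8 * s ^+ 2 * eta <= e.
  by move: m2; rewrite ler_pdivlMr //; rewrite /eta; nra.
pose b := (1 - eta)%:C * a.
have bs : normc b < s.
  rewrite /b Normc.normcM normcR gtr0_norm; last lra.
  apply: le_lt_trans (ler_wpM2l _ as_) _; first lra.
  by rewrite gtr_pMl //; lra.
have nz t : b - circ 0 s t != 0.
  by rewrite subr_eq0; apply: contraTneq bs => ->; rewrite cs ltxx.
rewrite -(jensen_circ bs); apply: le_itg => //; first exact: cL.
move=> t _; have n0 : 0 < normc (b - circ 0 s t) ^+ 2 by rewrite exprn_gt0 // normc_gt0.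
suff h : normc (b - circ 0 s t) ^+ 2 <= normc (a - circ 0 s t) ^+ 2 + e.
  have : ln (normc (b - circ 0 s t) ^+ 2) <= ln (normc (a - circ 0 s t) ^+ 2 + e).
    by rewrite ler_ln ?posrE //; lra.
  by rewrite ln_sqr_normc // /ln_dist; lra.
have h1 : normc (b - circ 0 s t) <= normc (a - circ 0 s t) + eta * s.
  have -> : b - circ 0 s t = (a - circ 0 s t) - eta%:C * a by rewrite /b rmorphB rmorph1; ring.
  apply: le_trans (ler_normcD _ _) _; rewrite lerD2l normcN Normc.normcM normcR gtr0_norm //.
  by rewrite ler_pM2l.
have h2 : normc (a - circ 0 s t) <= 2 * s.
  by have := ler_normcD a (- circ 0 s t); rewrite normcN cs; lra.
have := normc_ge0 (b - circ 0 s t); have := normc_ge0 (a - circ 0 s t).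
move: (normc (b - circ 0 s t)) (normc (a - circ 0 s t)) h1 h2 => p q h1 h2 q0 p0.
have p2 : p ^+ 2 <= (q + eta * s) ^+ 2 by rewrite lerXn2r ?nnegrE // addr_ge0 // mulr_ge0 // ltW.
apply: le_trans p2 _.
have -> : (q + eta * s) ^+ 2 = q ^+ 2 + (2 * (eta * s) * q + eta * s * (eta * s)) by ring.
rewrite lerD2l; apply: le_trans etae.
have es : 0 < eta * s by rewrite mulr_gt0.
have k1 : 2 * (eta * s) * q <= 2 * (eta * s) * (2 * s) by rewrite ler_pM2l // mulr_gt0.
have k2 : eta * s * (eta * s) <= eta * s * s by rewrite ler_pM2l // -[X in _ <=
  X]mul1r ler_pM2r // ltW.
have -> : 8 * s ^+ 2 * eta = 8 * (eta * s * s) by ring.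
have : 0 < eta * s * s by rewrite mulr_gt0.
by move: k1 k2; nra.
Qed.

(** The sides differ by [2 (rho - r) (r - x)], where [x] is the projection of [a] on the direction
    [t], at most [|a|]. This replaces a circle that may pass through [a] by a larger one. *)
Lemma dist_circ_le a r rho t : normc a <= r -> r < rho ->
  normc (circ 0 r t - a) ^+ 2 + (rho - r) ^+ 2 <= normc (a - circ 0 rho t) ^+ 2.
Proof.
move=> ar rrho.
have h : complex.Re a * cos t + complex.Im a * sin t <= r.
  apply: le_trans ar; have [//|pos] := leP (complex.Re a * cos t + complex.Im a * sin t) 0.
    by move=> h; apply: le_trans h (normc_ge0 _).
  rewrite -(@ler_pXn2r _ 2) ?nnegrE ?normc_ge0 ?(ltW pos) // sqr_normcE.
  have -> : (complex.Re a * cos t + complex.Im a * sin t) ^+ 2 =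
    (complex.Re a ^+ 2 + complex.Im a ^+ 2) * (cos t ^+ 2 + sin t ^+ 2) -
    (complex.Re a * sin t - complex.Im a * cos t) ^+ 2 by ring.
  by rewrite cos2Dsin2 mulr1; have := sqr_ge0 (complex.Re a * sin t - complex.Im a * cos t); lra.
rewrite !sqr_normcE !(ReB, ImB) /circ !add0r /= !mul0r subr0 addr0 -subr_ge0.
have K0 : 0 <= (rho - r) * (2 * (r - (complex.Re a * cos t + complex.Im a * sin t))).
  by rewrite !mulr_ge0 ?subr_ge0 // ltW.
rewrite (_ : _ - _ = (rho - r) * (2 * (r - (complex.Re a * cos t + complex.Im a * sin t))) +
  (cos t ^+ 2 + sin t ^+ 2 - 1) * (rho ^+ 2 - r ^+ 2)); last by ring.
by rewrite cos2Dsin2 subrr mul0r addr0.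
Qed.

End log_means.

(** * Circle means of [ln (max |f| s)] *)

Section log_mean_bound.
Variable R : realType.
Implicit Types (f F : R[i] -> R[i]) (h k : R -> R[i]) (a c z w l m : R[i]) (r s e t x y b eta : R).
Local Notation tpi := (pi *+ 2 : R).
Local Notation RR := (measurableTypeR R * measurableTypeR R)%type.

Lemma ln_distC e z w : ln_dist e z w = ln_dist e w z.
Proof. by rewrite /ln_dist [z + w]addrC. Qed.

Lemma ln_dist_ge e z w : 0 < e -> ln e <= ln_dist e z w.
Proof.
move=> e0; have h : 0 <= normc (z + w) ^+ 2 by rewrite exprn_ge0 // normc_ge0.
by rewrite /ln_dist ler_ln ?posrE; lra.
Qed.

Lemma ln_dist_measurable e h k : (forall t, rct h t) -> (forall t, rct k t) ->
  measurable_fun setT (fun p : RR => ln_dist e (h p.1) (k p.2)).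
Proof.
move=> ch ck.
have mR (g : R -> R) : continuous g -> measurable_fun setT (fun p : RR => g p.1).
  by move=> cg; apply: (measurableT_comp (f := g)) => //; exact: continuous_measurable_fun.
have mR' (g : R -> R) : continuous g -> measurable_fun setT (fun p : RR => g p.2).
  by move=> cg; apply: (measurableT_comp (f := g)) => //; exact: continuous_measurable_fun.
rewrite (_ : (fun p => _) = (fun p : RR => ln ((complex.Re (h p.1) + complex.Re (k p.2)) ^+ 2 +
   (complex.Im (h p.1) + complex.Im (k p.2)) ^+ 2 + e))); last first.
  by apply/funext => p; rewrite /ln_dist sqr_normcE ReD ImD.
apply: (measurableT_comp (f := @ln R)); first exact: measurable_ln.
apply: measurable_funD => //; apply: measurable_funD; apply: measurable_funX;
  apply: measurable_funD.
- by apply: (mR (fun t => complex.Re (h t))) => t; exact: rct_Re.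
- by apply: (mR' (fun t => complex.Re (k t))) => t; exact: rct_Re.
- by apply: (mR (fun t => complex.Im (h t))) => t; exact: rct_Im.
- by apply: (mR' (fun t => complex.Im (k t))) => t; exact: rct_Im.
Qed.

(** Tonelli asks for a nonnegative kernel, hence the shift by [ln e], a lower bound of
    [ln_dist e]. *)
Lemma itg_ln_dist_swap e h k b : 0 < e -> 0 <= b -> (forall t, rct h t) -> (forall t, rct k t) ->
  itg 0 b (fun x => itg 0 b (fun y => ln_dist e (h x) (k y))) =
  itg 0 b (fun y => itg 0 b (fun x => ln_dist e (h x) (k y))).
Proof.
move=> e0 b0 ch ck.
pose K x y : R := 1 * ln_dist e (h x) (k y) + - ln e.
have c1 x : forall y, {for y, continuous (fun y => ln_dist e (h x) (k y))}.
  by move=> y; exact: ln_dist_cont.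
have c2 y : forall x, {for x, continuous (fun x => ln_dist e (h x) (k y))}.
  move=> x; rewrite (_ : (fun x => _) = (fun x => ln_dist e (k y) (h x)));
    first exact: ln_dist_cont.
  by apply/funext => x'; rewrite ln_distC.
have c3 : forall x, {for x, continuous (fun x => itg 0 b (fun y => ln_dist e (h x) (k y)))}.
  by move=> x; apply: itg_ln_dist_cont.
have c4 : forall y, {for y, continuous (fun y => itg 0 b (fun x => ln_dist e (h x) (k y)))}.
  move=> y; rewrite (_ : (fun y => _) = (fun y => itg 0 b (fun x => ln_dist e (k y) (h x)))).
    exact: itg_ln_dist_cont.
  by apply/funext => y'; apply: eq_itg => x _; rewrite ln_distC.
have KE1 x : itg 0 b (K x) = 1 * itg 0 b (fun y => ln_dist e (h x) (k y)) + - ln e * b.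
  by rewrite /K itg_affine.
have KE2 y : itg 0 b (K ^~ y) = 1 * itg 0 b (fun x => ln_dist e (h x) (k y)) + - ln e * b.
  by rewrite /K itg_affine.
have := @ge0_itg_swap R 0 b K.
move/(_ _ _ _ _ _ _)/wrap => [x y||x|y|||].
- by rewrite /K mul1r subr_ge0 ln_dist_ge.
- apply: measurable_funD => //; apply: measurable_funM => //; exact: ln_dist_measurable.
- exact: affine_cont.
- exact: affine_cont.
- rewrite (_ : (fun x => _) = (fun x => 1 * itg 0 b (fun y => ln_dist e (h x) (k y)) + - ln e *
    b)); last exact/funext.
  exact: affine_cont.
- rewrite (_ : (fun x => _) = (fun y => 1 * itg 0 b (fun x => ln_dist e (h x) (k y)) + - ln e *
    b)); last exact/funext.
  exact: affine_cont.
rewrite (eq_itg (G := fun x => 1 * itg 0 b (fun y => ln_dist e (h x) (k y)) + - ln e * b));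
  last by move=> x _.
rewrite [RHS](eq_itg (G := fun y => 1 * itg 0 b (fun x => ln_dist e (h x) (k y)) + - ln e * b));
  last by move=> x _.
rewrite (itg_affine _ b0 c3) (itg_affine _ b0 c4) => E.
have cancel (u v c : R) : 1 * u + c = 1 * v + c -> u = v by rewrite !mul1r => /addIr.
exact: cancel E.
Qed.

Variables (f : R[i] -> R[i]) (r1 r s : R).
Hypothesis fh : forall z, normc z < 1 -> exists l, cder f z l.
Hypothesis fi : forall z w, normc z < 1 -> normc w < 1 -> f z = f w -> z = w.
Hypothesis f00 : f 0 = 0.
Hypothesis r10 : 0 < r1.
Hypothesis r1r : r1 < r.
Hypothesis r_lt1 : r < 1.
Hypothesis s0 : 0 < s.
Hypothesis fs : forall z, normc z <= r1 -> normc (f z) < s.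

Let H t := f (circ 0 r t).
Let B := tpi * (ln s + ln (r / r1)).
(** Approximates from above twice the integral of [ln |f - w|] over the circle of radius [r]. *)
Let Gm e w := itg 0 tpi (fun t => ln_dist e (H t) (- w)).

Let r0 : 0 < r. Proof. exact: lt_trans r1r. Qed.

Let cr t : normc (circ 0 r t) = r.
Proof. by have := normc_circ 0 r t; rewrite subr0 gtr0_norm. Qed.

Let sub0 z : z - 0 = z. Proof. by rewrite subr0. Qed.

Let cf z : normc z < 1 -> ct f z.
Proof. by move=> /fh[l /cder_ct]. Qed.

Let rH t : rct H t.
Proof. by apply: rct_comp; [apply: cf; rewrite cr|exact: rct_circ]. Qed.

Let BE : B = tpi * (ln s - ln r1) + tpi * ln r.
Proof. by rewrite /B ln_div ?posrE //; ring. Qed.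

Let cH e w t : 0 < e -> {for t, continuous (fun t => ln_dist e (H t) (- w))}.
Proof.
move=> e0; rewrite (_ : (fun x => _) = (fun x => ln_dist e (- w) (H x))); first exact: ln_dist_cont.
by apply/funext => x'; rewrite ln_distC.
Qed.

(** Factor [f - w] as a quotient times [z - a]. The quotient has mean logarithm [ln (s / |a|)], read
    off at [0], and Jensen's formula gives [ln rho] for [z - a] on a slightly larger circle. Finally
    [|a| > r1], because [|f| < s] on [|z| <= r1]. *)
Lemma Gm_hit w a eta : normc w = s -> 0 < eta -> normc a <= r -> f a = w ->
  exists2 e, 0 < e & Gm e w <= 2 * (B + eta).
Proof.
move=> ws eta0 ar fa; have tp := @tpi_gt0 R.
have a1 : normc a < 1 by exact: le_lt_trans r_lt1.
have [l fl] := fh a1.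
have fi' : inj_disc f 0 1 by move=> z z' hz hz'; rewrite !sub0 in hz hz'; exact: fi.
have fh' : holo f 0 1 by move=> z hz; rewrite sub0 in hz; exact: fh.
have l0 : l != 0 by apply: (inj_cder_neq0 fh' fi' _ fl); rewrite sub0.
have q_ok z : normc (z - 0) < 1 -> ct (quot f a l) z /\ quot f a l z != 0.
  move=> zr; split; first by apply: quot_ct => //; apply: fh; rewrite -[z]sub0.
  by apply: (quot_neq0 fi' l0) => //; rewrite sub0.
have [|m m0 hm] := @circ_lower R (quot f a l) 0 r.
  by move=> z zr; apply: q_ok; rewrite zr.
have ra : r1 < normc a.
  by rewrite ltNge; apply/negP => /fs; rewrite fa ws ltxx.
have a0 : 0 < normc a by apply: lt_trans ra.
(* The larger radius costs exactly [eta] in the integral and allows [a] to lie on the circle of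
   radius [r]. *)
pose rho := r * expR (eta / tpi).
have rrho : r < rho by rewrite /rho ltr_pMr // expR_gt1 divr_gt0.
have rho0 : 0 < rho by apply: lt_trans rrho.
have lnrho : tpi * ln rho = tpi * ln r + eta.
  by rewrite /rho lnM ?posrE ?expR_gt0 // expRK mulrDr; congr (_ + _);
    rewrite mulrC divfK // gt_eqF.
(* At most [|quot|^2 (rho - r)^2], the gain provided by [dist_circ_le]. *)
pose e := m ^+ 2 * (rho - r) ^+ 2.
have e0 : 0 < e by rewrite mulr_gt0 // exprn_gt0 // subr_gt0.
exists e => //.
have q0E : normc (quot f a l 0) = s / normc a.
  have := quotE f a l 0; rewrite f00 fa !sub0r => /(congr1 (@Normc.normc R)).
  by rewrite normcN ws Normc.normcM normcN => ->; rewrite mulfK // gt_eqF.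
have mean_q : circ_int (fun z => ln (normc (quot f a l z))) 0 r = tpi * ln (normc (quot f a l 0)).
  apply: (@mean_value_ln _ _ _ 1 _ a) => //; last by rewrite ltW.
  by move=> z; rewrite sub0 => /fh[m' hm'] za; apply: quot_cder hm'.
have mean_a := @jensen_circ R a rho (le_lt_trans ar rrho).
have nz t : a - circ 0 rho t != 0.
  rewrite subr_eq0; apply/eqP => E; have := normc_circ 0 rho t; rewrite sub0 -E gtr0_norm //.
  by lra.
have c1 : cont_on 0 tpi (fun t => ln (normc (quot f a l (circ 0 r t)))).
  by move=> t _; have [|h1 h2] := q_ok (circ 0 r t); [rewrite sub0 cr|exact: cont_ln_normc].
have c2 : cont_on 0 tpi (fun t => ln (normc (a - circ 0 rho t))).
  move=> t _; apply: (@cont_ln_normc _ (fun z => a - z)) => //.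
  by apply: ctB; [exact: ct_cst|exact: ct_id].
have c12 : cont_on 0 tpi (fun t => ln (normc (quot f a l (circ 0 r t))) +
  ln (normc (a - circ 0 rho t))).
  by move=> t ht; apply: continuousD; [exact: c1|exact: c2].
have : Gm e w <= itg 0 tpi (fun t => 2 * (ln (normc (quot f a l (circ 0 r t))) +
  ln (normc (a - circ 0 rho t)))).
  apply: le_itg; first by move=> t _; exact: cH.
    by move=> t ht; apply: continuousM; [exact: cst_continuous|exact: c12].
  move=> t _; have [|_ qn] := q_ok (circ 0 r t); first by rewrite sub0 cr.
  have mq : m <= normc (quot f a l (circ 0 r t)) by apply: hm; rewrite sub0 cr.
  rewrite mulrDr -!ln_sqr_normc // -lnM ?posrE ?exprn_gt0 ?normc_gt0 // /ln_dist.
  rewrite ler_ln ?posrE ?mulr_gt0 ?exprn_gt0 ?normc_gt0 //; last first.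
    by rewrite ltr_wpDl // exprn_ge0 // normc_ge0.
  have := @dist_circ_le R a r rho t ar rrho => hd.
  rewrite -fa (quotE f a l) Normc.normcM exprMn.
  have m2 : m ^+ 2 <= normc (quot f a l (circ 0 r t)) ^+ 2 by rewrite lerXn2r ?nnegrE ?normc_ge0
    ?(ltW m0).
  apply: le_trans (ler_wpM2l _ hd); last by rewrite exprn_ge0 // normc_ge0.
  by rewrite mulrDr lerD2l /e ler_wpM2r // exprn_ge0 // subr_ge0 ltW.
rewrite itgZ // itgD // mean_a -/(circ_int (fun z => ln (normc (quot f a l z))) 0 r) mean_q q0E
  lnrho.
move=> h; apply: le_trans h _; rewrite ler_pM2l // BE.
rewrite -addrA lerD2r ler_pM2l // ln_div ?posrE // lerD2l lerN2 ler_ln ?posrE // ltW //.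
Qed.

(** Here [f - w] has no zero for [|z| <= r], and its mean logarithm is [ln |f 0 - w| = ln s]. *)
Lemma Gm_miss w eta : normc w = s -> 0 < eta -> (forall a, normc a <= r -> f a <> w) ->
  exists2 e, 0 < e & Gm e w <= 2 * (B + eta).
Proof.
move=> ws eta0 miss; have tp := @tpi_gt0 R.
(* By injectivity [w] has at most one preimage, so the zero-free disk extends beyond radius [r]. *)
have [r' rr' [r'1 hr']] : exists2 r', r < r' & r' <= 1 /\ forall z, normc z < r' -> f z <> w.
  have [[a [a1 fa]]|no] := pselect (exists a, normc a < 1 /\ f a = w).
    exists (normc a); first by rewrite ltNge; apply/negP => /miss.
    split; first exact: ltW.
    move=> z za; rewrite -fa => E; have za' := fi (lt_trans za a1) a1 E.
    by move: za; rewrite za' ltxx.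
  by exists 1 => //; split => // z z1 fz; apply: no; exists z.
have ok z : normc (z - 0) < r' -> ct (fun z => f z - w) z /\ f z - w != 0.
  rewrite sub0 => zr; split.
    by apply: ctB; [apply: cf; exact: lt_le_trans r'1|exact: ct_cst].
  by rewrite subr_eq0; apply/eqP; exact: hr'.
have [|m m0 hm] := @circ_lower R (fun z => f z - w) 0 r.
  by move=> z zr; apply: ok; rewrite zr.
have mean : circ_int (fun z => ln (normc (f z - w))) 0 r = tpi * ln s.
  rewrite (_ : s = normc (f 0 - w)); last by rewrite f00 sub0r normcN.
  apply: (@mean_value_ln _ (fun z => f z - w) _ r' _ 0) => //; last by rewrite ltW.
  move=> z; rewrite sub0 => zr _; have [|l hl] := fh (z := z); first exact: lt_le_trans r'1.
  by eexists; apply: cderB hl _; exact: cder_cst.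
pose e := m ^+ 2 * (eta / tpi).
have e0 : 0 < e by rewrite mulr_gt0 ?exprn_gt0 ?divr_gt0.
exists e => //.
have c1 t : {for t, continuous (fun t => ln (normc (H t - w)))}.
  by have [|h1 h2] := ok (circ 0 r t); [rewrite sub0 cr|exact: (@cont_ln_normc _ (fun z =>
    f z - w))].
have : Gm e w <= itg 0 tpi (fun t => 2 * ln (normc (H t - w)) + eta / tpi).
  apply: le_itg; [by move=> t _; exact: cH|exact: affine_cont|].
  move=> t _; have [|_ nz] := ok (circ 0 r t); first by rewrite sub0 cr.
  have mq : m <= normc (H t - w) by apply: hm; rewrite sub0 cr.
  have n2 : 0 < normc (H t - w) ^+ 2 by rewrite exprn_gt0 // normc_gt0.
  rewrite /ln_dist -ln_sqr_normc //.
  have -> : normc (H t - w) ^+ 2 + e = normc (H t - w) ^+ 2 * (1 + e / normc (H t - w) ^+ 2).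
    by field; rewrite normc_eq0.
  have en : e / normc (H t - w) ^+ 2 <= eta / tpi.
    rewrite ler_pdivrMr // /e mulrC ler_pM2l ?divr_gt0 //.
    by rewrite lerXn2r ?nnegrE ?normc_ge0 ?(ltW m0).
  have en0 : 0 < e / normc (H t - w) ^+ 2 by rewrite divr_gt0.
  rewrite lnM ?posrE //; last by rewrite addr_gt0.
  by rewrite lerD2l; apply: le_trans en; apply: le_ln1Dx; lra.
have E : itg 0 tpi (fun t => ln (normc (H t - w))) = tpi * ln s by exact: mean.
rewrite (itg_affine _ (ltW tp) c1) E divfK ?gt_eqF //.
have : ln r1 <= ln r by rewrite ler_ln ?posrE // ltW.
move=> h h'; apply: le_trans h' _; rewrite BE.
have : 0 <= tpi * (ln r - ln r1) by rewrite mulr_ge0 ?subr_ge0 // ltW.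
by lra.
Qed.

(* A monotone family of continuous functions of [w], pointwise eventually below
   [2 * (B + eta)] on the circle [|w| = s], is so uniformly (Dini). *)
Lemma Gm_uniform eta : 0 < eta -> exists2 e, 0 < e & forall t,
  0 <= t <= tpi -> Gm e (circ 0 s t) <= 2 * (B + eta).
Proof.
move=> eta0; have tp := @tpi_gt0 R; have eta2 : 0 < eta / 2 by rewrite divr_gt0.
have cs t : normc (circ 0 s t) = s by have := normc_circ 0 s t; rewrite subr0 gtr0_norm.
have hloc w : normc w = s -> exists2 e, 0 < e & Gm e w <= 2 * (B + eta / 2).
  move=> ws; have [[a [ar fa]]|no] := pselect (exists a, normc a <= r /\ f a = w).
    exact: (Gm_hit ws eta2 ar fa).
  by apply: Gm_miss => // a ar fa; apply: no; exists a.
(* The angle is encoded as the real part of a point of the disk of radius [2 pi], and the scale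
   plays the role of [e]. *)
have [|x _|d d0 hd] := @disc_uniform R 0 tpi (fun z d => Gm d (circ 0 s (complex.Re z)) <= 2 *
  (B + eta)).
- move=> x d d' /andP[d'0 d'd] h; apply: le_trans h; apply: le_itg.
  + by move=> t _; exact: cH.
  + by move=> t _; apply: cH; exact: lt_le_trans d'd.
  move=> t _; have h : 0 <= normc (H t + - circ 0 s (complex.Re x)) ^+
    2 by rewrite exprn_ge0 // normc_ge0.
  by rewrite /ln_dist ler_ln ?posrE; lra.
- have [e e0 he] := hloc _ (cs (complex.Re x)).
  have cG : {for complex.Re x, continuous (fun t => Gm e (circ 0 s t))}.
    rewrite (_ : (fun t => _) = (fun t => itg 0 tpi (fun y => ln_dist e (- circ 0 s t) (H y)))).
      by apply: itg_ln_dist_cont => //; [exact: ltW|apply: rctN => t; exact: rct_circ].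
    by apply/funext => t; apply: eq_itg => y _; rewrite ln_distC.
  have [d d0 hd] := for_continuous_near cG eta0.
  exists (Num.min d e); first by rewrite lt_min d0.
  move=> x' xx' _; have m0 : 0 < Num.min d e by rewrite lt_min d0.
  have [md me] : Num.min d e <= d /\ Num.min d e <= e by rewrite !ge_min !lexx orbT.
  apply: (@le_trans _ _ (Gm e (circ 0 s (complex.Re x')))).
    apply: le_itg; [by move=> t _; exact: cH|by move=> t _; exact: cH|].
    move=> t _; have h : 0 <= normc (H t + - circ 0 s (complex.Re x')) ^+
      2 by rewrite exprn_ge0 // normc_ge0.
    by rewrite /ln_dist ler_ln ?posrE; lra.
  have := hd (complex.Re x'); rewrite -ReB => /(_ (le_lt_trans (ler_Re_normc _) (lt_le_trans xx'
    md))).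
  by rewrite ltr_norml; lra.
exists d => // t tpi_t; have := hd t%:C; apply.
by rewrite sub0 normcR ger0_norm; lra.
Qed.

(** Average [ln_max_le] over the circle of radius [r], exchange the integrals, and bound the inner
    one uniformly by [Gm_uniform]. *)
Lemma log_mean_bound : itg 0 tpi (fun t => ln (Num.max (normc (H t)) s)) <= B.
Proof.
have tp := @tpi_gt0 R; apply/ler_addgt0Pr => eta eta0.
have [e e0 he] := Gm_uniform eta0.
have cm : cont_on 0 tpi (fun t => ln (Num.max (normc (H t)) s)).
  move=> t _; apply: (@continuous_comp _ _ _ (fun t => Num.max (normc (H t)) s) (@ln R)).
    by apply: continuous_max; [exact: rct_normc|exact: cst_continuous].
  by apply: continuous_ln; rewrite lt_max s0 orbT.
have rS := rctN (fun t => @rct_circ R 0 s t).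
have c3 t : {for t, continuous (fun x => itg 0 tpi (fun y => ln_dist e (H x) (- circ 0 s y)))}.
  by apply: itg_ln_dist_cont => //; exact: ltW.
have c4 : cont_on 0 tpi (fun t => Gm e (circ 0 s t)).
  move=> t _; rewrite (_ : (fun t => _) = (fun t => itg 0 tpi (fun y =>
    ln_dist e (- circ 0 s t) (H y)))).
    by apply: itg_ln_dist_cont => //; exact: ltW.
  by apply/funext => t'; apply: eq_itg => y _; rewrite ln_distC.
have h1 : tpi * itg 0 tpi (fun t => ln (Num.max (normc (H t)) s)) <=
    2^-1 * itg 0 tpi (fun x => itg 0 tpi (fun y => ln_dist e (H x) (- circ 0 s y))).
  rewrite -(itgZ _ cm) -(itgZ _ (fun t _ => c3 t)).
  apply: le_itg.
  - by move=> t ht; apply: continuousM; [exact: cst_continuous|exact: cm].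
  - by move=> t ht; apply: continuousM; [exact: cst_continuous|exact: c3].
  move=> t _; apply: le_trans (ln_max_le _ s0 e0) _.
  by rewrite itgZ // => y _; exact: ln_dist_cont.
have h2 : itg 0 tpi (fun t => Gm e (circ 0 s t)) <= 2 * (B + eta) * tpi.
  have <- : itg 0 tpi (fun=> 2 * (B + eta)) = 2 * (B + eta) * tpi.
    by rewrite itg_cst ?ltW // subr0.
  apply: le_itg => //; first exact: cont_on_cst.
rewrite (itg_ln_dist_swap e0 (ltW tp) rH rS) in h1.
have : tpi * itg 0 tpi (fun t => ln (Num.max (normc (H t)) s)) <= tpi * (B + eta).
  by apply: le_trans h1 _; move: h2; rewrite /Gm; lra.
by rewrite ler_pM2l.
Qed.

End log_mean_bound.

(** * Rotations of the plane *)

(* The instance making a product of sigma-finite measures sigma-finite is not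
   inferred on [mu \x mu], hence this alias carrying it. *)
Definition plane_area (R : realType) : set (measurableTypeR R * measurableTypeR R) -> \bar R :=
  (@lebesgue_measure R \x @lebesgue_measure R)%E.

HB.instance Definition _ (R : realType) :=
  Measure.copy (@plane_area R) (@lebesgue_measure R \x @lebesgue_measure R)%E.

Lemma plane_area_sigma_finite (R : realType) : sigma_finite setT (@plane_area R).
Proof.
have /sigma_finiteP[F [TF ndF Foo]] := sigma_finiteT (@lebesgue_measure R).
exists (fun n => F n `*` F n).
  rewrite -setXTT TF predeqE => -[x y]; split=> [[[/= n _ Fnx] [k _ Gky]]|].
    exists (maxn n k) => //; split.
      by move: x Fnx; exact/subsetPset/ndF/leq_maxl.
    by move: y Gky; exact/subsetPset/ndF/leq_maxr.
  by move=> [n _ []/= ? ?]; split; exists n.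
move=> k; have [mF ?] := Foo k; split; first exact: measurableX.
by rewrite /plane_area product_measure1E // lte_mul_pinfty // ge0_fin_numE.
Qed.

HB.instance Definition _ (R : realType) :=
  Measure_isSigmaFinite.Build _ _ _ (@plane_area R) (@plane_area_sigma_finite R).

Section plane_rotation.
Variable R : realType.
Local Notation mu := (@lebesgue_measure R).
Local Notation RR := (measurableTypeR R * measurableTypeR R)%type.
Implicit Types (a c s t x y : R).

Lemma lebesgue_measureD a (A : set R) : measurable A ->
  pushforward mu ((fun x => x + a) : _ -> measurableTypeR R) A = mu A.
Proof.
move=> mA; apply/esym/lebesgue_measure_unique => //=; first exact: measurable_funD.
move=> _ _ [[u v]] _ <-; rewrite /pushforward (_ : _ @^-1` _ = `]u - a, v - a]%classic).
  by rewrite !lebesgue_measure_itv /= !lte_fin ltrD2r -!EFinB; case: ifP => // _; congr EFin; ring.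
by apply/seteqP; split=> x /=; rewrite !in_itv /= ltrBlDr lerBrDr.
Qed.

Lemma ge0_integral_shift (f : R -> \bar R) a : measurable_fun setT f -> (forall x, (0 <= f x)%E) ->
  (\int[mu]_x f (x + a)%R = \int[mu]_x f x)%E.
Proof.
move=> mf f0.
have := @ge0_integral_pushforward _ _ (measurableTypeR R) (measurableTypeR R) R (fun x => x +
  a) _ mu setT f measurableT mf.
rewrite preimage_setT /= => <- //; last exact: measurable_funD.
apply: eq_measure_integral => //= [|_ A mA _]; first exact: measurable_funD.
exact: lebesgue_measureD.
Qed.

Lemma ge0_integral_opp (f : R -> \bar R) : measurable_fun setT f -> (forall x, (0 <= f x)%E) ->
  (\int[mu]_x f (- x)%R = \int[mu]_x f x)%E.
Proof.
move=> mf f0.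
have := @ge0_integral_pushforward _ _ (measurableTypeR R) (measurableTypeR R) R -%R _ mu setT f
  measurableT mf.
rewrite preimage_setT /= => <- //.
by apply: eq_measure_integral => //= A mA _; exact: lebesgue_measureN.
Qed.

Lemma integral_shearx (F : RR -> \bar R) a : measurable_fun setT F -> (forall p, (0 <= F p)%E) ->
  (\int[(mu \x mu)%E]_p F (p.1 + a * p.2, p.2)%R = \int[(mu \x mu)%E]_p F p)%E.
Proof.
move=> mF F0; rewrite [RHS]fubini_tonelli2 // fubini_tonelli2 //; last first.
  apply: (measurableT_comp mF); apply: measurable_fun_pair => //=.
  by apply: measurable_funD => //; exact: measurable_funM.
apply: eq_integral => y _ /=; rewrite /fubini_G /=.
apply: (@ge0_integral_shift (fun x => F (x, y))) => //.
exact: measurableT_comp.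
Qed.

Lemma integral_sheary (F : RR -> \bar R) a : measurable_fun setT F -> (forall p, (0 <= F p)%E) ->
  (\int[(mu \x mu)%E]_p F (p.1, p.2 + a * p.1)%R = \int[(mu \x mu)%E]_p F p)%E.
Proof.
move=> mF F0; rewrite [RHS]fubini_tonelli1 // fubini_tonelli1 //; last first.
  apply: (measurableT_comp mF); apply: measurable_fun_pair => //=.
  by apply: measurable_funD => //; exact: measurable_funM.
apply: eq_integral => x _ /=; rewrite /fubini_F /=.
apply: (@ge0_integral_shift (fun y => F (x, y))) => //.
exact: measurableT_comp.
Qed.

Definition rot c s (p : R * R) : R * R := (c * p.1 - s * p.2, s * p.1 + c * p.2).

Lemma measurable_rot c s : measurable_fun setT (rot c s : RR -> RR).
Proof.
apply: measurable_fun_pair => /=.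
  by apply: measurable_funB; apply: measurable_funM.
by apply: measurable_funD; apply: measurable_funM.
Qed.

(* A rotation is a product of three shears unless its matrix is scalar, and the
   half-turn is the square of the quarter-turn. *)
Lemma integral_rot (F : RR -> \bar R) c s : c ^+ 2 + s ^+ 2 = 1 ->
  measurable_fun setT F -> (forall p, (0 <= F p)%E) ->
  (\int[(mu \x mu)%E]_p F (rot c s p) = \int[(mu \x mu)%E]_p F p)%E.
Proof.
have nz c' s' (G : RR -> \bar R) : s' != 0 -> c' ^+ 2 + s' ^+ 2 = 1 -> measurable_fun setT G ->
  (forall p, (0 <= G p)%E) ->
  (\int[(mu \x mu)%E]_p G (rot c' s' p) = \int[(mu \x mu)%E]_p G p)%E.
  (* For the angle [theta] this is [- tan (theta / 2)]: the rotation is a horizontal shear by [a], a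
     vertical one by [s'], and the horizontal one again. *)
  move=> s0 cs mG G0; pose a : R := (c' - 1) / s'.
  rewrite -[RHS](@integral_shearx G a) //.
  pose G1 (p : RR) := G (p.1 + a * p.2, p.2).
  have mG1 : measurable_fun setT G1.
    apply: (measurableT_comp mG); apply: measurable_fun_pair => //=.
    by apply: measurable_funD => //; exact: measurable_funM.
  rewrite -[RHS](@integral_sheary G1 s') //; last by move=> p; exact: G0.
  pose G2 (p : RR) := G1 (p.1, p.2 + s' * p.1).
  have mG2 : measurable_fun setT G2.
    apply: (measurableT_comp mG1); apply: measurable_fun_pair => //=.
    by apply: measurable_funD => //; exact: measurable_funM.
  rewrite -[RHS](@integral_shearx G2 a) //; last by move=> p; exact: G0.
  apply: eq_integral => p _; rewrite /G2 /G1 /rot /a /=; congr (G (_, _)); last by field.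
  have -> : c' * p.1 - s' * p.2 = c' * p.1 + (c' ^+ 2 - 1) / s' * p.2 by rewrite -cs; field.
  by field.
move=> cs mF F0; have [s0|s0] := eqVneq s 0; last exact: nz.
have : (c - 1) * (c + 1) = 0 by move: cs; rewrite s0; lra.
move/eqP; rewrite mulf_eq0 subr_eq0 addr_eq0 => /orP[] /eqP c1.
  by apply: eq_integral => -[x y] _; rewrite /rot s0 c1 /=; congr (F (_, _)); ring.
have e1 : (0 : R) ^+ 2 + 1 ^+ 2 = 1 by ring.
rewrite -[RHS](nz 0 1) ?oner_eq0 //.
rewrite -[RHS](nz 0 1 (F \o rot 0 1)) ?oner_eq0 //; last 2 first.
- exact: (measurableT_comp mF (measurable_rot 0 1)).
- by move=> p; exact: F0.
by apply: eq_integral => -[x y] _; rewrite /rot s0 c1 /=; congr (F (_, _)); ring.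
Qed.

(** Integrate [F] at the rotated point over the angles and the plane: by [integral_rot] every angle
    contributes the same, and Tonelli exchanges the order. *)
Lemma rotation_average (F G : RR -> \bar R) (T : R) : 0 <= T ->
  measurable_fun setT F -> (forall p, (0 <= F p)%E) ->
  measurable_fun setT G ->
  (forall p, \int[mu]_(t in `[0%R, T]) F (rot (cos t) (sin t) p) <= G p)%E ->
  (T%:E * \int[(mu \x mu)%E]_p F p <= \int[(mu \x mu)%E]_p G p)%E.
Proof.
move=> T0 mF F0 mG FG.
pose D : set (measurableTypeR R) := `[0, T]%classic.
have mD : measurable D by exact: measurable_itv.
have muD : mu D = T%:E.
  by rewrite /D lebesgue_measure_itv /= lte_fin sube0; case: ltgtP T0 => // <-.
pose K (q : measurableTypeR R * RR) : \bar R := (F (rot (cos q.1) (sin q.1) q.2) * (\1_D q.1)%:E)%E.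
have K0 q : (0 <= K q)%E by rewrite mule_ge0 // lee_fin.
have mK : measurable_fun setT K.
  apply: emeasurable_funM; last first.
    by apply/measurable_EFinP; apply: (@measurableT_comp _ _ _ _ _ _ (\1_D : measurableTypeR R ->
      R)) => //; apply: measurable_indic; exact: measurable_itv.
  apply: (measurableT_comp mF); apply: measurable_fun_pair => /=.
    apply: measurable_funB; apply: measurable_funM.
    - by apply: (measurableT_comp (f := @cos R)) => //; apply: continuous_measurable_fun;
        exact: continuous_cos.
    - by apply: measurableT_comp.
    - by apply: (measurableT_comp (f := @sin R)) => //; apply: continuous_measurable_fun;
        exact: continuous_sin.
    - by apply: measurableT_comp.
  apply: measurable_funD; apply: measurable_funM.
  - by apply: (measurableT_comp (f := @sin R)) => //; apply: continuous_measurable_fun;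
      exact: continuous_sin.
  - by apply: measurableT_comp.
  - by apply: (measurableT_comp (f := @cos R)) => //; apply: continuous_measurable_fun;
      exact: continuous_cos.
  - by apply: measurableT_comp.
have := @fubini_tonelli _ _ (measurableTypeR R) RR R mu (@plane_area R) K mK K0.
rewrite /plane_area /=.
have -> : (\int[mu]_t \int[(mu \x mu)%E]_p K (t, p) = T%:E * \int[(mu \x mu)%E]_p F p)%E.
  transitivity (\int[mu]_t (\int[(mu \x mu)%E]_p F p * (\1_D t)%:E))%E.
    apply: eq_integral => t _; rewrite /K /=.
    rewrite ge0_integralZr //.
      by rewrite integral_rot // cos2Dsin2.
    exact: (measurableT_comp mF (measurable_rot _ _)).
  rewrite ge0_integralZl //; last 2 first.
  - by apply/measurable_EFinP; apply: measurable_indic; exact: measurable_itv.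
  - exact: integral_ge0.
  by rewrite integral_indic // setIT [X in (_ * X)%E]muD muleC.
move=> ->; apply: ge0_le_integral => //.
- by move=> p _; apply: integral_ge0 => t _; exact: K0.
- exact: measurable_fun_fubini_tonelli_G.
move=> p _; apply: le_trans (FG p); rewrite /K /= [leRHS]integral_mkcond.
rewrite le_eqVlt; apply/orP; left; apply/eqP; apply: eq_integral => t _.
by rewrite patchE indicE /D; case: ifP; rewrite ?mule1 ?mule0.
Qed.
End plane_rotation.

(** * Integrability *)

Section disc_weight.
Variable R : realType.
Local Notation mu := (@lebesgue_measure R).
Local Notation RR := (measurableTypeR R * measurableTypeR R)%type.
Implicit Types (a b c s t x y : R).

Lemma continuous_powR a x : 0 < x -> {for x, continuous (fun y => y `^ a)}.
Proof.
move=> x0; apply: differentiable_continuous; apply/derivable1_diffP.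
exact: (@ex_derive _ _ _ _ _ _ _ (is_derive1_powR a x0)).
Qed.

Lemma measurable_powR_itv c (D : set (measurableTypeR R)) : measurable_fun D (fun x => (x `^ c)%:E).
Proof. by apply/measurable_EFinP; apply: measurable_funTS; exact: measurable_powR. Qed.

(** The integrand may be unbounded at [0], so the interval is exhausted by [[s / (n + 2), s]], where
    the fundamental theorem applies; [n + 2] keeps the endpoints distinct. *)
Lemma integral_powR_le a s : -1 < a -> 0 < s ->
  (\int[mu]_(x in `]0%R, s]) (x `^ a)%:E <= (s `^ (a + 1) / (a + 1))%:E)%E.
Proof.
move=> a1 s0; have a10 : 0 < a + 1 by lra.
pose F n : set (measurableTypeR R) := `[s / n.+2%:R, s]%classic.
have p0 n : 0 < s / n.+2%:R :> R by rewrite divr_gt0.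
have ps n : s / n.+2%:R < s.
  by rewrite ltr_pdivrMr // ltr_pMr // ltr1n.
have -> : `]0, s]%classic = \bigcup_n F n.
  apply/seteqP; split=> [x /=|x [n _] x0]; first rewrite in_itv /= => /andP[x0 xs].
    exists (Num.truncn (s / x)) => //; rewrite /F /= in_itv /= xs andbT.
    rewrite ler_pdivrMr // mulrC -ler_pdivrMr //.
    have := truncnS_gt (s / x); rewrite -natr1 => h.
    apply: ltW; apply: lt_le_trans h _; rewrite natr1 ler_nat; exact: leqnSn.
  move: x0; rewrite /F /= !in_itv /= => /andP[x0 ->]; rewrite andbT; exact: lt_le_trans x0.
have h := @ge0_nondecreasing_set_cvg_integral _ _ R F (fun x => (x `^ a)%:E) mu.
have {}h : (\int[mu]_(x in F i) (x `^ a)%:E @[i --> \oo] -->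
  \int[mu]_(x in \bigcup_i F i) (x `^ a)%:E)%E.
  apply: h.
  - apply/nondecreasing_seqP => n; apply/subsetPset => x; rewrite /F /= !in_itv /= => /andP[h1 ->].
    rewrite andbT; apply: le_trans h1; rewrite ler_pM2l // lef_pV2 ?posrE // ler_nat //.
  - by move=> n; exact: measurable_itv.
  - by move=> n; exact: measurable_powR_itv.
  - by move=> n x _; rewrite lee_fin powR_ge0.
rewrite -(cvg_lim _ h) //; apply: lime_le; first by apply/cvg_ex; eexists; exact: h.
apply: nearW => n.
pose G x : R := x `^ (a + 1) / (a + 1).
have dG x : 0 < x -> is_derive x 1 G (x `^ a).
  move=> x0; rewrite /G (_ : (fun _ => _) = (a + 1)^-1 *: (fun y => y `^ (a + 1))).
    have := is_derive1_powR (a + 1) x0; rewrite addrK => hd.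
    by apply: is_derive_eq; rewrite /GRing.scale /= mulrA mulVf ?mul1r // gt_eqF.
  by apply/funext => y; rewrite /GRing.scale /= mulrC.
have cG x : 0 < x -> {for x, continuous G}.
  by move=> x0; apply: differentiable_continuous; apply/derivable1_diffP;
    exact: (@ex_derive _ _ _ _ _ _ _ (dG _ x0)).
rewrite (@continuous_FTC2 _ (fun x => x `^ a) G) //.
- rewrite -EFinB lee_fin; have : 0 <= G (s / n.+2%:R) by rewrite divr_ge0 ?powR_ge0 // ltW.
  by rewrite /G; lra.
- apply: continuous_in_subspaceT => x; rewrite inE /= in_itv /= => /andP[x0 _].
  by apply: continuous_powR; exact: lt_le_trans x0.
- split.
  + move=> x; rewrite in_itv /= => /andP[x0 _]; apply: (@ex_derive _ _ _ _ _ _ _ (dG x _));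
      exact: lt_trans x0.
  + by apply: cvg_at_right_filter; apply: cG.
  + by apply: cvg_at_left_filter; apply: cG.
- move=> x; rewrite in_itv /= => /andP[x0 _]; rewrite derive1E.
  by have hd := dG _ (lt_trans (p0 n) x0); rewrite derive_val.
Qed.

(** Translation and reflection carry each endpoint singularity to [0] on an interval of length
    [2 s]. *)
Lemma integral_powR_sym_le a s : -1 < a -> 0 < s ->
  (\int[mu]_(x in `](- s)%R, s[) ((s - x) `^ a + (s + x) `^ a)%:E <= (2 * ((2 * s) `^ (a +
    1) / (a + 1)))%:E)%E.
Proof.
move=> a1 s0.
pose k : R -> \bar R := (fun x => ((s - x) `^ a + (s + x) `^ a)%:E) \_ `](- s)%R, s[.
have k0 x : (0 <= k x)%E.
  by rewrite /k patchE; case: ifP => // _; rewrite lee_fin addr_ge0 // powR_ge0.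
have mk : measurable_fun setT (k : measurableTypeR R -> \bar R).
  apply/(measurable_restrictT _ (measurable_itv _)); apply/measurable_EFinP;
    apply: measurable_funTS.
  apply: measurable_funD; apply: (measurableT_comp (measurable_powR a)).
    by apply: measurable_funB.
  by apply: measurable_funD.
pose D : set (measurableTypeR R) := `]0, (2 * s)]%classic.
pose g : R -> \bar R := (fun x => (x `^ a)%:E) \_ D.
have g0 x : (0 <= g x)%E by rewrite /g patchE; case: ifP => // _; rewrite lee_fin powR_ge0.
have mg : measurable_fun setT (g : measurableTypeR R -> \bar R).
  by apply/(measurable_restrictT _ (measurable_itv _)); exact: measurable_powR_itv.
have mgs : measurable_fun setT (fun x : measurableTypeR R => g (x + s)).
  by apply: measurableT_comp => //; exact: measurable_funD.
have mgo : measurable_fun setT (fun x : measurableTypeR R => g (- x + s)).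
  by apply: (measurableT_comp mg); apply: measurable_funD => //; exact: measurable_funN.
have Ig : (\int[mu]_x g x <= ((2 * s) `^ (a + 1) / (a + 1))%:E)%E.
  by rewrite -integral_mkcond; apply: integral_powR_le => //; rewrite mulr_gt0.
have E1 : (\int[mu]_x g (x + s)%R = \int[mu]_x g x)%E by apply: ge0_integral_shift.
have E2 : (\int[mu]_x g (- x + s)%R = \int[mu]_x g x)%E.
  by rewrite (@ge0_integral_opp _ (fun x => g (x + s))).
have gE y : 0 < y <= 2 * s -> g y = (y `^ a)%:E.
  move=> hy; have yD : y \in D by rewrite inE /D /= in_itv.
  by rewrite /g patchE yD.
rewrite integral_mkcond -/k.
have kg x : (k x <= g (- x + s)%R + g (x + s)%R)%E.
  move: gE g0; clear -s0; clearbody g => gE g0.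
  rewrite /k patchE; case: ifPn => [|_]; last exact: adde_ge0 (g0 _) (g0 _).
  rewrite inE /= in_itv /= => /andP[x1 x2].
  by rewrite !gE ?EFinD 1?[- x + s]addrC 1?[x + s]addrC //; lra.
clearbody k g.
apply: (@le_trans _ _ (\int[mu]_x (g (- x + s)%R + g (x + s)%R))%E).
  apply: (@ge0_le_integral _ (measurableTypeR R) R mu setT measurableT k _ (fun x _ =>
    k0 x) mk) => [|x _].
    by apply: emeasurable_funD.
  exact: kg.
rewrite (@ge0_integralD _ (measurableTypeR R) R mu setT measurableT _ _ (fun x _ =>
  g0 _) mgo (fun x _ => g0 _) mgs) E1 E2.
by rewrite mulr2n mulrDl mul1r EFinD leeD.
Qed.

Definition disc : set RR := [set p | normc (p.1 +i* p.2) < 1].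

Lemma sqr_normc_disc (p : R * R) : normc (p.1 +i* p.2) ^+ 2 = p.1 ^+ 2 + p.2 ^+ 2.
Proof. by rewrite sqr_normcE. Qed.

Lemma in_disc (p : RR) : disc p <-> p.1 ^+ 2 + p.2 ^+ 2 < 1.
Proof.
rewrite -sqr_normc_disc /disc /=; have := normc_ge0 (p.1 +i* p.2).
by set r := normc _ => r0; split; nra.
Qed.

Lemma open2_disc : open2 disc.
Proof.
move=> p pd; pose e : R := (1 - normc (p.1 +i* p.2)) / 2.
have pd' : normc (p.1 +i* p.2) < 1 := pd.
have e0 : 0 < e by rewrite /e; lra.
exists e => // q q1 q2; rewrite /disc /=.
have h : normc ((q.1 +i* q.2) - (p.1 +i* p.2)) <= `|q.1 - p.1| +
  `|q.2 - p.2| by exact: ler_normc_ReIm.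
have := ler_normcD ((q.1 +i* q.2) - (p.1 +i* p.2)) (p.1 +i* p.2); rewrite subrK.
by move: q1 q2; rewrite /e; lra.
Qed.

Lemma measurable_disc : measurable disc.
Proof. exact: open2_measurable open2_disc. Qed.

Lemma measurable_disc_powR b :
  measurable_fun disc (fun p : RR => ((1 - normc (p.1 +i* p.2) ^+ 2) `^ b)%:E).
Proof.
apply/measurable_EFinP; apply: measurable_funTS; apply: (measurableT_comp (measurable_powR b)).
rewrite (_ : (fun p => _) = (fun p : RR => 1 - (p.1 ^+ 2 + p.2 ^+ 2))).
  by apply: measurable_funB => //; apply: measurable_funD; apply: measurable_funX.
by apply/funext => p; rewrite sqr_normc_disc.
Qed.

(** Separates the singularities of two factors: the one that is at least [m] is replaced by [m],
    which does not decrease a power with exponent [c <= 0]. *)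
Lemma powR_mul_le_sum a b m c : c <= 0 -> 0 < m -> 0 < a -> 0 < b -> m <= Num.max a b ->
  (a * b) `^ c <= m `^ c * (a `^ c + b `^ c).
Proof.
move=> c0 m0 a0 b0; rewrite le_max => mab.
have anti u v : 0 < u -> u <= v -> v `^ c <= u `^ c.
  move=> u0 uv; have v0 : 0 < v := lt_le_trans u0 uv.
  rewrite -[c]opprK !(powRN _ (- c)) lef_pV2 ?posrE ?powR_gt0 //.
  by apply: ge0_ler_powR; rewrite ?nnegrE ?oppr_ge0 //; exact: ltW.
rewrite (powRM _ (ltW a0) (ltW b0)) mulrDr; case/orP: mab => h.
  by rewrite ler_wpDl ?mulr_ge0 ?powR_ge0 // ler_wpM2r ?powR_ge0 // anti.
by rewrite mulrC ler_wpDr ?mulr_ge0 ?powR_ge0 // ler_wpM2r ?powR_ge0 // anti.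
Qed.

(** Horizontal slices: with [s^2 = 1 - y^2] the weight is [((s - x) (s + x))^b], and a slice
    integrates to at most [C s^(2 b + 1)]. As [2 b + 1 > -1] and [s <= 1], this is at most [C / s],
    which is integrable in [y]. *)
Lemma disc_weight_lty b : -1 < b -> b < 0 ->
  (\int[(mu \x mu)%E]_(p in disc) ((1 - normc (p.1 +i* p.2) ^+ 2) `^ b)%:E < +oo)%E.
Proof.
move=> b1 b0.
pose F : RR -> \bar R := (fun p : RR => ((1 - normc (p.1 +i* p.2) ^+ 2) `^ b)%:E) \_ disc.
have F0 p : (0 <= F p)%E by rewrite /F patchE; case: ifP => // _; rewrite lee_fin powR_ge0.
have mF : measurable_fun setT F.
  by apply/(measurable_restrictT _ measurable_disc); exact: measurable_disc_powR.
pose C : R := 2 * (2 `^ (b + 1) / (b + 1)); have b10 : 0 < b + 1 by lra.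
have C0 : 0 <= C by rewrite mulr_ge0 // divr_ge0 ?powR_ge0 // ltW.
rewrite integral_mkcond -/F fubini_tonelli2 //.
pose J : set (measurableTypeR R) := `](-1)%R, 1[%classic.
pose G y : R := C * ((1 - y) `^ (- 2^-1) + (1 + y) `^ (- 2^-1)).
apply: (@le_lt_trans _ _ (\int[mu]_(y in J) (G y)%:E)%E).
  rewrite [leRHS]integral_mkcond; apply: ge0_le_integral => //.
  - by move=> y _; apply: integral_ge0.
  - exact: measurable_fun_fubini_tonelli_G.
  - apply/(measurable_restrictT _ (measurable_itv _)); apply/measurable_EFinP;
      apply: measurable_funTS.
    apply: measurable_funM => //; apply: measurable_funD; apply: (measurableT_comp
      (measurable_powR _)).
      by apply: measurable_funB.
    by apply: measurable_funD.
  move=> y _; rewrite patchE /fubini_G; case: ifPn => [|yJ]; last first.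
    rewrite integral0_eq // => x _; rewrite /F patchE ifF //; apply: contraNF yJ.
    rewrite !inE => /in_disc /= h; rewrite /J /= in_itv /=; apply/andP; split; nra.
  rewrite inE /J /= in_itv /= => /andP[y1 y2].
  have y0 : 0 < 1 - y ^+ 2 by nra.
  pose s : R := Num.sqrt (1 - y ^+ 2).
  have s0 : 0 < s by rewrite sqrtr_gt0.
  have s2 : s ^+ 2 = 1 - y ^+ 2 by rewrite sqr_sqrtr // ltW.
  have s1 : s <= 1 by nra.
  apply: (@le_trans _ _ (\int[mu]_(x in `](- s)%R, s[) ((s `^ b)%:E * ((s - x) `^ b + (s +
    x) `^ b)%:E))%E).
    rewrite [leRHS]integral_mkcond; apply: ge0_le_integral => //.
    - exact: measurableT_comp.
    - apply/(measurable_restrictT _ (measurable_itv _)); apply/measurable_EFinP;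
        apply: measurable_funTS.
      apply: measurable_funM => //; apply: measurable_funD; apply: (measurableT_comp
        (measurable_powR _)).
        by apply: measurable_funB.
      by apply: measurable_funD.
    move=> x _; rewrite /F !patchE; case: ifPn => [|_]; last first.
      by case: ifP => // _; rewrite lee_fin mulr_ge0 ?powR_ge0 // addr_ge0 ?powR_ge0.
    rewrite inE => /in_disc /= h; have xs : x ^+ 2 < s ^+ 2 by rewrite s2; lra.
    have [x1 x2] : - s < x /\ x < s by split; nra.
    rewrite ifT; last by rewrite inE /= in_itv /= x1 x2.
    have -> : 1 - normc (x +i* y) ^+ 2 = (s - x) * (s + x).
      by rewrite (sqr_normc_disc (x, y)) /=; move: s2; nra.
    rewrite lee_fin; apply: powR_mul_le_sum; rewrite ?subr_gt0 //; [exact: ltW|lra|].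
    by rewrite le_max; have [?|?] := leP x 0; apply/orP; [left|right]; lra.
  rewrite ge0_integralZl //; last 3 first.
  - apply/measurable_EFinP; apply: measurable_funTS.
    apply: measurable_funD; apply: (measurableT_comp (measurable_powR _)).
      by apply: measurable_funB.
    by apply: measurable_funD.
  - by move=> x _; rewrite lee_fin addr_ge0 ?powR_ge0.
  - by rewrite lee_fin powR_ge0.
  apply: (@le_trans _ _ ((s `^ b)%:E * (2 * ((2 * s) `^ (b + 1) / (b + 1)))%:E)%E).
    by apply: lee_wpmul2l; [rewrite lee_fin powR_ge0|exact: integral_powR_sym_le].
  rewrite -EFinM lee_fin.
  have -> : s `^ b * (2 * ((2 * s) `^ (b + 1) / (b + 1))) = C * s `^ (b + (b + 1)).
    rewrite (powRM _ (ler0n R 2) (ltW s0)) (@powRD _ s b (b + 1)) ?(gt_eqF s0) ?implybT // /C.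
    by ring.
  rewrite /G ler_wpM2l //.
  apply: (@le_trans _ _ (s `^ (-1))).
    by apply: ger_powR; [rewrite s0|lra].
  have -> : s `^ (-1) = ((1 - y) * (1 + y)) `^ (- 2^-1).
    rewrite powR_inv1 ?ltW // powRN powR12_sqrt; last by nra.
    by congr (Num.sqrt _)^-1; ring.
  have := @powR_mul_le_sum (1 - y) (1 + y) 1 (- 2^-1); rewrite powR1 mul1r; apply;
    rewrite ?subr_gt0 // ?oppr_le0 ?invr_ge0 //; first lra.
  by rewrite le_max; have [?|?] := leP y 0; apply/orP; [left|right]; lra.
rewrite (_ : (fun y => _) = (fun y => C%:E * ((1 - y) `^ (- 2^-1) + (1 + y) `^ (- 2^-1))%:E)%E);
  last first.
  by apply/funext => y; rewrite /G EFinM.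
rewrite ge0_integralZl //; last 3 first.
- exact: measurable_itv.
- apply/measurable_EFinP; apply: measurable_funTS.
  apply: measurable_funD; apply: (measurableT_comp (measurable_powR _)).
    by apply: measurable_funB.
  by apply: measurable_funD.
- by move=> x _; rewrite lee_fin addr_ge0 ?powR_ge0.
apply: lte_mul_pinfty => //; apply: le_lt_trans (@integral_powR_sym_le (- 2^-1) 1 _ _) _;
  rewrite ?ltry //; lra.
Qed.

End disc_weight.

(** * Weighted integral of one logarithmic layer *)

Section layer.
Variable R : realType.
Local Notation mu := (@lebesgue_measure R).
Local Notation RR := (measurableTypeR R * measurableTypeR R)%type.
Local Notation tpi := (pi *+ 2 : R).
Implicit Types (f : R[i] -> R[i]) (a b c s t x y rho r : R) (z w e : R[i]).

Lemma measurable_disc_normc f : (forall z, normc z < 1 -> ct f z) ->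
  measurable_fun (@disc R) (fun p : RR => normc (f (p.1 +i* p.2))).
Proof.
move=> cf; apply: open2_measurable_fun; first exact: open2_disc.
move=> p pd d d0; have [e e0 he] := cf (p.1 +i* p.2) pd d d0.
have e20 : 0 < e / 2 by rewrite divr_gt0.
exists (e / 2) => // q q1 q2; apply: le_lt_trans (ler_dist_normc _ _) (he _ _).
have h : normc ((q.1 +i* q.2) - (p.1 +i* p.2)) <= `|q.1 - p.1| +
  `|q.2 - p.2| by exact: ler_normc_ReIm.
by apply: le_lt_trans h _; lra.
Qed.

Lemma rot_cis t (p : R * R) :
  (rot (cos t) (sin t) p).1 +i* (rot (cos t) (sin t) p).2 = (p.1 +i* p.2) * cis t.
Proof. by apply/eqP; rewrite eq_complex /=; apply/andP; split; apply/eqP; rewrite /=; ring. Qed.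

(** [log_mean_bound] for [w |-> f (e w)], with [e] the direction of [z]; then [ln (|z| / rho) <= (1
    - rho) / rho <= 2 (1 - rho)], as [rho >= 1/2]. *)
Lemma log_excess_mean f rho s z :
  (forall z, normc z < 1 -> exists l, cder f z l) ->
  (forall z w, normc z < 1 -> normc w < 1 -> f z = f w -> z = w) -> f 0 = 0 ->
  2^-1 <= rho -> 0 < s -> (forall z, normc z <= rho -> normc (f z) < s) ->
  rho < normc z < 1 ->
  itg 0 tpi (fun t => ln (Num.max (normc (f (z * cis t))) s) - ln s) <= tpi * (2 * (1 - rho)).
Proof.
move=> fh fi f00 rho2 s0 fs /andP[rz z1].
have rho0 : 0 < rho by lra.
have z0 : 0 < normc z by exact: lt_trans rz.
pose e : R[i] := z / (normc z)%:C.
have e1 : normc e = 1.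
  by rewrite /e Normc.normcM Normc.normcV normcR ger0_norm ?normc_ge0 // divff // gt_eqF.
have en w : normc (e * w) = normc w by rewrite Normc.normcM e1 mul1r.
have e0 : e != 0 by rewrite -normc_eq0 e1 oner_eq0.
have ze t : z * cis t = e * circ 0 (normc z) t.
  rewrite /e /circ add0r mulrA divfK //.
  by apply/eqP => /(congr1 (@complex.Re R)) /= E; move: z0; rewrite E ltxx.
have h := @log_mean_bound R (fun w => f (e * w)) rho (normc z) s.
have {}h : itg 0 tpi (fun t => ln (Num.max (normc (f (e * circ 0 (normc z) t))) s)) <= tpi *
  (ln s + ln (normc z / rho)).
  apply: h => //.
  - move=> w w1; have [|l hl] := fh (e * w); first by rewrite en.
    exists (l * (0 * w + e * 1)); apply: (@cder_comp _ f (fun w => e * w)) => //.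
    by apply: cderM; [exact: cder_cst|exact: cder_id].
  - by move=> w w' w1 w1' /fi E; apply: (mulfI e0); apply: E; rewrite en.
  - by rewrite mulr0.
  - by move=> w; rewrite -en; exact: fs.
have cm t : {for t, continuous (fun t => ln (Num.max (normc (f (z * cis t))) s))}.
  apply: (@continuous_comp _ _ _ (fun t => Num.max (normc (f (z * cis t))) s) (@ln R)).
    apply: continuous_max; last exact: cst_continuous.
    rewrite (_ : (fun t => _) = (fun t => normc (f (e * circ 0 (normc z) t))));
      last by apply/funext => t'; rewrite ze.
    apply: rct_normc; apply: rct_comp.
      have [|l /cder_ct] := fh (e * circ 0 (normc z) t); last exact.
      by have := normc_circ 0 (normc z) t; rewrite subr0 en ger0_norm ?normc_ge0 // => ->.
    apply: (@rct_comp _ (fun w => e * w)); last exact: rct_circ.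
    by apply: ctM; [exact: ct_cst|exact: ct_id].
  by apply: continuous_ln; rewrite lt_max s0 orbT.
rewrite (_ : (fun t => _) = (fun t => 1 * ln (Num.max (normc (f (z * cis t))) s) + - ln s));
  last first.
  by apply/funext => t; rewrite mul1r.
have tp := @tpi_gt0 R.
rewrite (itg_affine _ (ltW tp) cm) mul1r.
have -> : (fun t => ln (Num.max (normc (f (z * cis t))) s)) = (fun t => ln (Num.max (normc (f (e *
  circ 0 (normc z) t))) s)).
  by apply/funext => t; rewrite ze.
have lr : ln (normc z / rho) <= 2 * (1 - rho).
  have q0 : 0 < normc z / rho by rewrite divr_gt0.
  have -> : normc z / rho = 1 + (normc z / rho - 1) by rewrite addrC subrK.
  apply: le_trans (le_ln1Dx _) _; first by lra.
  by rewrite lerBlDr ler_pdivrMr //; nra.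
apply: (@le_trans _ _ (tpi * (ln s + ln (normc z / rho)) + - ln s * tpi)); first by rewrite lerD2r.
by rewrite mulrDr mulNr [ln s * tpi]mulrC addrAC subrr add0r ler_pM2l.
Qed.

(** The excess vanishes for [|z| <= rho]. Beyond, [1 - |z|^2 <= 2 (1 - rho)], so the power [a - b]
    of the weight is traded for a constant, and the circle mean contributes one more factor
    [2 (1 - rho)]. *)
Lemma layer_bound f rho s a b :
  (forall z, normc z < 1 -> exists l, cder f z l) ->
  (forall z w, normc z < 1 -> normc w < 1 -> f z = f w -> z = w) -> f 0 = 0 ->
  2^-1 <= rho -> rho < 1 -> 0 < s -> (forall z, normc z <= rho -> normc (f z) < s) -> b <= a ->
  (\int[(mu \x mu)%E]_(p in (@disc R))
     ((ln (Num.max (normc (f (p.1 +i* p.2))) s) - ln s) * (1 - normc (p.1 +i* p.2) ^+ 2) `^ a)%:E <=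
   ((2 * (1 - rho)) `^ (a - b + 1))%:E *
   \int[(mu \x mu)%E]_(p in (@disc R)) ((1 - normc (p.1 +i* p.2) ^+ 2) `^ b)%:E)%E.
Proof.
move=> fh fi f00 rho2 rho1 s0 fs ba; have tp := @tpi_gt0 R.
pose L z : R := ln (Num.max (normc (f z)) s) - ln s.
have L0 z : 0 <= L z by rewrite subr_ge0 ler_ln ?posrE // ?lt_max ?s0 ?orbT // le_max lexx orbT.
pose F : RR -> \bar R := (fun p : RR => (L (p.1 +i* p.2) * (1 - normc (p.1 +i* p.2) ^+
  2) `^ a)%:E) \_ (@disc R).
pose k : R := (2 * (1 - rho)) `^ (a - b + 1).
pose G : RR -> \bar R := (fun p : RR => ((tpi * k)%:E * ((1 - normc (p.1 +i* p.2) ^+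
  2) `^ b)%:E)%E) \_ (@disc R).
have k0 : 0 <= k by exact: powR_ge0.
have F0 p : (0 <= F p)%E by rewrite /F patchE; case: ifP => // _;
  rewrite lee_fin mulr_ge0 ?powR_ge0.
have G0 p : (0 <= G p)%E.
  by rewrite /G patchE; case: ifP => // _; rewrite -EFinM lee_fin !mulr_ge0 ?powR_ge0 // ltW.
have mL : measurable_fun (@disc R) (fun p : RR => L (p.1 +i* p.2)).
  apply: measurable_funB => //; apply: (measurableT_comp (f := @ln R)); first exact: measurable_ln.
  apply: measurable_maxr => //; apply: measurable_disc_normc => z /fh[l]; exact: cder_ct.
have mF : measurable_fun setT F.
  apply/(measurable_restrictT _ (@measurable_disc R)).
  apply/measurable_EFinP; apply: measurable_funM => //.
  by have /measurable_EFinP := @measurable_disc_powR R a.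
have mG : measurable_fun setT G.
  apply/(measurable_restrictT _ (@measurable_disc R)).
  by apply: measurable_funeM; exact: measurable_disc_powR.
have key : (tpi%:E * \int[(mu \x mu)%E]_p F p <= \int[(mu \x mu)%E]_p G p)%E.
  apply: rotation_average => //; first exact: ltW.
  move=> p; pose z := p.1 +i* p.2.
  have Frot t : F (rot (cos t) (sin t) p) = if p \in (@disc R) then (L (z * cis t) *
    (1 - normc z ^+ 2) `^ a)%:E else 0%E.
    rewrite /F patchE rot_cis -/z Normc.normcM normc_cis mulr1.
    have -> // : (rot (cos t) (sin t) p \in (@disc R)) = (p \in (@disc R)).
    by apply/idP/idP; rewrite !inE /disc /= rot_cis -/z Normc.normcM normc_cis mulr1.
  have [pd|pd] := boolP (p \in (@disc R)); last first.
    by rewrite integral0_eq // => t _; rewrite Frot (negPf pd).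
  have z1 : normc z < 1 by move: pd; rewrite inE.
  have [rz|rz] := leP (normc z) rho.
    rewrite integral0_eq // => t _; rewrite Frot pd /L max_r; first by rewrite subrr mul0r.
    by apply/ltW/fs; rewrite Normc.normcM normc_cis mulr1.
  have w0 : 0 < 1 - normc z ^+ 2 by have := normc_ge0 z; nra.
  have cL t : {for t, continuous (fun t => L (z * cis t))}.
    apply: continuousB; last exact: cst_continuous.
    apply: (@continuous_comp _ _ _ (fun t => Num.max (normc (f (z * cis t))) s) (@ln R)).
      apply: continuous_max; last exact: cst_continuous.
      apply: rct_normc; apply: rct_comp.
        have [|l /cder_ct] := fh (z * cis t); last exact.
        by rewrite Normc.normcM normc_cis mulr1.
      have -> : (fun t => z * cis t) = (fun t => z * circ 0 1 t).
        by apply/funext => t'; rewrite /circ add0r mul1r.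
      apply: (@rct_comp _ (fun w => z * w)); last exact: rct_circ.
      by apply: ctM; [exact: ct_cst|exact: ct_id].
    by apply: continuous_ln; rewrite lt_max s0 orbT.
  have -> : (\int[mu]_(t in `[0%R, tpi]) F (rot (cos t) (sin t) p) =
    (itg 0 tpi (fun t => (1 - normc z ^+ 2) `^ a * L (z * cis t)))%:E)%E.
    rewrite -itg_EFin; first by apply: eq_integral => t _; rewrite Frot pd mulrC.
    by move=> t _; apply: continuousM; [exact: cst_continuous|exact: cL].
  rewrite itgZ; last by move=> t _; exact: cL.
  rewrite /G patchE pd -EFinM lee_fin -/z.
  have hm : itg 0 tpi (fun t => L (z * cis t)) <= tpi * (2 * (1 - rho)).
    by apply: log_excess_mean => //; rewrite rz.
  have d0 : 0 < 2 * (1 - rho) by lra.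
  have wa : (1 - normc z ^+ 2) `^ a <= (2 * (1 - rho)) `^ (a - b) * (1 - normc z ^+ 2) `^ b.
    have -> : (1 - normc z ^+ 2) `^ a = (1 - normc z ^+ 2) `^ (a - b) * (1 - normc z ^+ 2) `^ b.
      by rewrite -powRD ?(gt_eqF w0) ?implybT // subrK.
    apply: ler_wpM2r; first exact: powR_ge0.
    apply: ge0_ler_powR; rewrite ?nnegrE ?(ltW w0) ?(ltW d0) ?(subr_ge0 b a) //.
    by have := normc_ge0 z; nra.
  apply: (@le_trans _ _ ((2 * (1 - rho)) `^ (a - b) * (1 - normc z ^+ 2) `^ b * (tpi * (2 *
    (1 - rho))))).
    apply: ler_pM => //; first exact: powR_ge0.
    apply: (@le_trans _ _ (itg 0 tpi (fun=> 0))); first by rewrite (itg_cst _ (ltW tp)) mul0r.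
    by apply: le_itg => // t _; exact: cst_continuous.
  rewrite /k (@powRD _ _ (a - b) 1) ?(gt_eqF d0) ?implybT // (powRr1 (ltW d0)).
  by rewrite le_eqVlt; apply/orP; left; apply/eqP; ring.
rewrite integral_mkcond -/F -(@lee_pmul2l _ tpi%:E) // ?lte_fin //.
apply: le_trans key _.
rewrite /G -integral_mkcond ge0_integralZl //; last 4 first.
- exact: measurable_disc.
- exact: measurable_disc_powR.
- by move=> p _; rewrite lee_fin powR_ge0.
- by rewrite lee_fin mulr_ge0 // ltW.
by rewrite muleA EFinM.
Qed.

End layer.

(** * Summation over the layers *)

Section bergman_bound.
Variable R : realType.
Local Notation mu := (@lebesgue_measure R).
Local Notation RR := (measurableTypeR R * measurableTypeR R)%type.
Implicit Types (f : R[i] -> R[i]) (a b c s t x y u v rho r : R) (z w e : R[i]).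

Lemma integral_lty_of_layers d (X : measurableType d) (m : {measure set X -> \bar R}) (D : set X)
  (h : X -> \bar R) (u : nat -> X -> \bar R) (K q : R) : measurable D ->
  measurable_fun D h -> (forall p, D p -> 0 <= h p)%E ->
  (forall n, measurable_fun D (u n)) -> (forall n p, D p -> 0 <= u n p)%E ->
  (forall p, D p -> exists n, h p <= u n p)%E ->
  (forall n, \int[m]_(p in D) u n p <= (K * q ^+ n)%:E)%E -> 0 <= K -> 0 <= q < 1 ->
  (\int[m]_(p in D) h p < +oo)%E.
Proof.
move=> mD mh h0 mU u0 hu uK K0 /andP[q0 q1].
apply: (@le_lt_trans _ _ (\int[m]_(p in D) \sum_(n <oo) u n p)%E).
  apply: ge0_le_integral => //.
  - apply: (@ge0_emeasurable_sum _ _ _ D u xpredT) => [k p Dp _|k _]; [exact: u0|exact: mU].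
  move=> x Dx; have [n hn] := hu x Dx; apply: le_trans hn _.
  apply: le_trans (@nneseries_lim_ge _ (u ^~ x) xpredT 0%N n.+1 _); last by move=> k _ _; exact: u0.
  rewrite big_nat_recr //= leeDr //; apply: sume_ge0 => k _; exact: u0.
rewrite integral_nneseries //; apply: (@le_lt_trans _ _ (K / (1 - q))%:E); last exact: ltry.
apply: lime_le.
  by apply: is_cvg_nneseries => n _ _; apply: integral_ge0 => x; exact: u0.
apply: nearW => n; apply: (@le_trans _ _ (\sum_(0 <= k < n) (K * q ^+ k)%:E)%E).
  by apply: lee_sum => k _; exact: uK.
rewrite sumEFin lee_fin -mulr_sumr ler_wpM2l // big_mkord.
have q1' : 0 < 1 - q by rewrite subr_gt0.
have := subrX1 q n => E; rewrite -(ler_pM2l q1') divff ?gt_eqF //.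
have -> : (1 - q) * \sum_(i < n) q ^+ i = 1 - q ^+ n by rewrite -opprB mulNr -E opprB.
by rewrite gerBl exprn_ge0.
Qed.

Lemma powR_expr a c n : 0 <= a -> (a ^+ n) `^ c = (a `^ c) ^+ n.
Proof. by move=> a0; rewrite -(powR_mulrn n a0) -(powR_mulrn n (powR_ge0 a c)) powRAC. Qed.

Lemma powR2_lt1 c : c < 0 -> (2 : R) `^ c < 1.
Proof.
move=> c0; rewrite /powR pnatr_eq0 /= expR_lt1 nmulr_rlt0 //.
by rewrite ln_gt0 // ltr1n.
Qed.

(** If [m] is least with [v < 2 s0 4^m], then for [n = m - 1] one has [v >= 2 s0 4^n], so the excess
    at level [n] is at least [ln 2], while [u <= 9 s0 4^n]. The case [v <= 2 s0] gives the constant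
    bound. *)
Lemma powR_layers c s0 u v : 0 < c -> 0 < s0 -> 0 <= u -> u <= v + s0 ->
  u `^ c <= (3 * s0) `^ c \/ exists n, u `^ c <=
    (16 * s0) `^ c / ln 2 * ((4 `^ c) ^+ n * (ln (Num.max v (s0 * 4 ^+ n)) - ln (s0 * 4 ^+ n))).
Proof.
move=> c0 s00 u0 uv.
have mono x y : 0 <= x -> x <= y -> x `^ c <= y `^ c.
  by move=> x0 xy; apply: ge0_ler_powR; rewrite ?nnegrE ?(ltW c0) // (le_trans x0).
have [v2|v2] := leP v (2 * s0); first by left; apply: mono => //; lra.
have ex : exists n, v < 2 * s0 * 4 ^+ n.
  pose n := (Num.truncn (v / (2 * s0))).+1; exists n.
  rewrite mulrC -ltr_pdivrMr; last by rewrite mulr_gt0.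
  apply: lt_le_trans (truncnS_gt _) _.
  by rewrite -natrX ler_nat -/n; exact: ltnW (ltn_expl _ _).
right; have [m hm mmin] := ex_minnP ex.
case: m hm mmin => [|n] hm mmin; first by move: hm; rewrite expr0; lra.
exists n; have hn : 2 * s0 * 4 ^+ n <= v.
  by rewrite leNgt; apply/negP => /mmin; rewrite ltnn.
have x0 : 0 < s0 * 4 ^+ n by rewrite mulr_gt0 // exprn_gt0.
have l2 : 0 < ln (2 : R) by rewrite ln_gt0 // ltr1n.
rewrite max_l; last by lra.
have lv : ln 2 <= ln v - ln (s0 * 4 ^+ n).
  by rewrite -ln_div ?posrE //; [rewrite ler_ln ?posrE ?divr_gt0 // ?ler_pdivlMr //|]; lra.
apply: (@le_trans _ _ ((16 * s0 * 4 ^+ n) `^ c)).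
  by apply: mono => //; move: hm; rewrite exprS; nra.
rewrite powRM ?mulr_ge0 ?exprn_ge0 ?(ltW s00) // powR_expr //.
rewrite -[leRHS]mulrA ler_wpM2l ?powR_ge0 // mulrCA ler_peMr ?exprn_ge0 ?powR_ge0 //.
by rewrite mulrC ler_pdivlMr ?mul1r.
Qed.

Lemma bergman_bound f c a : (forall z, normc z < 1 -> exists l, cder f z l) ->
  (forall z w, normc z < 1 -> normc w < 1 -> f z = f w -> z = w) ->
  0 < c -> -1 < a -> 2 * c < a + 2 ->
  (\int[(mu \x mu)%E]_(p in @disc R)
     (normc (f (p.1 +i* p.2)) `^ c * (1 - normc (p.1 +i* p.2) ^+ 2) `^ a)%:E < +oo)%E.
Proof.
move=> fh fi c0 a1 ca.
have [C0 C00 hC0] := growth fh fi.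
pose f0 z : R[i] := f z - f 0; pose C : R := C0 + normc (f 0).
have C_gt0 : 0 < C by rewrite ltr_wpDr ?normc_ge0.
(* The auxiliary exponent [b] is the midpoint of [-1] and [m]: negative and above [-1] for
   [disc_weight_lty], at most [a] for [layer_bound], and below [a + 1 - 2 c] so that [q < 1]. There
   is room because [-1 < a] and [2 c < a + 2]. *)
pose m : R := Num.min 0 (Num.min a (a + 1 - 2 * c)).
have [m1 m2 m3 m4] : [/\ -1 < m, m <= 0, m <= a & m <= a + 1 - 2 * c].
  split; last 3 first.
  - by rewrite /m ge_min lexx.
  - by rewrite /m !ge_min lexx orbT.
  - by rewrite /m !ge_min lexx !orbT.
  by rewrite /m !lt_min; apply/and3P; split; lra.
pose b : R := (m - 1) / 2.
have [b1 b0 ba bc] : [/\ -1 < b, b < 0, b <= a & b < a + 1 - 2 * c] by rewrite /b; split; lra.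
pose Ib : \bar R := (\int[(mu \x mu)%E]_(p in @disc R) ((1 - normc (p.1 +i* p.2) ^+ 2) `^ b)%:E)%E.
have Ib0 : (0 <= Ib)%E by apply: integral_ge0 => p _; rewrite lee_fin powR_ge0.
have [I IE] : exists I : R, Ib = I%:E.
  exists (fine Ib); rewrite fineK // ge0_fin_numE //; exact: disc_weight_lty.
have I0 : 0 <= I by rewrite -lee_fin -IE.
(* For [1 - |z| >= h n / 2] the growth estimate gives [4 C0 4^n]; the factor [8] makes the bound
   strict. *)
pose s0 : R := 8 * C; have s00 : 0 < s0 by rewrite mulr_gt0.
pose s n : R := s0 * 4 ^+ n; have sn0 n : 0 < s n by rewrite mulr_gt0 // exprn_gt0.
pose h n : R := 2^-1 ^+ n; have h0 n : 0 < h n by rewrite exprn_gt0 // invr_gt0.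
have h1 n : h n <= 1 by rewrite exprn_ile1 // ?invr_ge0 // invf_le1 // ler1n.
have h4 n : h n ^+ 2 * 4 ^+ n = 1.
  rewrite /h -exprM mulnC exprM -exprMn (_ : 2^-1 ^+ 2 * 4 = 1 :> R) ?expr1n //.
  by rewrite expr2; field.
have f0h z : normc z < 1 -> exists l, cder f0 z l.
  by move=> /fh[l hl]; eexists; apply: cderB hl _; exact: cder_cst.
have f0i z w : normc z < 1 -> normc w < 1 -> f0 z = f0 w -> z = w.
  by move=> z1 w1 /addIr; exact: fi.
have f00 : f0 0 = 0 by rewrite /f0 subrr.
have f0s n z : normc z <= 1 - h n / 2 -> normc (f0 z) < s n.
  move=> zr; have hn := h0 n; have z1 : normc z < 1 by lra.
  apply: le_lt_trans (hC0 _ z1) _; rewrite ltr_pdivrMr; last by rewrite exprn_gt0 // subr_gt0.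
  have q : (h n / 2) ^+ 2 <= (1 - normc z) ^+ 2 by rewrite lerXn2r ?nnegrE; lra.
  have C0C : C0 <= C by rewrite /C lerDl normc_ge0.
  apply: (@lt_le_trans _ _ (s n * (h n / 2) ^+ 2)); last by rewrite ler_wpM2l // ltW.
  have -> : s n * (h n / 2) ^+ 2 = 2 * C * (h n ^+ 2 * 4 ^+ n) by rewrite /s /s0; field.
  by rewrite h4; lra.
pose W p : R := (1 - normc p ^+ 2) `^ a.
pose L n z : R := ln (Num.max (normc (f0 z)) (s n)) - ln (s n).
have L0 n z : 0 <= L n z by rewrite subr_ge0 ler_ln ?posrE // ?lt_max ?sn0 ?orbT // le_max lexx
  orbT.
pose c1 : R := (3 * s0) `^ c; pose c2 : R := (16 * s0) `^ c / ln 2.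
have l2 : 0 < ln (2 : R) by rewrite ln_gt0 // ltr1n.
have c10 : 0 <= c1 by exact: powR_ge0.
have c20 : 0 <= c2 by rewrite divr_ge0 ?powR_ge0 // ltW.
(* Index [0] covers the points where [|f|] is bounded by a constant; layer [k] moves to index
   [k.+1], whence the quotient [c2 / q]. *)
pose u n (p : RR) : \bar R := if n is k.+1
  then ((c2 * (4 `^ c) ^+ k)%:E * (L k (p.1 +i* p.2) * (1 - normc (p.1 +i* p.2) ^+ 2) `^ a)%:E)%E
  else (c1%:E * ((1 - normc (p.1 +i* p.2) ^+ 2) `^ b)%:E)%E.
(* Ratio of consecutive layers: [4^c] from the level and [2^-(a - b + 1)] from the halved width. *)
pose q : R := 4 `^ c * 2^-1 `^ (a - b + 1).
have q0 : 0 < q by rewrite mulr_gt0 ?powR_gt0 ?invr_gt0.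
have q1 : q < 1.
  rewrite /q -powR_inv1 // -(_ : 2 `^ 2%:R = 4); last by rewrite powR_mulrn // expr2; ring.
  rewrite -!powRrM -powRD ?pnatr_eq0 ?implybT //; apply: powR2_lt1; lra.
have mL n : measurable_fun (@disc R) (fun p : RR => L n (p.1 +i* p.2)).
  apply: measurable_funB => //; apply: (measurableT_comp (f := @ln R)); first exact: measurable_ln.
  apply: measurable_maxr => //; apply: measurable_disc_normc => z /f0h[l]; exact: cder_ct.
have mLW n : measurable_fun (@disc R) (fun p : RR => (L n (p.1 +i* p.2) * (1 - normc (p.1 +i*
  p.2) ^+ 2) `^ a)%:E).
  apply/measurable_EFinP; apply: measurable_funM => //.
  by have /measurable_EFinP := @measurable_disc_powR R a.
have LW0 n (p : RR) : (0 <= (L n (p.1 +i* p.2) * (1 - normc (p.1 +i* p.2) ^+ 2) `^ a)%:E)%E.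
  by rewrite lee_fin mulr_ge0 ?powR_ge0.
apply: (@integral_lty_of_layers _ _ _ _ _ u ((c1 + c2 / q) * I) q) => //.
- exact: measurable_disc.
- apply/measurable_EFinP; apply: measurable_funM; last first.
    by have /measurable_EFinP := @measurable_disc_powR R a.
  apply: (measurableT_comp (measurable_powR c)).
  apply: measurable_disc_normc => z /fh[l]; exact: cder_ct.
- by move=> p _; rewrite lee_fin mulr_ge0 ?powR_ge0.
- by case=> [|n]; apply: measurable_funeM => //; exact: measurable_disc_powR.
- case=> [|n] p _; apply: mule_ge0 => //; rewrite lee_fin ?powR_ge0 //.
  by rewrite mulr_ge0 // exprn_ge0 // powR_ge0.
- move=> p pd; pose z := p.1 +i* p.2; have z1 : normc z < 1 := pd.
  have fz : normc (f z) <= normc (f0 z) + s0.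
    have := ler_normcD (f0 z) (f 0); rewrite /f0 subrK /s0 => h'.
    apply: le_trans h' _; rewrite lerD2l; move: C00; rewrite /C; have := normc_ge0 (f 0); lra.
  have [hp|[n hn]] := powR_layers c0 s00 (normc_ge0 (f z)) fz.
    exists 0%N; rewrite /u -EFinM lee_fin -/z; apply: ler_pM => //; rewrite ?powR_ge0 //.
    have [w0 w1] : 0 < 1 - normc z ^+ 2 /\ 1 - normc z ^+ 2 <= 1.
      by have := normc_ge0 z; split; nra.
    by apply: ger_powR => //; rewrite w0.
  exists n.+1; rewrite /u -EFinM lee_fin -/z mulrA ler_wpM2r ?powR_ge0 //.
  by rewrite -mulrA.
- case=> [|n].
    rewrite /u ge0_integralZl //; last 3 first.
    + exact: measurable_disc.
    + exact: measurable_disc_powR.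
    + by move=> p _; rewrite lee_fin powR_ge0.
    rewrite -/Ib IE -EFinM lee_fin expr0 mulr1 ler_wpM2r // lerDl.
    by rewrite divr_ge0 // ltW.
  rewrite /u ge0_integralZl //; last 2 first.
  + exact: measurable_disc.
  + by rewrite lee_fin mulr_ge0 // exprn_ge0 // powR_ge0.
  have hn0 := h0 n; have hn1 := h1 n.
  have hl : (\int[(mu \x mu)%E]_(p in @disc R) (L n (p.1 +i* p.2) * (1 - normc (p.1 +i* p.2) ^+
    2) `^ a)%:E <=
      ((2 * (1 - (1 - h n / 2))) `^ (a - b + 1))%:E * Ib)%E.
    by apply: layer_bound => //; [lra|lra|exact: f0s].
  apply: le_trans (lee_wpmul2l _ hl) _.
    by rewrite lee_fin mulr_ge0 // exprn_ge0 // powR_ge0.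
  rewrite IE -!EFinM lee_fin.
  have -> : 2 * (1 - (1 - h n / 2)) = h n by field.
  rewrite /h powR_expr // ?invr_ge0 //.
  rewrite [leLHS]mulrA [leRHS]mulrAC ler_wpM2r //.
  have -> : c2 * (4 `^ c) ^+ n * (2^-1 `^ (a - b + 1)) ^+ n = c2 / q * q ^+ n.+1.
    rewrite -mulrA -exprMn -/q exprS; field; exact: lt0r_neq0.
  by rewrite mulrDl lerDr mulr_ge0 // exprn_ge0 // ltW.
- by rewrite mulr_ge0 // addr_ge0 // divr_ge0 // ltW.
- by rewrite q1 ltW.
Qed.

End bergman_bound.

(** * Sharpness *)

Section sharpness.
Variable R : realType.
Local Notation mu := (@lebesgue_measure R).
Local Notation RR := (measurableTypeR R * measurableTypeR R)%type.
Implicit Types (a c s t x y rho r h : R) (z w : R[i]).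

Definition sqr_pole z : R[i] := ((1 - z) ^+ 2)^-1.

Lemma sqr_pole_neq0 z : normc z < 1 -> 1 - z != 0.
Proof.
move=> z1; rewrite subr_eq0; apply: contraTneq z1 => <-.
by rewrite nc1 ltxx.
Qed.

Lemma cder_sqr_pole z : normc z < 1 -> exists l, cder sqr_pole z l.
Proof.
move=> /sqr_pole_neq0 z1.
have hd : cder (fun w => 1 - w) z (0 - 1) by apply: cderB; [exact: cder_cst|exact: cder_id].
eexists; apply: (@cder_fV _ (fun w => (1 - w) ^+ 2)); first by rewrite expf_neq0.
exact: (cderM hd hd).
Qed.

(** [1 - z] and [1 - w] lie in the right half-plane, so equal squares force equality. *)
Lemma sqr_pole_inj z w : normc z < 1 -> normc w < 1 -> sqr_pole z = sqr_pole w -> z = w.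
Proof.
move=> z1 w1 /invr_inj /eqP; rewrite eqf_sqr => /orP[/eqP E|/eqP E].
  by apply: oppr_inj; apply: (addrI 1).
exfalso; have : complex.Re (1 - z) = complex.Re (- (1 - w)) by rewrite E.
rewrite opprB !ReB /= => ReE.
have := ler_Re_normc z; have := ler_Re_normc w.
rewrite !ler_norml => /andP[_ h1] /andP[_ h2]; lra.
Qed.

(** Half-open in the first coordinate, so that consecutive boxes are disjoint. The offset [3] gives
    [h <= 1/8], which leaves room for the constants of [pole_box_bounds]. *)
Definition pole_box (k : nat) : set RR :=
  let h : R := 2^-1 ^+ (k + 3) in `]1 - 2 * h, 1 - h]%classic `*` `[- (h / 2), h / 2]%classic.

Lemma pole_box_step (k : nat) : 0 < (2^-1 ^+ (k + 3) : R) <= 8^-1.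
Proof.
apply/andP; split; first by rewrite exprn_gt0 // invr_gt0.
have e8 : 2^-1 ^+ 3 = 8^-1 :> R by field.
by rewrite exprD e8 ler_piMl ?invr_ge0 // exprn_ile1 // ?invr_ge0 // invf_le1 // ler1n.
Qed.

Lemma measurable_pole_box k : measurable (pole_box k).
Proof. by apply: measurableX; exact: measurable_itv. Qed.

Lemma pole_box_area k : (mu \x mu)%E (pole_box k) = ((2^-1 ^+ (k + 3)) ^+ 2)%:E.
Proof.
have /andP[h0 _] := pole_box_step k.
rewrite /pole_box product_measure1E //=.
set h : R := 2^-1 ^+ (k + 3) in h0 *.
rewrite !lebesgue_measure_itv /= !lte_fin !ifT; [|lra|lra].
by rewrite -!EFinB -EFinM; congr EFin; rewrite expr2; field.
Qed.

Lemma trivIset_pole_box : trivIset setT pole_box.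
Proof.
have mono (j k : nat) : (j < k)%N -> 2 * (2^-1 ^+ (k + 3)) <= 2^-1 ^+ (j + 3) :> R.
  move=> jk; rewrite -(subnKC jk); set m := (k - j.+1)%N.
  have -> : (j.+1 + m + 3 = (j + 3 + m).+1)%N by rewrite addSn addSn addnAC.
  rewrite exprS mulrA mulfV ?pnatr_eq0 // mul1r exprD ler_piMr ?exprn_ge0 ?invr_ge0 //.
  by rewrite exprn_ile1 // ?invr_ge0 // invf_le1 // ler1n.
have disj (j k : nat) (p : RR) : (j < k)%N -> pole_box j p -> pole_box k p -> False.
  move=> /mono jk [/= + _] [/= + _]; rewrite !in_itv /= => /andP[_ h1] /andP[h2 _]; lra.
apply/trivIsetP => j k _ _; rewrite neq_ltn => /orP[] jk; apply/seteqP; split=> // p [pj pk].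
  exact: disj jk pj pk.
exact: disj jk pk pj.
Qed.

Lemma pole_box_bounds k (p : RR) : pole_box k p ->
  let h := 2^-1 ^+ (k + 3) in let z := p.1 +i* p.2 in
  [/\ 0 < normc (1 - z) ^+ 2, normc (1 - z) ^+ 2 <= 5 * h ^+ 2,
      h <= 1 - normc z ^+ 2 & 1 - normc z ^+ 2 <= 4 * h].
Proof.
move=> [hx hy] h z; move: hx hy; rewrite /= !in_itv /= -/h => /andP[x1 x2] /andP[y1 y2].
have /andP[h0 h8] : 0 < h <= 8^-1 by exact: pole_box_step.
have -> : normc (1 - z) ^+ 2 = (1 - p.1) ^+ 2 + p.2 ^+ 2.
  by rewrite sqr_normcE ReB ImB /=; ring.
rewrite (sqr_normc_disc p).
set x := p.1 in x1 x2 *; set y := p.2 in y1 y2 *.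
have y2h : y ^+ 2 <= h ^+ 2 / 4 by nra.
have yy : 0 <= y ^+ 2 by exact: sqr_ge0.
split.
- have hx : 0 < (1 - x) ^+ 2 by rewrite exprn_gt0 // subr_gt0; lra.
  by lra.
- nra.
- nra.
- nra.
Qed.

Lemma pole_box_disc k : pole_box k `<=` @disc R.
Proof.
move=> p /pole_box_bounds [_ _ h1 _]; have /andP[h0 _] := pole_box_step k.
by apply/in_disc; rewrite -sqr_normc_disc; lra.
Qed.

Lemma sqr_pole_not_lty c a : 0 < c -> a + 2 <= 2 * c ->
  ~ (\int[(mu \x mu)%E]_(p in @disc R)
     (normc (sqr_pole (p.1 +i* p.2)) `^ c * (1 - normc (p.1 +i* p.2) ^+ 2) `^ a)%:E < +oo)%E.
Proof.
move=> c0 ac.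
pose g (p : RR) : \bar R := (normc (sqr_pole (p.1 +i* p.2)) `^ c * (1 - normc (p.1 +i* p.2) ^+
  2) `^ a)%:E.
have g0 p : (0 <= g p)%E by rewrite lee_fin mulr_ge0 ?powR_ge0.
have mg : measurable_fun (@disc R) g.
  apply/measurable_EFinP; apply: measurable_funM; last first.
    by have /measurable_EFinP := @measurable_disc_powR R a.
  apply: (measurableT_comp (measurable_powR c)).
  apply: measurable_disc_normc => z /cder_sqr_pole[l]; exact: cder_ct.
(* Lower bound of [t^a] for [1 <= t <= 4], whatever the sign of [a]; it is applied to
   [t = (1 - |z|^2) / h]. *)
pose kap : R := Num.min 1 (4 `^ a).
have kap0 : 0 < kap by rewrite lt_min ltr01 powR_gt0.
pose d : R := kap * 5^-1 `^ c; have d0 : 0 < d by rewrite mulr_gt0 // powR_gt0 invr_gt0.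
have box k : (d%:E <= \int[(mu \x mu)%E]_(p in pole_box k) g p)%E.
  have /andP[] := pole_box_step k; set h : R := 2^-1 ^+ (k + 3) => h0 h8.
  pose M : R := (5 * h ^+ 2)^-1 `^ c * (kap * h `^ a).
  apply: (@le_trans _ _ (\int[(mu \x mu)%E]_(p in pole_box k) M%:E)%E).
    rewrite integral_cst; last exact: measurable_pole_box.
    rewrite [X in (_ * X)%E]pole_box_area -EFinM lee_fin -/h.
    have h21 : (h ^+ 2)^-1 = h `^ (- 2%:R) by rewrite powR_invn // ltW.
    have h22 : h ^+ 2 = h `^ 2%:R by rewrite powR_mulrn // ltW.
    have nz x : (x == 0) ==> (h != 0) by rewrite (gt_eqF h0) implybT.
    have -> : M * h ^+ 2 = d * (h `^ (- 2%:R * c) * h `^ a * h `^ 2%:R).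
      rewrite /M /d invfM powRM ?invr_ge0 ?exprn_ge0 ?(ltW h0) // h21 -h22 powRrM; ring.
    rewrite -!powRD // ler_peMr ?(ltW d0) //.
    (* The total exponent [a + 2 - 2 c] is at most [0] and [h <= 1]. *)
    apply: (@le_trans _ _ (h `^ 0)); first by rewrite powRr0.
    by apply: ger_powR; [rewrite h0; lra|lra].
  apply: ge0_le_integral => //.
  - exact: measurable_pole_box.
  - by move=> p _; rewrite lee_fin !mulr_ge0 ?powR_ge0 // ltW.
  - by apply: measurable_funS mg; [exact: measurable_disc|exact: pole_box_disc].
  move=> p /pole_box_bounds /=; rewrite -/h => -[b1 b2 b3 b4].
  rewrite lee_fin; apply: ler_pM; rewrite ?mulr_ge0 ?powR_ge0 ?(ltW kap0) //.
    apply: ge0_ler_powR; rewrite ?nnegrE ?(ltW c0) ?invr_ge0 ?normc_ge0 ?mulr_ge0 ?exprn_ge0 ?(ltW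
      h0) //.
    rewrite /sqr_pole Normc.normcV normcX lef_pV2 // posrE.
    by rewrite mulr_gt0 // exprn_gt0.
  set W := 1 - _ in b3 b4 *.
  have -> : W = W / h * h by rewrite divfK // gt_eqF.
  have t1 : 1 <= W / h by rewrite ler_pdivlMr // mul1r.
  have t4 : W / h <= 4 by rewrite ler_pdivrMr.
  rewrite powRM ?(ltW h0) //; last by lra.
  rewrite ler_wpM2r ?powR_ge0 // /kap ge_min.
  have [a0|a0] := leP 0 a.
    by rewrite -(powRr0 (W / h)) ler_powR.
  apply/orP; right; rewrite -[a]opprK !(powRN _ (- a)) lef_pV2 ?posrE ?powR_gt0 //; last by lra.
  by apply: ge0_ler_powR; rewrite ?nnegrE ?oppr_ge0 ?(ltW a0) //; lra.
move=> goo; pose U : set RR := \bigcup_k pole_box k.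
have Ud : U `<=` @disc R by move=> p [k _] /pole_box_disc.
have mU : measurable U by apply: bigcupT_measurable; exact: measurable_pole_box.
have E : (\int[(mu \x mu)%E]_(p in U) g p = \sum_(k <oo) \int[(mu \x mu)%E]_(p in pole_box k) g
  p)%E.
  apply: ge0_integral_bigcup => //.
  - exact: measurable_pole_box.
  - by apply: measurable_funS mg => //; exact: measurable_disc.
  - exact: trivIset_pole_box.
have lty : (\int[(mu \x mu)%E]_(p in U) g p < +oo)%E.
  by apply: le_lt_trans goo; apply: ge0_subset_integral => //; exact: measurable_disc.
have I0 : (0 <= \int[(mu \x mu)%E]_(p in U) g p)%E by apply: integral_ge0 => p _; exact: g0.
pose I : R := fine (\int[(mu \x mu)%E]_(p in U) g p).
have IE : (\int[(mu \x mu)%E]_(p in U) g p = I%:E)%E by rewrite /I fineK // ge0_fin_numE.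
(* More than [I / d] boxes already carry more than the total integral. *)
pose n := (Num.truncn (I / d)).+1.
have : ((n%:R * d)%:E <= I%:E)%E.
  rewrite -IE E; apply: le_trans (@nneseries_lim_ge _ _ xpredT 0%N n _); last first.
    by move=> k _ _; apply: integral_ge0 => p _; exact: g0.
  apply: (@le_trans _ _ (\sum_(0 <= k < n) d%:E)%E); last by apply: lee_sum => k _; exact: box.
  by rewrite sumEFin lee_fin sumr_const_nat subn0 mulr_natl.
rewrite lee_fin leNgt => /negP; apply.
by rewrite -ltr_pdivrMr // truncnS_gt.
Qed.

End sharpness.

(** For sharpness the witness is chosen before the exponents: a single map serves at the threshold
    and everywhere beyond it. *)
Theorem corollary1p1 (R : realType) :
  (forall f : R[i] -> R[i], conformal_mapping f ->
     forall p alpha : R, 0 < p -> -1 < alpha ->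
       0 < p / (alpha + 2) < 1 / 2 -> bergman_space p alpha f) /\
  (exists f : R[i] -> R[i], conformal_mapping f /\
     forall p alpha : R, 0 < p -> -1 < alpha ->
       1 / 2 <= p / (alpha + 2) -> ~ bergman_space p alpha f).
Proof.
split=> [f [fh fi] p a p0 a1 /andP[_ pa]|].
  split=> //; apply: bergman_bound => //.
  - by move=> z z1; apply/derivable_cderP; exact: fh.
  - by move=> z w z1 w1; apply: fi; rewrite inE.
  by move: pa; rewrite ltr_pdivrMr; lra.
exists (@sqr_pole R); split=> [|p a p0 a1 pa [_]].
  split=> [z z1|z w]; first by apply/derivable_cderP; exact: cder_sqr_pole.
  by rewrite !inE; exact: sqr_pole_inj.
apply: sqr_pole_not_lty => //.
by move: pa; rewrite ler_pdivlMr; lra.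
Qed.
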